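(* Let $\mathbf{D}\subset\mathbb{R}^2$ be the open unit disk, let $\alpha\in(0,4\pi]$, and let $\bar u_*\in\mathcal{M}_\alpha(\mathbf{D})$ be a radially symmetric positive optimizer. Then the first nonradial eigenvalue $\lambda_2^\circ(\alpha):=\min_{k\ge1}\lambda_1^{(k)}(\alpha)$ satisfies $$\Lambda_1^\circ(\alpha)<\lambda_2^\circ(\alpha).$$
   Context: For $\alpha\in(0,4\pi]$ set $\mathscr{E}_{\alpha,\mathbf{D}}(u)=\int_{\mathbf{D}}e^{\alpha u^2}dx$ and $\mathrm{TM}(\alpha,\mathbf{D})=\sup\{\mathscr{E}_{\alpha,\mathbf{D}}(u):u\in W^{1,2}_0(\mathbf{D}),\|\nabla u\|_{L^2(\mathbf{D})}\le1\}<\infty$. $\mathcal{M}_\alpha(\mathbf{D})$ is the set of optimizers, i.e. of $v\in W^{1,2}_0(\mathbf{D})$ with $\|\nabla v\|_{L^2(\mathbf{D})}\le1$ and $\mathscr{E}_{\alpha,\mathbf{D}}(v)=\mathrm{TM}(\alpha,\mathbf{D})$. $\Lambda_1^\circ(\alpha)=\inf_{v\in W^{1,2}_0(\mathbf{D})\setminus\{0\}}\frac{\int_{\mathbf{D}}|\nabla v|^2dx}{\int_{\mathbf{D}}v^2e^{\alpha\bar u_*^2}dx}$. Put $W_\alpha(\bar u_*(r))=(1+2\alpha\bar u_*(r)^2)e^{\alpha\bar u_*(r)^2}$ for $r=|x|\in(0,1)$. For an integer $k\ge1$, $\lambda_1^{(k)}(\alpha)$ is the first eigenvalue of the singular Sturm–Liouville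 problem $$-(r\phi')'+\frac{k^2}{r}\phi=\lambda\,r\,W_\alpha(\bar u_*(r))\,\phi\ \text{ in }(0,1),\qquad \phi(0)=\phi(1)=0,$$ i.e. the restriction of the problem $-\Delta\phi=\lambda(1+2\alpha\bar u_*^2)e^{\alpha\bar u_*^2}\phi$ in $\mathbf{D}$, $\phi=0$ on $\partial\mathbf{D}$, to the $k$-th angular Fourier mode (functions $\phi(r)\cos k\theta$, $\phi(r)\sin k\theta$). *)

(* Defs.v *)
From HB Require Import structures.
From mathcomp Require Import all_boot all_order all_algebra.
From mathcomp Require Import all_classical all_reals all_analysis.
Set Implicit Arguments.
Unset Strict Implicit.
Unset Printing Implicit Defensive.
Import Order.TTheory GRing.Theory Num.Theory.
Import numFieldNormedType.Exports.
Local Open Scope classical_set_scope.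
Local Open Scope ring_scope.

(* The plane is [R * R] with the product of the Lebesgue measures. The library
   norm of [R * R] is the max norm, hence the explicit Euclidean norm. *)
Definition leb2 (R : realType) := (@lebesgue_measure R \x @lebesgue_measure R)%E.

Definition enorm (R : realType) (p : R * R) : R := Num.sqrt (p.1 ^+ 2 + p.2 ^+ 2).

Definition disk (R : realType) : set (R * R) := [set p | enorm p < 1].
Arguments disk : clear implicits.

Definition ex (R : realType) : R * R := (1, 0).
Definition ey (R : realType) : R * R := (0, 1).
Arguments ex : clear implicits.
Arguments ey : clear implicits.

Fixpoint Cn (R : realType) (n : nat) (f : R * R -> R) : Prop :=
  if n is m.+1 then
    [/\ forall p, differentiable f p, Cn m ('D_(ex R) f) & Cn m ('D_(ey R) f)]
  else continuous f.

(* C_c^oo(D), its elements being extended by 0 to the whole plane *)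
Definition test_function (R : realType) (f : R * R -> R) : Prop :=
  (forall n, Cn n f) /\
  exists K, [/\ compact K, K `<=` disk R & forall p, ~ K p -> f p = 0].

Definition grad (R : realType) (f : R * R -> R) (p : R * R) : R * R :=
  ('D_(ex R) f p, 'D_(ey R) f p).

(* Square of the L^2(D) norm; functions on D are represented by functions on
   the plane, whose values outside D are never used. *)
Definition sqnorm (R : realType) (f : R * R -> R) : \bar R :=
  (\int[@leb2 R]_(p in disk R) (f p ^+ 2)%:E)%E.

Definition L2 (R : realType) (f : R * R -> R) : Prop :=
  measurable_fun (disk R) f /\ (sqnorm f < +oo)%E.

Definition sqnorm_vec (R : realType) (g : R * R -> R * R) : \bar R :=
  (\int[@leb2 R]_(p in disk R) (enorm (g p) ^+ 2)%:E)%E.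

Definition norm_vec (R : realType) (g : R * R -> R * R) : \bar R :=
  sqrte (sqnorm_vec g).

Definition weak_grad (R : realType) (u : R * R -> R) (g : R * R -> R * R) : Prop :=
  forall f, test_function f ->
    (\int[@leb2 R]_(p in disk R) (u p * 'D_(ex R) f p) =
       - \int[@leb2 R]_(p in disk R) ((g p).1 * f p)) /\
    (\int[@leb2 R]_(p in disk R) (u p * 'D_(ey R) f p) =
       - \int[@leb2 R]_(p in disk R) ((g p).2 * f p)).

(* [W12 u g]: u belongs to W^{1,2}(D) and g is (a version of) its gradient. *)
Definition W12 (R : realType) (u : R * R -> R) (g : R * R -> R * R) : Prop :=
  [/\ L2 u, L2 (fun p => (g p).1), L2 (fun p => (g p).2) & weak_grad u g].

Definition W012 (R : realType) (u : R * R -> R) (g : R * R -> R * R) : Prop :=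
  W12 u g /\
  exists f : nat -> R * R -> R,
    (forall n, test_function (f n)) /\
    (sqnorm (fun p => f n p - u p)%R + sqnorm_vec (fun p => grad (f n) p - g p)%R
       @[n --> \oo] --> 0)%E.

Definition TM_energy (R : realType) (alpha : R) (u : R * R -> R) : \bar R :=
  (\int[@leb2 R]_(p in disk R) (expR (alpha * u p ^+ 2))%:E)%E.

Definition admissible (R : realType) : set (R * R -> R) :=
  [set u | exists g, W012 u g /\ (norm_vec g <= 1)%E].

Definition TM (R : realType) (alpha : R) : \bar R :=
  ereal_sup [set TM_energy alpha u | u in @admissible R].

Definition optimizers (R : realType) (alpha : R) : set (R * R -> R) :=
  [set v | admissible v /\ TM_energy alpha v = TM alpha].

Definition radial (R : realType) (u : R * R -> R) : Prop :=
  forall p q, disk R p -> disk R q -> enorm p = enorm q -> u p = u q.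

(* Elements of W^{1,2}_0(D) are classes modulo a.e. equality, so "v <> 0"
   means that v is not a.e. zero in D. *)
Definition Lambda1 (R : realType) (alpha : R) (u : R * R -> R) : \bar R :=
  ereal_inf [set q | exists v g,
    [/\ W012 v g, ~ {ae @leb2 R, forall p, disk R p -> v p = 0} &
        q = (sqnorm_vec g /
             \int[@leb2 R]_(p in disk R)
               (v p ^+ 2 * expR (alpha * u p ^+ 2))%:E)%E]].

Definition profile (R : realType) (u : R * R -> R) (r : R) : R := u (r, 0).

Definition weight (R : realType) (alpha : R) (u : R * R -> R) (r : R) : R :=
  (1 + 2 * alpha * profile u r ^+ 2) * expR (alpha * profile u r ^+ 2).

(* [SL_eigen alpha u k lam phi]: phi is an eigenfunction, with eigenvalue lam,
   of
     - (r phi')' + k^2 / r phi = lam r W phi  in (0,1),  phi(0) = phi(1) = 0.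
   As u, hence W, is only determined up to null sets, the equation is taken in
   the Caratheodory sense (r phi' is locally absolutely continuous in (0,1) and
   the equation holds a.e.), i.e. integrated over [a, b] for 0 < a < b < 1. *)
Definition SL_eigen (R : realType) (alpha : R) (u : R * R -> R) (k : nat)
    (lam : R) (phi : R -> R) : Prop :=
  let F (r : R) := k%:R ^+ 2 / r * phi r - lam * (r * weight alpha u r * phi r) in
  [/\ exists2 r : R, 0 < r < 1 & phi r != 0,
      {within `[0, 1], continuous phi} /\ phi 0 = 0 /\ phi 1 = 0,
      forall r : R, 0 < r < 1 -> derivable phi r 1 &
      forall a b : R, 0 < a -> a < b -> b < 1 ->
        (@lebesgue_measure R).-integrable `[a, b] (EFin \o F) /\
        b * derive1 phi b - a * derive1 phi a =
          \int[@lebesgue_measure R]_(r in `[a, b]) F r].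

Definition SL_eigenvalues (R : realType) (alpha : R) (u : R * R -> R) (k : nat) :
    set R := [set lam | exists phi, SL_eigen alpha u k lam phi].

(* First eigenvalue and minimum over k >= 1, as infima in [\bar R]; by
   [lambda1_least] and [lambda2_min] these are the least elements as soon as
   the latter exist. *)
Definition lambda1 (R : realType) (alpha : R) (u : R * R -> R) (k : nat) : \bar R :=
  ereal_inf [set lam%:E | lam in SL_eigenvalues alpha u k].

Definition lambda2 (R : realType) (alpha : R) (u : R * R -> R) : \bar R :=
  ereal_inf [set lambda1 alpha u k | k in [set k | (1 <= k)%N]].

Lemma lambda1_least (R : realType) (alpha : R) (u : R * R -> R) (k : nat) (lam : R) :
  SL_eigenvalues alpha u k lam -> lbound (SL_eigenvalues alpha u k) lam ->
  lambda1 alpha u k = lam%:E.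
Proof.
move=> lamE lamlb; apply/le_anti/andP; split.
  by apply: ereal_inf_lbound; exists lam.
by apply: le_ereal_inf_tmp => _ [mu muE <-]; rewrite lee_fin; exact: lamlb.
Qed.

Lemma lambda2_min (R : realType) (alpha : R) (u : R * R -> R) (k : nat) :
  (1 <= k)%N ->
  (forall j, (1 <= j)%N -> (lambda1 alpha u k <= lambda1 alpha u j)%E) ->
  lambda2 alpha u = lambda1 alpha u k.
Proof.
move=> k1 kmin; apply/le_anti/andP; split.
  by apply: ereal_inf_lbound; exists k.
by apply: le_ereal_inf_tmp => _ [j j1 <-]; exact: kmin.
Qed.

(* Main.v *)
(* The first variation at the optimizer gives -Delta u = u e^{alpha u^2} / I
   with I = int_D u^2 e^{alpha u^2}; testing the quotient with u itself yields
   Lambda1 <= |grad u|^2 / I <= 1 / I. In the radial variable the equation is an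
   ODE, and w = - U', U being the profile of u, is a positive solution of the
   problem of the mode k = 1 with eigenvalue 1 / I, except that w(1) <> 0. The
   product of w with 3 - r^2 - r^3 is a strict supersolution: it satisfies the
   differential inequality with some kappa > 1 / I. Picone's identity against
   this supersolution shows that every eigenvalue of a mode k >= 1 is at least
   kappa, hence lambda2 >= kappa > 1 / I >= Lambda1. *)
Require Import Defs.
From HB Require Import structures.
From mathcomp Require Import all_boot all_order all_algebra.
From mathcomp Require Import all_classical all_reals all_analysis.
From mathcomp Require Import measurable_realfun ring lra.
Set Implicit Arguments.
Unset Strict Implicit.
Unset Printing Implicit Defensive.
Import Order.TTheory GRing.Theory Num.Theory.
Import numFieldNormedType.Exports.
Local Open Scope classical_set_scope.
Local Open Scope ring_scope.

Local Notation I01 R := (`[(0%R : R), 1%R[%classic).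
Local Notation leb R := (@lebesgue_measure R).
Local Notation plane R := (measurableTypeR R * measurableTypeR R)%type.

(** An optimizer is only a class in $W^{1,2}_0$ that may a priori be unbounded at the centre, so the
    ODE of its profile has to be earned. Radial quantities are written in $t=|p|^2$: the map
    $p\mapsto|p|^2$ sends plane measure to a constant times Lebesgue measure, which takes the place
    of polar coordinates. The weak gradient represents the profile a.e. by an integral of the radial
    flux; the energy of small disks being small, the profile grows at most like a small multiple of
    $\sqrt{\ln(1/t)}$, so $e^{bu^2}$ is integrable for every $b$. This legitimates the first
    variation and then bounds the profile. [lambda2] is an infimum over all modes and all
    eigenvalues: knowing that each eigenvalue exceeds $1/I$ would still allow equality in the limit.
    One $\kappa>1/I$ must serve them all, which is why $w$ is corrected by a factor instead of being
    compared with directly. [SL_eigen] says nothing on $\phi'$ at 0 and 1, so the boundary terms of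
    Picone's identity are controlled only at well chosen points. *)

Definition sqn (R : realType) (p : R * R) : R := p.1 ^+ 2 + p.2 ^+ 2.

Lemma sqn_ge0 (R : realType) (p : R * R) : 0 <= sqn p.
Proof. by rewrite addr_ge0 ?sqr_ge0. Qed.

Lemma diskE (R : realType) : disk R = @sqn R @^-1` `[0, 1[.
Proof.
apply/seteqP; split => p /=; rewrite in_itv/= sqn_ge0/= /disk/= /enorm -/(sqn p).
  by rewrite -{1}sqrtr1 ltr_sqrt.
by move=> h; rewrite -sqrtr1 ltr_sqrt.
Qed.

Lemma measurable_sqn (R : realType) :
  measurable_fun setT (@sqn R : measurableTypeR R * measurableTypeR R -> measurableTypeR R).
Proof.
apply: measurable_funD; apply: measurable_funX; [exact: measurable_fst|exact: measurable_snd].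
Qed.

Lemma measurable_disk (R : realType) : measurable (disk R : set (plane R)).
Proof.
rewrite diskE -[X in measurable X]setTI; apply: measurable_sqn => //.
Qed.

(** * Areas of disks and the image of plane measure under the squared radius *)

Lemma continuous_half_disk (R : realType) (s : R) :
  continuous (fun x : R => 2 * Num.sqrt (s ^+ 2 - x ^+ 2)).
Proof.
move=> x; apply: cvgM; first exact: cvg_cst.
apply: (@continuous_comp _ _ _ (fun x : R => s ^+ 2 - x ^+ 2) (@Num.sqrt R)); last exact: sqrt_continuous.
by apply: cvgB; [exact: cvg_cst|apply: exprn_continuous].
Qed.

Lemma ge0_integral_dilation (R : realType) (s : R) (G : R -> R) : 0 < s ->
  continuous G -> (forall x, 0 <= G x) ->
  (\int[leb R]_x (G x)%:E =
   s%:E * \int[leb R]_x (G (s * x)%R)%:E)%E.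
Proof.
move=> s0 cG G0.
have ds : derive1 (fun x : R => s * x) = cst s.
  by apply/funext => x; rewrite derive1E (_ : (fun x => s * x) = s *: (@id R))//;
    rewrite deriveZ// derive_id/= /GRing.scale/= mulr1.
rewrite (@increasing_ge0_integration_by_substitutionT _ (fun x => s * x))//; last 6 first.
- by move=> x y xy; rewrite ltr_pM2l.
- by rewrite ds => x; exact: cst_continuous.
- by rewrite ds; exact: is_cvg_cst.
- by rewrite ds; exact: is_cvg_cst.
- exact: gt0_cvgMrNy.
- exact: gt0_cvgMry.
rewrite ds -ge0_integralZl//=; last 3 first.
- apply/measurable_EFinP; apply: continuous_measurable_fun => x.
  by apply: (@continuous_comp _ _ _ (fun x : R => s * x) G); [exact: mulrl_continuous|exact: cG].
- by move=> x _; rewrite lee_fin.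
- by rewrite lee_fin ltW.
by apply: eq_integral => x _; rewrite -EFinM mulrC.
Qed.

(** The number is $\pi$. Only its finiteness and positivity enter, and it cancels from the equation
    of the profile. Since [fine] would turn an infinite measure into 0, finiteness is proved in
    [disk_areaE] by enclosing the disk in a square. *)
Definition disk_area (R : realType) : R := fine (@leb2 R (@sqn R @^-1` `]-oo, 1%R])).

(** Slicing by vertical lines: the section over $x$ is an interval of half-length $\sqrt{t-x^2}$.
    For $x^2>t$ the section is empty, in agreement with the value 0 of [Num.sqrt] at negative
    numbers. *)
Lemma leb2_sqn_le (R : realType) (t : R) : 0 <= t ->
  @leb2 R (@sqn R @^-1` `]-oo, t]) =
  (\int[leb R]_x (2 * Num.sqrt (t - x ^+ 2))%:E)%E.
Proof.
move=> t0; rewrite /leb2 /product_measure1 /=.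
apply: eq_integral => x _ /=.
have [tx|tx] := leP (x ^+ 2) t.
  rewrite (_ : xsection _ x = `[- Num.sqrt (t - x ^+ 2), Num.sqrt (t - x ^+ 2)]%classic).
    rewrite lebesgue_measure_itv/= lte_fin -EFinB.
    case: ltP => h; first by congr EFin; ring.
    have := sqrtr_ge0 (t - x ^+ 2); rewrite le_eqVlt => /predU1P[<-|h']; first by rewrite mulr0.
    by exfalso; lra.
  apply/seteqP; split => y /=; rewrite /xsection/= in_itv/= ?inE/=.
    rewrite /sqn/= -ler_norml in_itv/= => h.
    by rewrite -sqrtr_sqr ler_sqrt; lra.
  rewrite /sqn/= -ler_norml in_itv/= -sqrtr_sqr ler_sqrt; first by lra.
  lra.
rewrite (_ : xsection _ x = set0); last first.
  apply/seteqP; split => y //=; rewrite /xsection/= inE/= /sqn/= in_itv/=.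
  have := sqr_ge0 y; lra.
by rewrite measure0 ler0_sqrtr ?mulr0//; lra.
Qed.

(** The dilation by $\sqrt t$ contributes one factor $\sqrt t$ from the measure in $x$ and another
    from the length of the slices. The case $t=0$ is apart because a dilation has a positive
    ratio. *)
Lemma leb2_sqn_le_scale (R : realType) (t : R) : 0 <= t ->
  @leb2 R (@sqn R @^-1` `]-oo, t]) = (t%:E * @leb2 R (@sqn R @^-1` `]-oo, 1%R]))%E.
Proof.
rewrite le_eqVlt => /predU1P[<-|t0].
  rewrite mul0e leb2_sqn_le// integral0_eq// => x _.
  by rewrite ler0_sqrtr ?mulr0// sub0r oppr_le0 sqr_ge0.
rewrite !leb2_sqn_le ?(ltW t0)//.
have s0 : 0 < Num.sqrt t by rewrite sqrtr_gt0.
rewrite -(sqr_sqrtr (ltW t0)).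
set s := Num.sqrt t in s0 *.
rewrite (ge0_integral_dilation s0 (@continuous_half_disk _ _)); last first.
  by move=> x; rewrite mulr_ge0// sqrtr_ge0.
rewrite expr2 EFinM -muleA; congr (_ * _)%E.
have -> : (fun x : measurableTypeR R => (2 * Num.sqrt (s * s - (s * x) ^+ 2))%:E) = (fun x => s%:E * (2 * Num.sqrt (1 - x ^+ 2))%:E)%E.
  apply/funext => x; rewrite -EFinM; congr EFin.
  have -> : s * s - (s * x) ^+ 2 = s ^+ 2 * (1 - x ^+ 2) by ring.
  rewrite sqrtrM ?sqr_ge0// sqrtr_sqr gtr0_norm//; ring.
rewrite ge0_integralZl//.
- apply/measurable_EFinP; apply: continuous_measurable_fun.
  by have := @continuous_half_disk R 1; rewrite expr1n.
- by rewrite lee_fin ltW.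
Qed.

Lemma leb2_box (R : realType) (a b c d : R) : a <= b -> c <= d ->
  @leb2 R (`[a, b]%classic `*` `[c, d]%classic) = ((b - a) * (d - c))%:E.
Proof.
move=> ab cd; rewrite /leb2 product_measure1E//= !lebesgue_measure_itv/= !lte_fin.
rewrite EFinM; congr (_ * _)%E.
  by move: ab; rewrite le_eqVlt => /predU1P[->|->//]; rewrite ltxx subrr.
by move: cd; rewrite le_eqVlt => /predU1P[->|->//]; rewrite ltxx subrr.
Qed.

Lemma measurable_preimage_sqn (R : realType) (A : set (measurableTypeR R)) :
  measurable A -> measurable (@sqn R @^-1` A : set (plane R)).
Proof. by move=> mA; rewrite -[X in measurable X]setTI; apply: measurable_sqn. Qed.

Lemma sqr_le1_itv (R : realType) (x : R) : x ^+ 2 <= 1 -> -1 <= x <= 1.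
Proof. by move=> h; apply/andP; split; nra. Qed.

Lemma disk_areaE (R : realType) :
  @leb2 R (@sqn R @^-1` `]-oo, 1%R]) = (disk_area R)%:E.
Proof.
rewrite /disk_area fineK// ge0_fin_numE ?measure_ge0//.
apply: (@le_lt_trans _ _ (@leb2 R (`[-1, 1]%classic `*` `[-1, 1]%classic))).
  apply: le_measure; rewrite ?inE.
  - exact: measurable_preimage_sqn.
  - by apply: measurableX.
  - move=> [x y]; rewrite /sqn/= !in_itv/= => h.
    by split; apply: sqr_le1_itv; have := sqr_ge0 x; have := sqr_ge0 y; lra.
by rewrite leb2_box ?ltry//; lra.
Qed.

Lemma disk_area_gt0 (R : realType) : 0 < disk_area R.
Proof.
rewrite -lte_fin -disk_areaE.
apply: (@lt_le_trans _ _ (@leb2 R (`[0, 1/2]%classic `*` `[0, 1/2]%classic))).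
  by rewrite leb2_box ?lte_fin; lra.
apply: le_measure; rewrite ?inE.
- by apply: measurableX.
- exact: measurable_preimage_sqn.
- by move=> [x y]; rewrite /sqn/= !in_itv/= => -[hx hy]; nra.
Qed.

HB.instance Definition _ (R : realType) := Measure.on (@leb2 R).
(** Exhaustion by the disks $|p|^2\le n$. The instance is what lets the Fubini argument of the
    layer-cake formula apply to [leb2]. *)
Lemma sigma_finite_leb2 (R : realType) : sigma_finite setT (@leb2 R).
Proof. exists (fun n : nat => @sqn R @^-1` `]-oo, n%:R]).
  apply/esym/seteqP; split => p // _.
  exists (Num.bound (sqn p)) => //=.
  by rewrite in_itv/=; apply/ltW/archi_boundP/sqn_ge0.
move=> n; split; first exact: measurable_preimage_sqn.
by have /= := leb2_sqn_le_scale (ler0n R n); rewrite /leb2 => ->; have /= := disk_areaE R; rewrite /leb2 => ->; rewrite -EFinM ltry.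
Qed.
HB.instance Definition _ (R : realType) := @Measure_isSigmaFinite.Build _ _ _ (@leb2 R) (@sigma_finite_leb2 R).

Lemma leb2_sqn_itv (R : realType) (a b : R) : 0 <= a -> a <= b ->
  @leb2 R (@sqn R @^-1` `]a, b]) = ((disk_area R) * (b - a))%:E.
Proof.
move=> a0 ab; have b0 := le_trans a0 ab.
have -> : @sqn R @^-1` `]a, b] = (@sqn R @^-1` `]-oo, b]) `\` (@sqn R @^-1` `]-oo, a]).
  by apply/seteqP; split => p /=; rewrite !in_itv/=; [move=> /andP[? ->]; split => //; apply/negP; rewrite -ltNge|move=> [-> /negP]; rewrite -ltNge => ->].
rewrite measureD//=; [|exact: measurable_preimage_sqn|exact: measurable_preimage_sqn|].
  rewrite setIidr; last first.
    by move=> p /=; rewrite !in_itv/= => /le_trans; exact.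
  have /= := leb2_sqn_le_scale a0; have /= := leb2_sqn_le_scale b0; rewrite /leb2 => -> ->.
  have /= := disk_areaE R; rewrite /leb2 => ->.
  by rewrite -!EFinM -EFinB; congr EFin; ring.
have /= := leb2_sqn_le_scale b0; rewrite /leb2 => ->.
by have /= := disk_areaE R; rewrite /leb2 => ->; rewrite -EFinM ltry.
Qed.

(** Both sides are measures in $A$ that agree on half-open intervals, a family stable under
    intersection, and are finite on $]-n,n]$; uniqueness of measures concludes. The half-line
    appears because [sqn] takes no negative value. *)
Lemma leb2_preimage_sqn (R : realType) (A : set (measurableTypeR R)) : measurable A ->
  @leb2 R (@sqn R @^-1` A) = ((disk_area R)%:E * leb R (A `&` `[(0:R)%R, +oo[%classic))%E.
Proof.
move=> mA.
have c0 := ltW (disk_area_gt0 R).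
have mp : measurable (`[(0:R), +oo[%classic : set (measurableTypeR R)) by [].
pose m1 := pushforward (@leb2 R) (@sqn R).
pose m2 := mscale (NngNum c0) (mrestr (leb R) mp).
have key (a b : R) : m1 `]a, b]%classic = m2 `]a, b]%classic.
  rewrite /m1 /m2 /pushforward /mscale/= /mrestr.
  have [ab|ba] := ltP b a.
    by rewrite set_itv_ge ?bnd_simp -?leNgt ?(ltW ab)// preimage_set0 set0I !measure0 mule0.
  have [b0|b0] := ltP b 0.
    rewrite (_ : @sqn R @^-1` _ = set0); last first.
      apply/seteqP; split => p //=; rewrite in_itv/= => /andP[_ h].
      by have := le_lt_trans h b0; rewrite ltNge sqn_ge0.
    rewrite (_ : _ `&` _ = set0) ?measure0 ?mule0//.
    apply/seteqP; split => p //=; rewrite !in_itv/= => -[/andP[_ h] /andP[h' _]].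
    by have := le_lt_trans h b0; rewrite ltNge h'.
  have [a0|a0] := leP 0 a.
    rewrite (_ : `]a, b] `&` _ = `]a, b]%classic); last first.
      by apply/setIidPl => x /=; rewrite !in_itv/= => /andP[/ltW /(le_trans a0) ->].
    have /= := leb2_sqn_itv a0 ba; rewrite /leb2 => ->.
    rewrite lebesgue_measure_itv/= lte_fin -EFinB EFinM; congr (_ * _)%E.
    by move: ba; rewrite le_eqVlt => /predU1P[->|->//]; rewrite ltxx subrr.
  rewrite (_ : `]a, b] `&` _ = `[0, b]%classic); last first.
    apply/seteqP; split => x /=; rewrite !in_itv/=.
      by move=> [/andP[_ ->]]; rewrite andbT => ->.
    by move=> /andP[x0 ->]; rewrite x0 (lt_le_trans a0 x0).
  rewrite (_ : @sqn R @^-1` _ = @sqn R @^-1` `]-oo, b]); last first.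
    apply/seteqP; split => p /=; rewrite !in_itv/=; first by move=> /andP[].
    by move=> ->; rewrite (lt_le_trans a0 (sqn_ge0 p)).
  have /= := leb2_sqn_le_scale b0; rewrite /leb2 => ->; have /= := disk_areaE R; rewrite /leb2 => ->.
  rewrite lebesgue_measure_itv/= lte_fin -EFinB subr0 muleC; congr (_ * _)%E.
  by move: b0; rewrite le_eqVlt => /predU1P[<-|->]; rewrite ?ltxx.
suff -> : @leb2 R (@sqn R @^-1` A) = m2 A by [].
rewrite -[LHS]/(m1 A).
pose M1 : {measure set (measurableTypeR R) -> \bar R} := @pushforward _ _ (measurableTypeR R * measurableTypeR R)%type (measurableTypeR R) R (@leb2 R) (@sqn R).
pose M2 : {measure set (measurableTypeR R) -> \bar R} := mscale (NngNum c0) (mrestr (leb R) mp).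
apply: (@measure_unique _ R (measurableTypeR R) (@ocitv R) (fun n : nat => `]-n%:R, n%:R]%classic) _ _ _ _ (M1 (@measurable_sqn R)) M2) => //=.
- exact: ocitvI.
- by move=> n; exists (-n%:R, n%:R).
- apply/seteqP; split => x // _.
  exists (Num.bound `|x : R|) => //=; rewrite in_itv/=.
  have /ltr_normlP[h1 h2] := archi_boundP (normr_ge0 (x : R)).
  by rewrite (ltW h2) andbT ltrNl.
- by move=> _ [[a b] _ <-]; exact: key.
- move=> n; apply: (@le_lt_trans _ _ (m1 `]-oo, n%:R]%classic)).
    rewrite /m1 /pushforward; apply: le_measure; rewrite ?inE.
    - exact: measurable_preimage_sqn.
    - exact: measurable_preimage_sqn.
    - by move=> p /=; rewrite !in_itv/= => /andP[].
  have /= := leb2_sqn_le_scale (ler0n R n); rewrite /m1 /pushforward /leb2 => ->.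
  by have /= := disk_areaE R; rewrite /leb2 => ->; rewrite -EFinM ltry.
Qed.

Lemma pushforward_sqn_itv (R : realType) (A : set (measurableTypeR R)) : measurable A ->
  A `<=` (I01 R) ->
  pushforward (@leb2 R) (@sqn R) A = ((disk_area R)%:E * leb R A)%E.
Proof.
move=> mA A01; rewrite /pushforward leb2_preimage_sqn//.
by rewrite (setIidl (B := `[(0:R), +oo[%classic))// => x /A01 /=; rewrite !in_itv/= => /andP[->].
Qed.

Lemma ge0_integral_disk_radial (R : realType) (h : R -> \bar R) :
  measurable_fun (I01 R) h -> (forall t, 0 <= t < 1 -> (0 <= h t)%E) ->
  (\int[@leb2 R]_(p in disk R) h (sqn p) =
   (disk_area R)%:E * \int[leb R]_(t in (I01 R)) h t)%E.
Proof.
move=> mh h0; rewrite diskE.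
have c0 := ltW (disk_area_gt0 R).
rewrite -[LHS](@ge0_integral_pushforward _ _ _ _ R _ (@measurable_sqn R) (@leb2 R) (I01 R) h)//; last first.
  by move=> t; rewrite inE/= in_itv/=; exact: h0.
rewrite (eq_measure_integral (mscale (NngNum c0) (leb R))).
- by rewrite ge0_integral_mscale//; move=> t; rewrite /= in_itv/=; exact: h0.
- exact: measurable_sqn.
- by move=> mq A mA A01; exact: pushforward_sqn_itv.
Qed.

Lemma integrable_disk_radial (R : realType) (h : R -> R) :
  measurable_fun (I01 R) h ->
  (leb R).-integrable (I01 R) (EFin \o h) <->
  (@leb2 R).-integrable (disk R) (EFin \o (h \o @sqn R)).
Proof.
move=> mh.
have mhq : measurable_fun (disk R : set (plane R)) (h \o @sqn R).
  apply: (measurable_comp (F := (I01 R))) => //.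
    by rewrite diskE => _ [p /= h1 <-].
  by apply: measurable_funTS; exact: measurable_sqn.
have mah : measurable_fun (I01 R) (fun t => `|(h t)%:E|%E).
  by apply/measurable_EFinP; exact: measurableT_comp.
have := ge0_integral_disk_radial mah (fun _ _ => abse_ge0 _).
have c0 := disk_area_gt0 R.
split => /integrableP[_ hi]; apply/integrableP; split.
- exact/measurable_EFinP.
- by move: H => /= ->; rewrite lte_mul_pinfty// lee_fin ltW.
- exact/measurable_EFinP.
- move: hi; rewrite H /=; case: (integral _ _ _) => //=.
  + by move=> r _; rewrite ltry.
  + by rewrite gt0_muley ?lte_fin.
Qed.

Lemma Rintegral_disk_radial (R : realType) (h : R -> R) :
  (leb R).-integrable (I01 R) (EFin \o h) ->
  \int[@leb2 R]_(p in disk R) h (sqn p) =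
  disk_area R * \int[leb R]_(t in (I01 R)) h t.
Proof.
move=> ih.
have mh : measurable_fun (I01 R) (EFin \o h) by case/integrableP : ih.
have c0 := ltW (disk_area_gt0 R).
rewrite /Rintegral integralE [X in _ = _ * fine X]integralE.
have hp := ge0_integral_disk_radial (measurable_funepos mh) (fun t _ => funepos_ge0 _ t).
have hn := ge0_integral_disk_radial (measurable_funeneg mh) (fun t _ => funeneg_ge0 _ t).
rewrite (_ : (fun p => (h (sqn p))%:E) = (EFin \o h) \o @sqn R)//.
rewrite funepos_comp funeneg_comp/= hp hn.
have mI : measurable (I01 R : set (measurableTypeR R)) by [].
have fp := integrable_fin_num mI (integrable_funepos mI ih).
have fn := integrable_fin_num mI (integrable_funeneg mI ih).
rewrite -(fineK fp) -(fineK fn) -!EFinM -!EFinB/=; ring.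
Qed.

(** * Test functions *)

Lemma CnSP (R : realType) (n : nat) (f : R * R -> R) : Cn n.+1 f <->
  [/\ forall p, differentiable f p, Cn n ('D_(ex R) f) & Cn n ('D_(ey R) f)].
Proof. exact: iff_refl. Qed.

Lemma Cn_le (R : realType) (n : nat) (f : R * R -> R) : Cn n.+1 f -> Cn n f.
Proof.
elim: n f => [|n ih] f /CnSP[df d1 d2]; first by move=> p; exact: differentiable_continuous.
by apply/CnSP; split; [exact: df|exact: ih d1|exact: ih d2].
Qed.

Lemma Cn_cst (R : realType) (n : nat) (c : R) : Cn n (fun _ : R * R => c).
Proof.
elim: n c => [|n ih] c; first by move=> p; exact: cvg_cst.
apply/CnSP; split.
- by move=> p; apply: differentiable_cst.
- rewrite (_ : 'D_ _ _ = fun=> 0); first exact: ih.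
  by apply/funext => p; rewrite derive_cst.
- rewrite (_ : 'D_ _ _ = fun=> 0); first exact: ih.
  by apply/funext => p; rewrite derive_cst.
Qed.

Lemma CnD (R : realType) (n : nat) (f g : R * R -> R) : Cn n f -> Cn n g ->
  Cn n (fun p => f p + g p).
Proof.
elim: n f g => [|n ih] f g /=; first by move=> cf cg p; apply: cvgD; [exact: cf|exact: cg].
move=> [df f1 f2] [dg g1 g2]; split.
- by move=> p; apply: differentiableD.
- rewrite (_ : 'D_ _ _ = fun p => 'D_(ex R) f p + 'D_(ex R) g p); first exact: ih.
  by apply/funext => p; rewrite deriveD//; apply: diff_derivable.
- rewrite (_ : 'D_ _ _ = fun p => 'D_(ey R) f p + 'D_(ey R) g p); first exact: ih.
  by apply/funext => p; rewrite deriveD//; apply: diff_derivable.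
Qed.

Lemma CnM (R : realType) (n : nat) (f g : R * R -> R) : Cn n f -> Cn n g ->
  Cn n (fun p => f p * g p).
Proof.
elim: n f g => [|n ih] f g; first by move=> cf cg p; apply: cvgM; [exact: cf|exact: cg].
move=> Cf Cg; have Cf' := Cn_le Cf; have Cg' := Cn_le Cg.
case: Cf Cg => [df f1 f2] [dg g1 g2]; split.
- by move=> p; apply: differentiableM.
- rewrite (_ : 'D_ _ _ = fun p => f p * 'D_(ex R) g p + g p * 'D_(ex R) f p).
    by apply: CnD; apply: ih.
  by apply/funext => p; rewrite deriveM//; apply: diff_derivable.
- rewrite (_ : 'D_ _ _ = fun p => f p * 'D_(ey R) g p + g p * 'D_(ey R) f p).
    by apply: CnD; apply: ih.
  by apply/funext => p; rewrite deriveM//; apply: diff_derivable.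
Qed.

Lemma continuous_fst2 (R : realType) : continuous (@fst R R).
Proof. by move=> p; exact: cvg_fst. Qed.

Lemma continuous_snd2 (R : realType) : continuous (@snd R R).
Proof. by move=> p; exact: cvg_snd. Qed.

Lemma differentiable_fst2 (R : realType) (p : R * R) : differentiable (@fst R R) p.
Proof. exact/linear_differentiable/continuous_fst2. Qed.

Lemma differentiable_snd2 (R : realType) (p : R * R) : differentiable (@snd R R) p.
Proof. exact/linear_differentiable/continuous_snd2. Qed.

Lemma derive_fst (R : realType) (v p : R * R) : 'D_v fst p = v.1.
Proof.
rewrite deriveE; last exact: differentiable_fst2.
by rewrite diff_lin//; exact: continuous_fst2.
Qed.

Lemma derive_snd (R : realType) (v p : R * R) : 'D_v snd p = v.2.
Proof.
rewrite deriveE; last exact: differentiable_snd2.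
by rewrite diff_lin//; exact: continuous_snd2.
Qed.

Lemma Cn_fst (R : realType) (n : nat) : Cn n (@fst R R).
Proof.
case: n => [|n]; first by move=> p; exact: cvg_fst.
split.
- by move=> p; exact: differentiable_fst2.
- by rewrite (_ : 'D_ _ _ = fun=> (1 : R)); [exact: Cn_cst|apply/funext => p; rewrite derive_fst].
- by rewrite (_ : 'D_ _ _ = fun=> (0 : R)); [exact: Cn_cst|apply/funext => p; rewrite derive_fst].
Qed.

Lemma Cn_snd (R : realType) (n : nat) : Cn n (@snd R R).
Proof.
case: n => [|n]; first by move=> p; exact: cvg_snd.
split.
- by move=> p; exact: differentiable_snd2.
- by rewrite (_ : 'D_ _ _ = fun=> (0 : R)); [exact: Cn_cst|apply/funext => p; rewrite derive_snd].
- by rewrite (_ : 'D_ _ _ = fun=> (1 : R)); [exact: Cn_cst|apply/funext => p; rewrite derive_snd].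
Qed.

Fixpoint Cn1 (R : realType) (n : nat) (f : R -> R) : Prop :=
  if n is m.+1 then (forall x, derivable f x 1) /\ Cn1 m (derive1 f) else continuous f.

Lemma Cn1_le (R : realType) (n : nat) (f : R -> R) : Cn1 n.+1 f -> Cn1 n f.
Proof.
elim: n f => [|n ih] f [df d1]; last by split; [exact: df|exact: ih].
by move=> x; apply: differentiable_continuous; apply/derivable1_diffP.
Qed.

Lemma derive_comp1 (R : realType) (h : R -> R) (f : R * R -> R) (v p : R * R) :
  derivable h (f p) 1 -> differentiable f p ->
  'D_v (h \o f) p = derive1 h (f p) * 'D_v f p.
Proof.
move=> /derivable1_diffP dh df.
rewrite deriveE; last exact: differentiable_comp.
by rewrite diff_comp//= (deriveE _ df) derive1E' // -[in LHS](mulr1 ('d f p v)) linearZ mulrC.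
Qed.

Lemma Cn_comp (R : realType) (n : nat) (h : R -> R) (f : R * R -> R) :
  Cn1 n h -> Cn n f -> Cn n (h \o f).
Proof.
elim: n h f => [|n ih] h f; first by move=> ch cf p; apply: continuous_comp; [exact: cf|exact: ch].
move=> Ch Cf; have Cf' := Cn_le Cf; case: Ch Cf => [dh ch] [df f1 f2]; split.
- by move=> p; apply: differentiable_comp => //; apply/derivable1_diffP.
- rewrite (_ : 'D_ _ _ = fun p => (derive1 h \o f) p * 'D_(ex R) f p).
    by apply: CnM => //; apply: ih.
  by apply/funext => p; rewrite derive_comp1.
- rewrite (_ : 'D_ _ _ = fun p => (derive1 h \o f) p * 'D_(ey R) f p).
    by apply: CnM => //; apply: ih.
  by apply/funext => p; rewrite derive_comp1.
Qed.

Lemma Cn_sqn (R : realType) (n : nat) : Cn n (@sqn R).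
Proof.
rewrite (_ : @sqn R = fun p => p.1 * p.1 + p.2 * p.2).
  by apply: CnD; apply: CnM; [exact: Cn_fst|exact: Cn_fst|exact: Cn_snd|exact: Cn_snd].
by apply/funext => p; rewrite /sqn !expr2.
Qed.

Lemma differentiable_sqn (R : realType) (p : R * R) : differentiable (@sqn R) p.
Proof. by case: (@Cn_sqn R 1). Qed.

Lemma derive_sqn (R : realType) (v p : R * R) : 'D_v (@sqn R) p = 2 * (p.1 * v.1 + p.2 * v.2).
Proof.
rewrite (_ : @sqn R = (@fst R R * @fst R R) + (@snd R R * @snd R R)); last first.
  by apply/funext => q; rewrite /sqn !expr2.
have d1 q : derivable (@fst R R) q v by apply: diff_derivable; case: (@Cn_fst R 1).
have d2 q : derivable (@snd R R) q v by apply: diff_derivable; case: (@Cn_snd R 1).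
rewrite deriveD; [|exact: derivableM|exact: derivableM].
rewrite !deriveM// derive_fst derive_snd /GRing.scale/=; ring.
Qed.

Lemma Cn1SP (R : realType) (n : nat) (f : R -> R) : Cn1 n.+1 f <->
  (forall x, derivable f x 1) /\ Cn1 n (derive1 f).
Proof. exact: iff_refl. Qed.

Lemma Cn1D (R : realType) (n : nat) (f g : R -> R) : Cn1 n f -> Cn1 n g ->
  Cn1 n (fun x => f x + g x).
Proof.
elim: n f g => [|n ih] f g; first by move=> cf cg p; apply: cvgD; [exact: cf|exact: cg].
move=> /Cn1SP[df f1] /Cn1SP[dg g1]; apply/Cn1SP; split.
- by move=> x; apply: derivableD.
- rewrite (_ : derive1 _ = fun x => derive1 f x + derive1 g x); first exact: ih.
  by apply/funext => x; rewrite !derive1E deriveD.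
Qed.

Lemma Cn1M (R : realType) (n : nat) (f g : R -> R) : Cn1 n f -> Cn1 n g ->
  Cn1 n (fun x => f x * g x).
Proof.
elim: n f g => [|n ih] f g; first by move=> cf cg p; apply: cvgM; [exact: cf|exact: cg].
move=> Cf Cg; have Cf' := Cn1_le Cf; have Cg' := Cn1_le Cg.
move: Cf Cg => /Cn1SP[df f1] /Cn1SP[dg g1]; apply/Cn1SP; split.
- by move=> x; apply: derivableM.
- rewrite (_ : derive1 _ = fun x => f x * derive1 g x + g x * derive1 f x).
    by apply: Cn1D; apply: ih.
  by apply/funext => x; rewrite !derive1E deriveM.
Qed.

Lemma Cn1_cst (R : realType) (n : nat) (c : R) : Cn1 n (fun _ : R => c).
Proof.
elim: n c => [|n ih] c; first by move=> p; exact: cvg_cst.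
apply/Cn1SP; split; first by move=> x; apply: derivable_cst.
rewrite (_ : derive1 _ = fun=> (0 : R)); first exact: ih.
by apply/funext => p; rewrite derive1E derive_cst.
Qed.

Lemma Cn1_id (R : realType) (n : nat) : Cn1 n (@id R).
Proof.
case: n => [|n]; first by move=> p; exact: cvg_id.
apply/Cn1SP; split; first by move=> x; apply: derivable_id.
rewrite (_ : derive1 _ = fun=> (1 : R)); first exact: Cn1_cst.
by apply/funext => p; rewrite derive1E derive_id.
Qed.

Lemma Cn1_comp (R : realType) (n : nat) (h f : R -> R) :
  Cn1 n h -> Cn1 n f -> Cn1 n (h \o f).
Proof.
elim: n h f => [|n ih] h f; first by move=> ch cf p; apply: continuous_comp; [exact: cf|exact: ch].
move=> Ch Cf; have Cf' := Cn1_le Cf; move: Ch Cf => /Cn1SP[dh ch] /Cn1SP[df f1]; apply/Cn1SP; split.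
- by move=> x; apply/derivable1_diffP; apply: differentiable_comp; apply/derivable1_diffP.
- rewrite (_ : derive1 _ = fun x => (derive1 h \o f) x * derive1 f x).
    by apply: Cn1M; [exact: ih|].
  by apply/funext => x; rewrite derive1_comp.
Qed.

Lemma Cn1_affine (R : realType) (n : nat) (a b : R) : Cn1 n (fun x => a * x + b).
Proof. by apply: Cn1D; [apply: Cn1M; [exact: Cn1_cst|exact: Cn1_id]|exact: Cn1_cst]. Qed.

Lemma powers_le_expR (R : realType) (n : nat) (x : R) : 0 <= x -> x ^+ n <= n`!%:R * expR x.
Proof.
move=> x0; case: n => [|n]; first by rewrite expr0 mul1r -(expR0 R) ler_expR.
have := expR_ge1Dxn n x0; have f0 : 0 < n.+1`!%:R :> R by rewrite ltr0n fact_gt0.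
move=> h; rewrite mulrC -ler_pdivrMr//; apply: le_trans h; lra.
Qed.

Lemma poly_le_expR (R : realType) (P : {poly R}) :
  exists2 C, 0 <= C & forall x, 0 <= x -> `|P.[x]| <= C * expR x.
Proof.
exists (\sum_(i < size P) `|P`_i| * i`!%:R).
  by apply: sumr_ge0 => i _; rewrite mulr_ge0// ler0n.
move=> x x0; rewrite horner_coef (le_trans (ler_norm_sum _ _ _))// mulr_suml.
apply: ler_sum => i _; rewrite normrM (ger0_norm (exprn_ge0 _ x0)) -mulrA.
by apply: ler_wpM2l => //; exact: powers_le_expR.
Qed.

(* [polyexp P x = P(1/x) exp(-1/x)] for [x > 0], continued by 0 *)
Definition polyexp (R : realType) (P : {poly R}) (x : R) : R :=
  if 0 < x then P.[x^-1] * expR (- x^-1) else 0.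

(** The polynomial $X^2P$, rather than $P$, is compared with the exponential; this leaves a factor
    $x^2$, hence derivative 0 at the junction point 0. *)
Lemma polyexp_le (R : realType) (P : {poly R}) :
  exists2 C, 0 <= C & forall x, `|polyexp P x| <= C * x ^+ 2.
Proof.
have [C C0 hC] := poly_le_expR ('X^2 * P); exists C => // x.
rewrite /polyexp; case: ifPn => x0; last by rewrite normr0 mulr_ge0// sqr_ge0.
have := hC _ (ltW (_ : 0 < x^-1)); rewrite invr_gt0 => /(_ x0).
rewrite hornerM hornerXn normrM normrX (gtr0_norm (_ : 0 < x^-1)) ?invr_gt0//.
rewrite normrM (gtr0_norm (expR_gt0 _)) expRN => h.
rewrite -ler_pdivlMr ?invr_gt0 ?expR_gt0// invrK mulrAC.
by rewrite -ler_pdivrMr ?exprn_gt0// mulrC -exprVn.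
Qed.

(** This rule and the following ones are stated on explicit abstractions so that they compose by
    mere application, the value of the derivative being built by unification. *)
Lemma is_derive1_add (R : realType) (f g : R -> R) (x a b : R) :
  is_derive x 1 f a -> is_derive x 1 g b -> is_derive x 1 (fun t => f t + g t) (a + b).
Proof. exact: is_deriveD. Qed.

Lemma is_derive1_sub (R : realType) (f g : R -> R) (x a b : R) :
  is_derive x 1 f a -> is_derive x 1 g b -> is_derive x 1 (fun t => f t - g t) (a - b).
Proof. exact: is_deriveB. Qed.

Lemma is_derive1_opp (R : realType) (f : R -> R) (x a : R) :
  is_derive x 1 f a -> is_derive x 1 (fun t => - f t) (- a).
Proof. exact: is_deriveN. Qed.

Lemma is_derive1_mul (R : realType) (f g : R -> R) (x a b : R) :
  is_derive x 1 f a -> is_derive x 1 g b ->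
  is_derive x 1 (fun t => f t * g t) (a * g x + f x * b).
Proof.
move=> fa gb; have := is_deriveM fa gb; rewrite /GRing.scale/= => h.
by rewrite addrC (mulrC a).
Qed.

Lemma is_derive1_scale (R : realType) (k : R) (f : R -> R) (x a : R) :
  is_derive x 1 f a -> is_derive x 1 (fun t => k * f t) (k * a).
Proof. exact: is_deriveZ. Qed.

Lemma is_derive1_compose (R : realType) (h f : R -> R) (x a b : R) :
  is_derive x 1 f a -> is_derive (f x) 1 h b -> is_derive x 1 (fun t => h (f t)) (b * a).
Proof.
move=> [df <-] [dh <-]; apply: DeriveDef.
  by apply/derivable1_diffP/differentiable_comp; apply/derivable1_diffP.
by rewrite -!derive1E (derive1_comp df dh).
Qed.

Lemma is_derive1_inv (R : realType) (f : R -> R) (x a : R) : f x != 0 ->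
  is_derive x 1 f a -> is_derive x 1 (fun t => (f t)^-1) (- a / f x ^+ 2).
Proof.
move=> fx0 [df <-]; apply: DeriveDef; first exact: derivableV.
by rewrite deriveV//= /GRing.scale/= -exprVn mulrC mulNr mulrN mulrC.
Qed.

Lemma is_derive1_itv_eq (R : realType) (f g : R -> R) (a b x l : R) : a < x -> x < b ->
  (forall t, a < t -> t < b -> f t = g t) -> is_derive x 1 f l -> is_derive x 1 g l.
Proof.
move=> ax xb fg; apply: near_eq_is_derive; near=> t.
apply: fg; near: t; [exact: lt_nbhsr|exact: lt_nbhsl].
Unshelve. all: by end_near. Qed.

Lemma is_derive1_cts (R : realType) (f : R -> R) (x l : R) : is_derive x 1 f l -> {for x, continuous f}.
Proof. by move=> [df _]; apply/differentiable_continuous/derivable1_diffP. Qed.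

Lemma is_derive1_quadratic (R : realType) (f : R -> R) (C : R) : 0 <= C ->
  (forall x, `|f x| <= C * x ^+ 2) -> is_derive (0 : R) 1 f 0.
Proof.
move=> C0 hf.
have f0 : f 0 = 0 by apply/normr0_eq0/le_anti/andP; split => //; rewrite (le_trans (hf 0))// expr0n mulr0.
have h : h^-1 *: (f (h *: 1 + 0) - f 0) @[h --> 0^'] --> (0 : R).
  apply/cvgr0Pnorm_le => e e0.
  near=> h.
  have h0 : h != 0 by near: h; exact: nbhs_dnbhs_neq.
  rewrite f0 subr0 addr0 /GRing.scale/= mulr1 normrM normfV.
  rewrite ler_pdivrMl ?normr_gt0// (le_trans (hf _))// -real_normK ?num_real// expr2 mulrCA.
  rewrite ler_pM2l ?normr_gt0//.
  have : `|h| <= e / (C + 1).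
    near: h; apply: dnbhs0_le; rewrite divr_gt0// ltr_wpDl//.
  rewrite ler_pdivlMr; last by rewrite ltr_wpDl.
  have := normr_ge0 h; nra.
apply: DeriveDef; last exact/cvg_lim.
by apply/cvg_ex; exists 0.
Unshelve. all: by end_near. Qed.

(** Since $(P(1/x)e^{-1/x})'=x^{-2}(P-P')(1/x)e^{-1/x}$, the family is closed under derivation.
    Smoothness then follows by induction on the order with $P$ arbitrary. *)
Lemma is_derive_polyexp (R : realType) (P : {poly R}) (x : R) :
  is_derive x 1 (polyexp P) (polyexp ('X^2 * (P - P^`())) x).
Proof.
have [x0|x0|->] := ltgtP x 0.
- have -> : polyexp ('X^2 * (P - P^`())) x = 0 by rewrite /polyexp ifN// -leNgt ltW.
  apply: (@is_derive1_itv_eq _ (fun=> 0) _ (x - 1) 0 x) => //; first by rewrite ltrBlDr ltrDl.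
  by move=> t _ t0; rewrite /polyexp ifN// -leNgt ltW.
- have -> : polyexp ('X^2 * (P - P^`())) x = x^-1 ^+ 2 * (P.[x^-1] - P^`().[x^-1]) * expR (- x^-1).
    by rewrite /polyexp x0 !hornerE.
  apply: (@is_derive1_itv_eq _ (fun y => P.[y^-1] * expR (- y^-1)) _ 0 (x + 1) x) => //; first by rewrite ltrDl.
    by move=> t t0 _; rewrite /polyexp t0.
  have x1 : x != 0 by rewrite gt_eqF.
  have dV : is_derive x 1 (fun y : R => y^-1) (- 1 / x ^+ 2).
    exact: (@is_derive1_inv _ id x 1 x1 (is_derive_id _ _)).
  apply: is_derive_eq; rewrite /GRing.scale/=.
  by field.
- have [C C0 hC] := polyexp_le P.
  have p0 Q : polyexp Q 0 = 0 :> R by rewrite /polyexp ltxx.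
  by rewrite p0; exact: is_derive1_quadratic C0 hC.
Qed.

Lemma Cn1_polyexp (R : realType) (n : nat) (P : {poly R}) : Cn1 n (polyexp P).
Proof.
elim: n P => [|n ih] P; first by move=> x; exact: is_derive1_cts (is_derive_polyexp P x).
apply/Cn1SP; split; first by move=> x; have [] := is_derive_polyexp P x.
rewrite (_ : derive1 _ = polyexp ('X^2 * (P - P^`()))); first exact: ih.
by apply/funext => x; rewrite derive1E; have [] := is_derive_polyexp P x.
Qed.

(** Product of the flat functions $e^{-1/((n+1)(t-a))}$ and $e^{-1/((n+1)(b-t))}$: a smooth function
    supported in $[a,b]$ that increases to the indicator of $]a,b[$. It supplies both a bump
    ([n = 0]) and a smooth approximation of indicators, without convolution. *)
Definition plateau (R : realType) (n : nat) (a b t : R) : R :=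
  polyexp 1 (n.+1%:R * (t - a)) * polyexp 1 (n.+1%:R * (b - t)).

Lemma Cn1_plateau (R : realType) (m n : nat) (a b : R) : Cn1 m (plateau n a b).
Proof.
apply: Cn1M.
  rewrite (_ : (fun t => _) = polyexp 1 \o (fun t => n.+1%:R * t + (- (n.+1%:R * a)))).
    by apply: Cn1_comp; [exact: Cn1_polyexp|exact: Cn1_affine].
  by apply/funext => t /=; rewrite mulrBr.
rewrite (_ : (fun t => _) = polyexp 1 \o (fun t => (- n.+1%:R) * t + n.+1%:R * b)).
  by apply: Cn1_comp; [exact: Cn1_polyexp|exact: Cn1_affine].
by apply/funext => t /=; congr polyexp; ring.
Qed.

Lemma polyexp1_ge0 (R : realType) (x : R) : 0 <= polyexp 1 x.
Proof. by rewrite /polyexp; case: ifP => // _; rewrite hornerC mul1r expR_ge0. Qed.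

Lemma polyexp1_le1 (R : realType) (x : R) : polyexp 1 x <= 1.
Proof.
rewrite /polyexp; case: ifP => // x0; rewrite hornerC mul1r -(expR0 R) ler_expR.
by rewrite oppr_le0 invr_ge0 ltW.
Qed.

Lemma polyexp1_gt0 (R : realType) (x : R) : 0 < x -> 0 < polyexp 1 x.
Proof. by rewrite /polyexp => ->; rewrite hornerC mul1r expR_gt0. Qed.

Lemma plateau_ge0 (R : realType) (n : nat) (a b t : R) : 0 <= plateau n a b t.
Proof. by rewrite mulr_ge0 ?polyexp1_ge0. Qed.

Lemma plateau_le1 (R : realType) (n : nat) (a b t : R) : plateau n a b t <= 1.
Proof. by rewrite mulr_ile1 ?polyexp1_ge0 ?polyexp1_le1. Qed.

Lemma plateau_gt0 (R : realType) (n : nat) (a b t : R) : a < t -> t < b -> 0 < plateau n a b t.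
Proof. by move=> at_ tb; rewrite mulr_gt0// polyexp1_gt0// mulr_gt0// subr_gt0. Qed.

Lemma plateau_out (R : realType) (n : nat) (a b t : R) : t <= a \/ b <= t -> plateau n a b t = 0.
Proof.
rewrite /plateau /polyexp => -[h|h].
  by rewrite ifN ?mul0r// -leNgt pmulr_rle0// subr_le0.
by rewrite [X in _ * X]ifN ?mulr0// -leNgt pmulr_rle0// subr_le0.
Qed.

Lemma cvg_polyexp1 (R : realType) (d : R) : 0 < d ->
  polyexp 1 (n.+1%:R * d) @[n --> \oo] --> (1 : R).
Proof.
move=> d0.
rewrite (_ : (fun n => _) = (fun n : nat => expR (- (d^-1 * n.+1%:R^-1)))); last first.
  apply/funext => n; rewrite /polyexp mulr_gt0// hornerC mul1r invfM mulrC//.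
suff : expR (- (d^-1 * n.+1%:R^-1)) @[n --> \oo] --> expR (- (d^-1 * 0)).
  by rewrite mulr0 oppr0 expR0.
apply: continuous_cvg; first exact: continuous_expR.
apply: cvgN; apply: cvgM; first exact: cvg_cst.
exact: cvg_harmonic.
Qed.

Lemma cvg_plateau (R : realType) (a b t : R) :
  plateau n a b t @[n --> \oo] --> (\1_`]a, b[%classic t : R).
Proof.
rewrite indicE; have [|h] := boolP (t \in _); rewrite ?inE/= ?in_itv/=.
  move=> /andP[at_ tb]; suff : plateau n a b t @[n --> \oo] --> (1 * 1 : R) by rewrite mulr1.
  by apply: cvgM; apply: cvg_polyexp1; rewrite subr_gt0.
rewrite (_ : (fun n => _) = fun=> 0); first exact: cvg_cst.
apply/funext => n; apply: plateau_out.
move: h; rewrite notin_setE/= in_itv/= => /negP; rewrite negb_and -!leNgt.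
by move=> /orP[]; [left|right].
Qed.

Definition smooth1 (R : realType) (f : R -> R) : Prop := forall n, Cn1 n f.

Lemma compact_sqn_le (R : realType) (d : R) : compact [set p : R * R | sqn p <= d].
Proof.
pose M := Num.sqrt d.
have Hs (x y : R) : x ^+ 2 + y ^+ 2 <= d -> - M <= x <= M.
  move=> h; rewrite -ler_norml -sqrtr_sqr; apply: ler_wsqrtr.
  by have := sqr_ge0 y; lra.
apply: (@subclosed_compact _ _ (`[- M, M]%classic `*` `[- M, M]%classic)).
- rewrite (_ : [set p | _] = @sqn R @^-1` [set x | x <= d])//.
  apply: closed_comp; last exact: closed_le.
  by move=> p _; exact: (@Cn_sqn R 0).
- by apply: compact_setX; exact: segment_compact.
- move=> [x y] /= h; split => /=; rewrite in_itv/=; first exact: Hs h.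
  by apply: (Hs y x); rewrite addrC.
Qed.

Lemma test_function_sqn (R : realType) (f : R * R -> R) (d : R) : d < 1 ->
  (forall n, Cn n f) -> (forall p, d < sqn p -> f p = 0) -> test_function f.
Proof.
move=> d1 sf f0; split => //; exists [set p | sqn p <= d]; split.
- exact: compact_sqn_le.
- by move=> p /= h; rewrite diskE/= in_itv/= sqn_ge0/= (le_lt_trans h).
- by move=> p /negP; rewrite -ltNge; exact: f0.
Qed.

Lemma Rintegral_support (d : measure_display) (T : measurableType d) (R : realType)
    (mu : {measure set T -> \bar R}) (A B : set T) (f : T -> R) :
  A `<=` B -> (forall x, B x -> ~ A x -> f x = 0) ->
  \int[mu]_(x in B) f x = \int[mu]_(x in A) f x.
Proof.
move=> AB f0; rewrite [LHS]Rintegral_mkcond [RHS]Rintegral_mkcond.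
apply: eq_Rintegral => x _; rewrite !patchE.
have [xB|xB] := boolP (x \in B); have [xA|xA] := boolP (x \in A) => //.
  by apply: f0; [rewrite inE in xB|rewrite notin_setE in xA].
by move: xB; rewrite notin_setE; case; apply: AB; rewrite inE in xA.
Qed.

(** * One-dimensional calculus and the du Bois-Reymond lemma *)

Lemma continuous_itv_within (R : realType) (a b : R) (f : R -> R) :
  (forall t, a <= t -> t <= b -> {for t, continuous f}) -> {within `[a, b], continuous f}.
Proof.
move=> cf; apply: continuous_in_subspaceT => t; rewrite inE/= in_itv/= => /andP[at_ tb].
exact: cf.
Qed.

Lemma Rintegral_FTC2 (R : realType) (F f : R -> R) (a b : R) : a < b ->
  (forall t, a <= t -> t <= b -> is_derive t 1 F (f t)) ->
  (forall t, a <= t -> t <= b -> {for t, continuous f}) ->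
  \int[leb R]_(t in `[a, b]) f t = F b - F a.
Proof.
move=> ab dF cf; rewrite /Rintegral (@continuous_FTC2 R f F)//.
- exact: continuous_itv_within.
- split.
  + by move=> t; rewrite in_itv/= => /andP[at_ tb]; have [] := dF t (ltW at_) (ltW tb).
  + by apply: cvg_at_right_filter; exact: is_derive1_cts (dF a (lexx a) (ltW ab)).
  + by apply: cvg_at_left_filter; exact: is_derive1_cts (dF b (ltW ab) (lexx b)).
- move=> t; rewrite in_itv/= => /andP[at_ tb].
  by rewrite derive1E; have [] := dF t (ltW at_) (ltW tb).
Qed.

Lemma integrable_continuous_itv (R : realType) (f : R -> R) (a b : R) :
  (forall t, a <= t -> t <= b -> {for t, continuous f}) ->
  (leb R).-integrable `[a, b] (EFin \o f).
Proof.
move=> cf; apply: continuous_compact_integrable; first exact: segment_compact.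
exact: continuous_itv_within.
Qed.

Lemma smooth_antiderivative (R : realType) (g : R -> R) (a : R) :
  continuous g -> (forall t, t <= a -> g t = 0) ->
  exists2 G : R -> R, (forall t : R, is_derive t 1 G (g t)) & (forall t, t <= a -> G t = 0).
Proof.
move=> cg g0.
(* Starting at [a - 1] makes every $t\ge a$ interior to an interval of integration, where the
   fundamental theorem applies. *)
pose G t := \int[leb R]_(s in `[a - 1, t]) g s.
have G0 t : t <= a -> G t = 0.
  move=> ta; rewrite /G (_ : \int[_]_(s in _) _ = \int[leb R]_(s in `[a - 1, t]) 0).
    by rewrite Rintegral_cst// mul0r.
  apply: eq_Rintegral => s; rewrite inE/= in_itv/= => /andP[_ st].
  by apply: g0; exact: le_trans st ta.
exists G => // t; have [ta|ta] := ltP t a.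
  rewrite g0 ?(ltW ta)//.
  by apply: (@is_derive1_itv_eq _ (fun=> 0) _ (t - 1) a t) => //; [rewrite ltrBlDr ltrDl|move=> s _ /ltW/G0].
have [dG1 dG2] : derivable G t 1 /\ derive1 G t = g t.
  apply: (@continuous_FTC1_closed R g (a - 1) t (t + 1)).
  - by rewrite ltrDl.
  - by apply: integrable_continuous_itv => s _ _; exact: cg.
  - by rewrite ltrBlDr (le_lt_trans ta)// ltrDl.
  - exact: cg.
apply: DeriveDef; first exact: dG1.
by move: dG2; rewrite derive1E.
Qed.

Lemma derive1_val (R : realType) (f : R -> R) (x l : R) : is_derive x 1 f l -> derive1 f x = l.
Proof. by move=> [_ <-]; rewrite derive1E. Qed.

(** The zero mean makes the primitive that vanishes on the left of $a$ vanish also on the right of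
    $b$, so it is again a test function. *)
Lemma smooth1_antiderivative (R : realType) (g : R -> R) (a b : R) : a < b ->
  smooth1 g -> (forall t, t <= a \/ b <= t -> g t = 0) ->
  \int[leb R]_(t in `[a, b]) g t = 0 ->
  exists G : R -> R, [/\ smooth1 G, forall t : R, is_derive t 1 G (g t) &
    forall t, t <= a \/ b <= t -> G t = 0].
Proof.
move=> ab sg g0 ig; have cg : continuous g := sg 0%N.
have [G dG G0] := @smooth_antiderivative R g a cg (fun t h => g0 t (or_introl h)).
exists G; split => //.
  have G' : derive1 G = g by apply/funext => t; exact: derive1_val.
  move=> n; apply: Cn1_le; apply/Cn1SP; split; first by move=> x; have [] := dG x.
  by rewrite G'.
have Gb : G b = 0.
  have := @Rintegral_FTC2 R G g a b ab (fun t _ _ => dG t) (fun t _ _ => cg t).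
  by rewrite ig (G0 _ (lexx a)) subr0.
move=> t [/G0//|]; rewrite le_eqVlt => /predU1P[<-//|bt].
have := @Rintegral_FTC2 R G g b t bt (fun t _ _ => dG t) (fun t _ _ => cg t).
rewrite Gb subr0 => <-.
rewrite (_ : \int[_]_(s in _) _ = \int[leb R]_(s in `[b, t]) 0).
  by rewrite Rintegral_cst// mul0r.
by apply: eq_Rintegral => s; rewrite inE/= in_itv/= => /andP[bs _]; apply: g0; right.
Qed.

Lemma itvcc_sub_co (R : realType) (a b : R) : 0 < a -> b < 1 -> `[a, b] `<=` `[0, 1[%classic.
Proof.
by move=> a0 b1 t /=; rewrite !in_itv/= => /andP[at_ tb]; rewrite (le_trans (ltW a0) at_) (le_lt_trans tb b1).
Qed.

Lemma Rintegral_plateau_gt0 (R : realType) (n : nat) (a b : R) : a < b ->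
  0 < \int[leb R]_(t in `[a, b]) plateau n a b t.
Proof.
move=> ab.
have cg : continuous (@plateau R n a b) := @Cn1_plateau R 0 n a b.
have [G dG _] := @smooth_antiderivative R _ a cg (fun t h => plateau_out n (or_introl h)).
rewrite (@Rintegral_FTC2 R G _ a b ab (fun t _ _ => dG t) (fun t _ _ => cg t)).
have [c] := @MVT R G (plateau n a b) a b ab (fun t _ => dG t)
  (continuous_itv_within (fun t _ _ => is_derive1_cts (dG t))).
rewrite in_itv/= => /andP[ac cb] ->; rewrite mulr_gt0 ?subr_gt0//; exact: plateau_gt0.
Qed.

Lemma integrable_addr d (T : measurableType d) (R : realType) (mu : {measure set T -> \bar R})
  (D : set T) (f g : T -> R) : measurable D -> mu.-integrable D (EFin \o f) ->
  mu.-integrable D (EFin \o g) -> mu.-integrable D (EFin \o (fun x => f x + g x)).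
Proof. by move=> mD fi gi; exact: (integrableD mD fi gi). Qed.

Lemma integrable_scaler d (T : measurableType d) (R : realType) (mu : {measure set T -> \bar R})
  (D : set T) (k : R) (f : T -> R) : measurable D -> mu.-integrable D (EFin \o f) ->
  mu.-integrable D (EFin \o (fun x => k * f x)).
Proof. by move=> mD fi; exact: (integrableZl mD k fi). Qed.

Lemma integrable_subr d (T : measurableType d) (R : realType) (mu : {measure set T -> \bar R})
  (D : set T) (f g : T -> R) : measurable D -> mu.-integrable D (EFin \o f) ->
  mu.-integrable D (EFin \o g) -> mu.-integrable D (EFin \o (fun x => f x - g x)).
Proof. by move=> mD fi gi; exact: (integrableB mD fi gi). Qed.

Lemma integrable_dominated d (T : measurableType d) (R : realType) (mu : {measure set T -> \bar R})
  (D : set T) (f g : T -> R) : measurable D -> measurable_fun D f ->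
  mu.-integrable D (EFin \o g) -> (forall x, D x -> `|f x| <= g x) ->
  mu.-integrable D (EFin \o f).
Proof.
move=> mD mf gi fg; apply: (le_integrable mD _ _ gi); first exact/measurable_EFinP.
by move=> x Dx /=; rewrite lee_fin (le_trans (fg x Dx))// ler_norm.
Qed.

Lemma measurable_integrable d (T : measurableType d) (R : realType) (mu : {measure set T -> \bar R})
  (D : set T) (f : T -> R) : mu.-integrable D (EFin \o f) -> measurable_fun D f.
Proof. by case/integrableP => /measurable_EFinP. Qed.

Lemma integrable_mul_bounded d (T : measurableType d) (R : realType) (mu : {measure set T -> \bar R})
  (D : set T) (f h : T -> R) (C : R) : measurable D -> mu.-integrable D (EFin \o f) ->
  measurable_fun D h -> (forall x, D x -> `|h x| <= C) ->
  mu.-integrable D (EFin \o (fun x => f x * h x)).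
Proof.
move=> mD fi mh hC; apply: (integrable_dominated mD _ (integrable_scaler C mD (integrable_norm fi))).
  by apply: measurable_funM => //; exact: measurable_integrable fi.
by move=> x Dx; rewrite normrM mulrC; apply: ler_wpM2r => //; exact: hC.
Qed.

Lemma Rintegral_support1 (R : realType) (A B : set R) (f : R -> R) :
  A `<=` B -> (forall x, B x -> ~ A x -> f x = 0) ->
  \int[leb R]_(x in B) f x = \int[leb R]_(x in A) f x.
Proof. exact: (@Rintegral_support _ (measurableTypeR R) R (leb R)). Qed.

Definition locint01 (R : realType) (V : R -> R) : Prop := forall a b, 0 < a -> a < b -> b < 1 ->
  (leb R).-integrable `[a, b] (EFin \o V).

(** Classical argument: a bump minus the multiple of a fixed bump with the same mean is the
    derivative of a test function, so [V - C] is orthogonal to every [plateau n a b]. Dominated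
    convergence as $n\to\infty$ replaces the plateau by the indicator of $]a,b[$. *)
Lemma weak_derivative0 (R : realType) (V : R -> R) : locint01 V ->
  (forall f a b, 0 < a -> a < b -> b < 1 -> smooth1 f ->
     (forall t, t <= a \/ b <= t -> f t = 0) ->
     \int[leb R]_(t in `[a, b]) (V t * derive1 f t) = 0) ->
  exists C, forall a b, 0 < a -> a < b -> b < 1 ->
     \int[leb R]_(t in `[a, b]) (V t - C) = 0.
Proof.
move=> iV hV.
(* The reference bump lives on a fixed interval so that the constant [C] does not depend on [a] and
   [b]. *)
pose q1 : R := 1 / 4; pose q3 : R := 3 / 4.
have q13 : q1 < q3 by rewrite /q1 /q3; lra.
pose b0 := @plateau R 0%N q1 q3.
pose N := \int[leb R]_(t in `[q1, q3]) b0 t.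
have N0 : 0 < N := Rintegral_plateau_gt0 0%N q13.
pose C := (\int[leb R]_(t in `[q1, q3]) (V t * b0 t)) / N.
exists C => a b a_gt0 ab b_lt1.
(* The interval $[a',b']$ contains the supports of both bumps and is still compact in $]0,1[$. *)
pose a' := Num.min a q1; pose b' := Num.max b q3.
have a'a : a' <= a by rewrite /a' ge_min lexx.
have a'q : a' <= q1 by rewrite /a' ge_min lexx orbT.
have b'b : b <= b' by rewrite /b' le_max lexx.
have b'q : q3 <= b' by rewrite /b' le_max lexx orbT.
have a'0 : 0 < a' by rewrite /a' lt_min a_gt0 /q1/=; lra.
have b'1 : b' < 1 by rewrite /b' gt_max b_lt1 /q3/=; lra.
have a'b' : a' < b' by apply: le_lt_trans (lt_le_trans ab b'b).
have key n : \int[leb R]_(t in `[a, b]) ((V t - C) * plateau n a b t) = 0.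
  pose k := (\int[leb R]_(t in `[a, b]) plateau n a b t) / N.
  pose g t := plateau n a b t - k * b0 t.
  have sg : smooth1 g.
    move=> m; rewrite /g (_ : (fun t => _) = fun t => plateau n a b t + (- k) * b0 t).
      by apply: Cn1D; [exact: Cn1_plateau|apply: Cn1M; [exact: Cn1_cst|exact: Cn1_plateau]].
    by apply/funext => t; ring.
  have g0 t : t <= a' \/ b' <= t -> g t = 0.
    move=> h; rewrite /g /b0 !plateau_out ?mulr0 ?subrr//.
      by case: h => h; [left; exact: le_trans h _|right; exact: le_trans _ h].
    by case: h => h; [left; exact: le_trans h _|right; exact: le_trans _ h].
  have sub1 : `[a, b]%classic `<=` `[a', b']%classic.
    by move=> t /=; rewrite !in_itv/= => /andP[h1 h2]; rewrite (le_trans a'a h1) (le_trans h2 b'b).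
  have sub2 : `[q1, q3]%classic `<=` `[a', b']%classic.
    by move=> t /=; rewrite !in_itv/= => /andP[h1 h2]; rewrite (le_trans a'q h1) (le_trans h2 b'q).
  have out1 t : ~ `[a, b]%classic t -> plateau n a b t = 0.
    rewrite /= in_itv/= => /negP; rewrite negb_and -!ltNge => /orP[/ltW h|/ltW h]; apply: plateau_out; tauto.
  have out2 t : ~ `[q1, q3]%classic t -> b0 t = 0.
    rewrite /= in_itv/= => /negP; rewrite negb_and -!ltNge => /orP[/ltW h|/ltW h]; apply: plateau_out; tauto.
  have m1 : measurable (`[a, b]%classic : set (measurableTypeR R)) by [].
  have m2 : measurable (`[a', b']%classic : set (measurableTypeR R)) by [].
  have mb n' x y : measurable_fun `[a', b'] (@plateau R n' x y).
    by apply: measurable_funTS; apply: continuous_measurable_fun; exact: (@Cn1_plateau R 0%N).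
  have bb n' x y t : `|plateau n' x y t| <= 1.
    by rewrite ger0_norm ?plateau_ge0 ?plateau_le1.
  have ib n' x y : (leb R).-integrable `[a', b'] (EFin \o plateau n' x y).
    by apply: integrable_continuous_itv => t _ _; exact: (@Cn1_plateau R 0%N).
  have iVb n' x y : (leb R).-integrable `[a', b'] (EFin \o (fun t => V t * plateau n' x y t)).
    exact: (integrable_mul_bounded m2 (iV a' b' a'0 a'b' b'1) (mb n' x y) (fun t _ => bb R n' x y t)).
  have [|G [sG dG G0]] := smooth1_antiderivative a'b' sg g0.
    rewrite /g (RintegralB m2 (ib n a b) (integrable_scaler k m2 (ib 0%N q1 q3))).
    rewrite (RintegralZl k m2 (ib 0%N q1 q3)).
    have -> := @Rintegral_support1 R _ _ (plateau n a b) sub1 (fun t _ => out1 t).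
    have -> := @Rintegral_support1 R _ _ b0 sub2 (fun t _ => out2 t).
    by rewrite -/N /k divfK ?subrr// gt_eqF.
  have := hV G a' b' a'0 a'b' b'1 sG G0.
  rewrite (_ : (fun t => V t * derive1 G t) = fun t => V t * plateau n a b t - k * (V t * b0 t)); last first.
    by apply/funext => t; rewrite (derive1_val (dG t)) /g; ring.
  rewrite (RintegralB m2 (iVb n a b) (integrable_scaler k m2 (iVb 0%N q1 q3))).
  rewrite (RintegralZl k m2 (iVb 0%N q1 q3)).
  have -> : \int[leb R]_(t in `[a', b']) (V t * plateau n a b t) =
      \int[leb R]_(t in `[a, b]) (V t * plateau n a b t).
    by apply: Rintegral_support1 => // t _ /out1 ->; rewrite mulr0.
  have -> : \int[leb R]_(t in `[a', b']) (V t * plateau 0 q1 q3 t) =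
      \int[leb R]_(t in `[q1, q3]) (V t * b0 t).
    by apply: Rintegral_support1 => // t _ /out2; rewrite /b0 => ->; rewrite mulr0.
  move=> h.
  rewrite (_ : (fun t => (V t - C) * plateau n a b t) = fun t => V t * plateau n a b t - C * plateau n a b t); last first.
    by apply/funext => t; ring.
  have iVb' := integrableS m2 m1 sub1 (iVb n a b).
  have ib' := integrableS m2 m1 sub1 (ib n a b).
  rewrite (RintegralB m1 iVb' (integrable_scaler C m1 ib')) (RintegralZl C m1 ib').
  rewrite -[RHS]h /k /C; congr (_ - _); ring.
have m1 : measurable (`[a, b]%classic : set (measurableTypeR R)) by [].
have iVC : (leb R).-integrable `[a, b] (EFin \o (fun t => V t - C)).
  apply: integrable_subr => //; first exact: iV.
  by apply: integrable_continuous_itv => t _ _; exact: cvg_cst.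
have mb n : measurable_fun `[a, b] (@plateau R n a b).
  by apply: measurable_funTS; apply: continuous_measurable_fun; exact: (@Cn1_plateau R 0%N).
have mVC := measurable_integrable iVC.
have mfn n : measurable_fun `[a, b] (fun t => ((V t - C) * plateau n a b t)%:E).
  by apply/measurable_EFinP; exact: measurable_funM.
have mf : measurable_fun `[a, b] (fun t => ((V t - C) * \1_(`]a, b[%classic) t)%:E).
  by apply/measurable_EFinP; apply: measurable_funM => //; exact: measurable_indic.
have cv : {ae (leb R), forall t, `[a, b]%classic t ->
    ((V t - C) * plateau n a b t)%:E @[n --> \oo] --> ((V t - C) * \1_(`]a, b[%classic) t)%:E}.
  apply: aeW => t _; apply: cvg_EFin; first by near=> n.
  by apply: cvgM; [exact: cvg_cst|exact: cvg_plateau].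
have dom : {ae (leb R), forall t, forall n, `[a, b]%classic t ->
    (`| ((V t - C) * plateau n a b t)%:E | <= `| (V t - C)%:E |)%E}.
  by apply: aeW => t n _; rewrite lee_fin normrM ler_piMr// ger0_norm ?plateau_ge0 ?plateau_le1.
have [_ _ /cvg_lim h] := dominated_convergence m1 mfn mf cv (integrable_abse iVC) dom.
have e0 : (\int[leb R]_(t in `[a, b]) ((V t - C) * \1_(`]a, b[%classic) t)%:E = 0)%E.
  rewrite -h//=; apply/cvg_lim => //.
  rewrite (_ : (fun n => _) = fun=> 0%E); first exact: cvg_cst.
  apply/funext => n.
  have iVb : (leb R).-integrable `[a, b] (EFin \o (fun t => (V t - C) * plateau n a b t)).
    have bb t : `|plateau n a b t| <= 1 by rewrite ger0_norm ?plateau_ge0 ?plateau_le1.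
    exact: (integrable_mul_bounded m1 iVC (mb n) (fun t _ => bb t)).
  by rewrite -(fineK (integrable_fin_num m1 iVb)); congr EFin; exact: key.
rewrite /Rintegral (_ : integral _ _ _ = 0%E)// -e0.
have m3 : measurable_fun `]a, b[ (fun t => (V t - C)%:E).
  apply/measurable_EFinP; apply: measurable_funS mVC => //.
  by move=> t /=; rewrite !in_itv/= => /andP[/ltW -> /ltW ->].
rewrite integral_itv_bndoo// [RHS]integral_itv_bndoo//.
  apply: eq_integral => t; rewrite inE/= => ht.
  by rewrite indicE mem_set// mulr1.
apply: measurable_funS mf => //.
by move=> t /=; rewrite !in_itv/= => /andP[/ltW -> /ltW ->].
Unshelve. all: by end_near. Qed.

(** After cutting [f] off to a compact interval, its primitive is constant there; Lebesgue's
    differentiation theorem identifies the derivative of the primitive with [f] almost everywhere.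
    Countably many intervals exhaust $]0,1[$. *)
Lemma integral_itv_eq0_ae (R : realType) (f : R -> R) : locint01 f ->
  (forall a b, 0 < a -> a < b -> b < 1 -> \int[leb R]_(t in `[a, b]) f t = 0) ->
  {ae leb R, forall t, 0 < t < 1 -> f t = 0}.
Proof.
move=> lf f0.
(* The shift by 3 keeps [e n] below 1/2, so that the interval from [e n] to [1 - e n] is never
   degenerate. *)
pose e n : R := n.+3%:R^-1.
have e0 n : 0 < e n by rewrite invr_gt0.
have e1 n : e n < 1 - e n.
  rewrite ltrBrDr -mulr2n -mulr_natl /e ltr_pdivrMr// mul1r ltr_nat//.
have e2 n : 1 - e n < 1 by rewrite ltrBlDr ltrDl.
suff key n : {ae leb R, forall t, e n < t < 1 - e n -> f t = 0}.
  have := ae_foralln key; apply: filterS => t ht /andP[t0 t1].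
  have : 0 < Num.min t (1 - t) by rewrite lt_min t0 subr_gt0.
  move=> m0; pose n := Num.bound (Num.min t (1 - t))^-1.
  have hn : e n < Num.min t (1 - t).
    rewrite /e invf_plt ?posrE//.
    by rewrite (lt_le_trans (archi_boundP _))// ?invr_ge0 ?(ltW m0)// ler_nat -addn3 leq_addr.
  move: hn; rewrite lt_min => /andP[h1 h2].
  by apply: (ht n); rewrite h1/= ltrBrDr addrC -ltrBrDr.
have mI : measurable (`[e n, 1 - e n]%classic : set (measurableTypeR R)) by [].
pose g := f \_ `[e n, 1 - e n].
have ig : (leb R).-integrable setT (EFin \o g).
  by have := lf _ _ (e0 n) (e1 n) (e2 n); rewrite integrable_mkcond//= (restrict_EFin f).
have mg : measurable_fun setT g by exact: measurable_integrable ig.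
have lg : locally_integrable setT g by apply: open_integrable_locally => //; exact: openT.
have iy y : (leb R).-integrable `]-oo, y] (EFin \o g) by apply: integrableS ig.
have := FTC1Ny iy lg; apply: filterS; first exact: (ae_filter_ringOfSetsType (leb R)).
move=> t [dF F't] /andP[h1 h2].
move: F't; set F := (fun x : R => _) => F't.
have F0 y : e n < y -> y < 1 - e n -> 0 = F y.
  move=> y1 y2; rewrite -(f0 (e n) y (e0 n) y1 (lt_trans y2 (e2 n))) /F.
  rewrite [LHS]Rintegral_mkcond [RHS]Rintegral_mkcond; apply: eq_Rintegral => s _.
  rewrite /g !patchE !mem_setE !in_itv/=.
  case: (leP s y) => sy; rewrite ?andbF ?andbT//.
  by rewrite (le_trans sy (ltW y2)) andbT.
have : is_derive t 1 F 0 by exact: (@is_derive1_itv_eq _ (fun=> 0) F (e n) (1 - e n) t 0 h1 h2 F0).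
move=> /derive1_val; rewrite F't /g patchE mem_set//=.
by rewrite in_itv/= !ltW.
Qed.

Lemma du_bois_reymond (R : realType) (V : R -> R) : locint01 V ->
  (forall f a b, 0 < a -> a < b -> b < 1 -> smooth1 f ->
     (forall t, t <= a \/ b <= t -> f t = 0) ->
     \int[leb R]_(t in `[a, b]) (V t * derive1 f t) = 0) ->
  exists C, {ae leb R, forall t, 0 < t < 1 -> V t = C}.
Proof.
move=> iV /(weak_derivative0 iV)[C hC]; exists C.
have iVC : locint01 (fun t => V t - C).
  move=> a b a0 ab b1; apply: integrable_subr => //; first exact: iV.
  by apply: integrable_continuous_itv => t _ _; exact: cvg_cst.
have := integral_itv_eq0_ae iVC hC; apply: filterS; first exact: (ae_filter_ringOfSetsType (leb R)).
by move=> t h /h /eqP; rewrite subr_eq0 => /eqP.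
Qed.

(** * The layer-cake formula *)

Section layer_cake.
Context d (T : measurableType d) (R : realType) (mu : {sigma_finite_measure set T -> \bar R}).
Context (D : set T) (q : T -> R) (k : T -> R) (f f' : R -> R) (C : R).
Context (mD : measurable D) (mq : measurable_fun setT q).
Context (qD : forall p, D p -> 0 <= q p < 1) (ik : mu.-integrable D (EFin \o k)).
Context (df : forall t : R, is_derive t 1 f (f' t)) (cf' : continuous f').
Context (f'C : forall t, `|f' t| <= C) (f0 : f 0 = 0).
Let nu := (leb R).
Let E : set (T * measurableTypeR R) := [set z | 0 <= z.2 < q z.1].
Let G (z : T * measurableTypeR R) : R := (k \_ D) z.1 * (f' z.2 * \1_E z).

Let mE : measurable E.
Proof.
rewrite (_ : E = (@snd T (measurableTypeR R)) @^-1` `[0, +oo[%classic `&` (fun z : T * measurableTypeR R => q z.1 - z.2) @^-1` `]0, +oo[%classic).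
  apply: measurableI; rewrite -[X in measurable X]setTI.
    by apply: measurable_snd.
  have : measurable_fun setT (fun z : T * measurableTypeR R => q z.1 - z.2).
    apply: measurable_funB; last exact: measurable_snd.
    exact: (measurableT_comp mq measurable_fst).
  by apply.
by apply/seteqP; split => z /=; rewrite !in_itv/= !andbT subr_gt0; [move=> /andP[]|move=> [? ?]; apply/andP].
Qed.

Let kD : T -> R := k \_ D.
Let ikD : mu.-integrable setT (EFin \o kD).
Proof. by move: ik; rewrite integrable_mkcond//= (restrict_EFin k). Qed.

Let mf' : measurable_fun setT f'.
Proof. exact: continuous_measurable_fun. Qed.

Let mG : measurable_fun setT G.
Proof.
apply: measurable_funM.
  exact: (measurableT_comp (measurable_integrable ikD) measurable_fst).
apply: measurable_funM; last exact: measurable_indic.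
exact: (measurableT_comp mf' measurable_snd).
Qed.

Let C0 : 0 <= C. Proof. exact: le_trans (normr_ge0 _) (f'C 0). Qed.

Let inner_t p : (\int[nu]_t (G (p, t))%:E)%E = ((kD p * f (q p))%:E).
Proof.
have [Dp|Dp] := boolP (p \in D); last first.
  rewrite integral0_eq ?/kD ?patchE ?(negbTE Dp) ?mul0r// => t _.
  by rewrite /G/= patchE (negbTE Dp) mul0r.
have := qD (set_mem Dp) => /andP[q0 q1].
rewrite (_ : (fun t => _) = ((EFin \o (fun t => kD p * f' t)) \_ `[0, q p[%classic)); last first.
  apply/funext => t; rewrite patchE /G/= indicE /kD.
  have -> : ((p, t) \in E) = (t \in `[0, q p[%classic).
    by apply/idP/idP; rewrite !inE/= in_itv/=.
  by case: ifP => _ /=; rewrite ?mulr1// !mulr0.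
rewrite -integral_mkcond.
have ckf : continuous (fun t : R => kD p * f' t).
  by move=> t; apply: cvgM; [exact: cvg_cst|exact: cf'].
have ikf : nu.-integrable `[0, q p] (EFin \o (fun t => kD p * f' t)).
  by apply: integrable_continuous_itv => t _ _; exact: ckf.
rewrite integral_itv_bndo_bndc; last first.
  apply/measurable_EFinP; apply: measurable_funS (measurable_integrable ikf) => //.
  by move=> t /=; rewrite !in_itv/= => /andP[-> /ltW].
move: q0; rewrite le_eqVlt => /predU1P[<-|q0].
  by rewrite set_itv1 integral_set1 f0 mulr0.
have mI : measurable (`[0, q p]%classic : set (measurableTypeR R)) by [].
rewrite -(fineK (integrable_fin_num mI ikf)); congr EFin.
rewrite -[LHS]/(\int[nu]_(t in `[0, q p]) (kD p * f' t)).
rewrite (@Rintegral_FTC2 R (fun t => kD p * f t))//.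
- by rewrite f0 mulr0 subr0.
- by move=> t _ _; exact: ckf t.
Qed.

Let inner_p (t : R) : (\int[mu]_p (G (p, t))%:E)%E =
  (if 0 <= t < 1 then (f' t * (\int[mu]_(p in D `&` [set p | t < q p]) k p))%:E else 0%E).
Proof.
have mDt : measurable (D `&` [set p | t < q p]).
  apply: measurableI => //; rewrite -[X in measurable X]setTI.
  rewrite (_ : [set p | t < q p] = q @^-1` `]t, +oo[%classic); first exact: mq.
  by apply/seteqP; split => p /=; rewrite in_itv/= andbT.
case: ifPn => t01; last first.
  rewrite integral0_eq// => p _; rewrite /G/= patchE indicE.
  case: ifPn => Dp; rewrite ?mul0r//.
  rewrite memNset ?mulr0// /E/= => /andP[t0 tq].
  by case/negP: t01; rewrite t0 (lt_trans tq)//; case/andP: (qD (set_mem Dp)).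
rewrite (_ : (fun p => _) = ((EFin \o (fun p => f' t * k p)) \_ (D `&` [set p | t < q p]))); last first.
  apply/funext => p; rewrite patchE /G/= patchE indicE.
  case/andP: t01 => t0 _.
  have -> : ((p, t) \in E) = (t < q p) by apply/idP/idP; rewrite inE /E/= t0.
  have -> : (p \in D `&` [set p | t < q p]) = (p \in D) && (t < q p).
    by apply/idP/idP; rewrite !inE/=; [move=> [h ->]; rewrite mem_set|move=> /andP[/set_mem]].
  by case: (p \in D); case: (t < q p) => //=; rewrite ?mulr1 ?mulr0 ?mul0r// mulrC.
rewrite -integral_mkcond.
have ik' : mu.-integrable (D `&` [set p | t < q p]) (EFin \o k) by apply: integrableS ik.
rewrite -RintegralZl// -[in RHS]/(fine _) fineK//.
by apply: integrable_fin_num => //; exact: integrable_scaler.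
Qed.

Let iG : (mu \x nu)%E.-integrable setT (EFin \o G).
Proof.
apply/integrable12ltyP; first exact/measurable_EFinP.
(* As [q] is below 1 on [D], the integrand vanishes for $t$ outside $[0,1[$, an interval of length
   1; hence the bound by $C|k|$. *)
have h p : (\int[nu]_t `|(EFin \o G) (p, t)| <= `|C%:E * (kD p)%:E|)%E.
  rewrite -EFinM [leRHS]/= normrM (ger0_norm C0).
  apply: (@le_trans _ _ (\int[nu]_(t in `[0%R, 1%R[) (C * `|kD p|)%:E)%E); last first.
    rewrite integral_cst//= lebesgue_measure_itv/= lte_fin ltr01 -EFinB subr0 mule1//.
  rewrite [leRHS]integral_mkcond; apply: ge0_le_integral => //.
  - apply/measurable_EFinP; apply: measurableT_comp => //.
    exact: (measurableT_comp mG (measurable_pair1 p)).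
  - have mI : measurable (`[0, 1[%classic : set (measurableTypeR R)) by [].
    exact: (measurable_restrictT _ mI).1 (measurable_cst _).
  - move=> t _; rewrite patchE /= /G/= -/kD normrM normrM.
    have [Dp|Dp] := boolP (p \in D); last first.
      rewrite /kD patchE (negbTE Dp) normr0 mul0r mulr0.
      by case: ifP.
    rewrite indicE; have [|] := boolP ((p, t) \in E); last first.
      by move=> _; rewrite normr0 !mulr0; case: ifP => // _; rewrite lee_fin mulr_ge0.
    rewrite inE /E/= => /andP[t0 tq].
    rewrite mem_set/=; last first.
      by rewrite in_itv/= t0 (lt_trans tq)//; case/andP: (qD (set_mem Dp)).
    by rewrite lee_fin normr1 mulr1 mulrC ler_wpM2r.
apply: le_lt_trans (_ : _ <= \int[mu]_p `|C%:E * (kD p)%:E|)%E _.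
  apply: ge0_le_integral => //.
  - by move=> p _; apply: integral_ge0.
  - apply: (@measurable_fun_fubini_tonelli_F _ _ T (measurableTypeR R) R (leb R) (fun z => `|(EFin \o G) z|%E)) => //.
    by apply: measurableT_comp => //; exact/measurable_EFinP.
  - by apply: measurableT_comp => //; apply: emeasurable_funM => //; case/integrableP: ikD.
by have /integrableP[] := integrableZl measurableT C ikD.
Qed.

(** Because $f(0)=0$, $f(q(p))=\int_0^{q(p)}f'$, and Fubini is applied on the region $0\le t<q(p)$.
    With [q] the squared radius this carries integrals of the flux from the disk to $[0,1[$; with
    [q] the identity it is an integration by parts for a merely integrable [k]. *)
Lemma Rintegral_layer_cake : \int[mu]_(p in D) (k p * f (q p)) =
  \int[nu]_(t in `[0, 1[) (f' t * \int[mu]_(p in D `&` [set p | t < q p]) k p).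
Proof.
rewrite /Rintegral integral_mkcond [in RHS]integral_mkcond; congr fine.
transitivity (\int[mu]_p \int[nu]_t (G (p, t))%:E)%E.
  apply: eq_integral => p _; rewrite inner_t /kD !patchE.
  by case: ifP; rewrite ?mul0r.
rewrite (Fubini iG); apply: eq_integral => t _; rewrite inner_p patchE.
have -> : (t \in `[0, 1[%classic) = (0 <= t < 1).
  by apply/idP/idP; rewrite inE/= in_itv/=.
by [].
Qed.

Lemma measurable_layer : measurable_fun (I01 R) (fun t => f' t * \int[mu]_(p in D `&` [set p | t < q p]) k p).
Proof.
have mI : measurable (I01 R : set (measurableTypeR R)) by [].
have := measurable_fubini_G iG; move=> /(measurable_funS measurableT (@subsetT _ (I01 R))) h.
apply/measurable_EFinP; apply: eq_measurable_fun h => t; rewrite inE/= in_itv/= => t01.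
by have := inner_p t; rewrite t01.
Qed.
End layer_cake.

(** This is the measurability of the inner integral in Fubini's theorem, read with $f'=1$. *)
Lemma measurable_tail d (T : measurableType d) (R : realType) (mu : {sigma_finite_measure set T -> \bar R})
  (D : set T) (q k : T -> R) : measurable D -> measurable_fun setT q ->
  (forall p, D p -> 0 <= q p < 1) -> mu.-integrable D (EFin \o k) ->
  measurable_fun (I01 R) (fun t => \int[mu]_(p in D `&` [set p | t < q p]) k p).
Proof.
move=> mD mq qD ik.
have c1 : continuous (fun _ : R => 1 : R) by move=> t; exact: cvg_cst.
have n1 (t : R) : `|1 : R| <= 1 by rewrite normr1.
have := @measurable_layer _ T R mu D q k (fun=> 1) 1 mD mq qD ik c1 n1.
by congr (measurable_fun _ _); apply/funext => t; rewrite mul1r.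
Qed.

Lemma integrable_tail d (T : measurableType d) (R : realType) (mu : {sigma_finite_measure set T -> \bar R})
  (D : set T) (q k : T -> R) : measurable D -> measurable_fun setT q ->
  (forall p, D p -> 0 <= q p < 1) -> mu.-integrable D (EFin \o k) ->
  (leb R).-integrable (I01 R) (EFin \o (fun t => \int[mu]_(p in D `&` [set p | t < q p]) k p)).
Proof.
move=> mD mq qD ik.
have mI : measurable (I01 R : set (measurableTypeR R)) by [].
apply: (integrable_dominated (g := fun=> \int[mu]_(p in D) `|k p|)) => //.
- exact: measurable_tail.
- apply/integrableP; split; first exact/measurable_EFinP.
  by rewrite integral_cst//= lebesgue_measure_itv/= lte_fin ltr01 -EFinB subr0 mule1 ltry.
- move=> t _.
  have mDt : measurable (D `&` [set p | t < q p]).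
    apply: measurableI => //; rewrite -[X in measurable X]setTI.
    rewrite (_ : [set p | t < q p] = q @^-1` `]t, +oo[%classic); first exact: mq.
    by apply/seteqP; split => p /=; rewrite in_itv/= andbT.
  apply: (le_trans (le_normr_Rintegral mDt (integrableS mD mDt (@subIsetl _ _ _) ik))).
  rewrite /Rintegral fine_le//.
  - apply: integrable_fin_num => //; apply: integrableS (integrable_norm ik) => //; exact: subIsetl.
  - by apply: integrable_fin_num => //; exact: integrable_norm.
  - apply: ge0_subset_integral => //.
    by apply/measurable_EFinP; apply: measurableT_comp => //; exact: measurable_integrable ik.
Qed.

(** * Radial test functions and square integrability on the disk *)

Lemma smooth1_derive1 (R : realType) (f : R -> R) : smooth1 f -> smooth1 (derive1 f).
Proof. by move=> sf n; have /Cn1SP[] := sf n.+1. Qed.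

Lemma smooth1_is_derive (R : realType) (f : R -> R) (x : R) : smooth1 f ->
  is_derive x 1 f (derive1 f x).
Proof.
move=> sf; have /Cn1SP[df _] := sf 1%N.
by apply: DeriveDef; [exact: df|rewrite derive1E].
Qed.

Lemma derive1_vanish_left (R : realType) (f : R -> R) (a : R) :
  (forall t, t < a -> f t = 0) -> forall t, t < a -> derive1 f t = 0.
Proof.
move=> f0 t ta; apply: derive1_val.
apply: (@is_derive1_itv_eq _ (fun=> 0) _ (t - 1) a t) => //; first by rewrite ltrBlDr ltrDl.
by move=> s _ /f0.
Qed.

Lemma derive1_vanish_right (R : realType) (f : R -> R) (b : R) :
  (forall t, b < t -> f t = 0) -> forall t, b < t -> derive1 f t = 0.
Proof.
move=> f0 t bt; apply: derive1_val.
apply: (@is_derive1_itv_eq _ (fun=> 0) _ b (t + 1) t) => //; first by rewrite ltrDl.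
by move=> s /f0.
Qed.

Lemma is_derive_div_pow (R : realType) (f : R -> R) (a : R) (m : nat) (x : R) : 0 < a ->
  smooth1 f -> (forall t, t < a -> f t = 0) ->
  is_derive x 1 (fun t => f t / t ^+ m) (derive1 f x / x ^+ m + (- m%:R) * (f x / x ^+ m.+1)).
Proof.
move=> a0 sf f0; have [xa|xa] := ltP x a.
  rewrite (derive1_vanish_left f0 xa) f0// !mul0r mulr0 addr0.
  apply: (@is_derive1_itv_eq _ (fun=> 0) _ (x - 1) a x) => //; first by rewrite ltrBlDr ltrDl.
  by move=> s _ /f0 ->; rewrite mul0r.
have x0 : 0 < x by exact: lt_le_trans a0 xa.
have x1 : x != 0 by rewrite gt_eqF.
have xm : x ^+ m != 0 by rewrite expf_neq0.
have df := smooth1_is_derive x sf.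
have dm : is_derive x 1 (fun t : R => t ^+ m) (m%:R * x ^+ m.-1).
  apply: DeriveDef; first exact: exprn_derivable.
  by rewrite -derive1E exp_derive1.
have di := @is_derive1_inv R (fun t => t ^+ m) x _ xm dm.
have := is_derive1_mul df di.
rewrite (_ : _ + _ = derive1 f x / x ^+ m + - m%:R * (f x / x ^+ m.+1))//.
congr (_ + _); case: (m) => [|n]; first by rewrite !mul0r oppr0 mul0r mulr0 mul0r.
rewrite /= [x ^+ n.+2]exprS [x ^+ n.+1]exprS.
have xn : x ^+ n != 0 by rewrite expf_neq0.
by field; rewrite x1 xn.
Qed.

(** Vanishing near 0 removes the singularity. The exponent is arbitrary because differentiating
    $f/t^m$ produces $f/t^{m+1}$, which the induction on the order must cover. *)
Lemma smooth1_div_pow (R : realType) (f : R -> R) (a : R) (m : nat) : 0 < a ->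
  smooth1 f -> (forall t, t < a -> f t = 0) -> smooth1 (fun t => f t / t ^+ m).
Proof.
move=> a0 sf f0 n; elim: n f m sf f0 => [|n ih] f m sf f0.
  by move=> x; exact: is_derive1_cts (is_derive_div_pow m x a0 sf f0).
apply/Cn1SP; split; first by move=> x; have [] := is_derive_div_pow m x a0 sf f0.
rewrite (_ : derive1 _ = fun x => derive1 f x / x ^+ m + (- m%:R) * (f x / x ^+ m.+1)); last first.
  by apply/funext => x; exact: derive1_val (is_derive_div_pow m x a0 sf f0).
apply: Cn1D.
  by apply: ih; [exact: smooth1_derive1|exact: derive1_vanish_left].
by apply: Cn1M; [exact: Cn1_cst|exact: ih].
Qed.

Lemma derive_fst_radial (R : realType) (h : R -> R) (v p : R * R) : smooth1 h ->
  'D_v (fun p : R * R => p.1 * h (sqn p)) p = v.1 * h (sqn p) + p.1 * (derive1 h (sqn p) * (2 * (p.1 * v.1 + p.2 * v.2))).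
Proof.
move=> sh; have dh : derivable h (sqn p) 1 by case: (smooth1_is_derive (sqn p) sh).
have d1 : derivable (@fst R R) p v by apply: diff_derivable; exact: differentiable_fst2.
have dq := differentiable_sqn p.
have d2 : derivable (h \o @sqn R) p v.
  by apply: diff_derivable; apply: differentiable_comp; [exact: dq|apply/derivable1_diffP; exact: dh].
have := deriveM d1 d2; rewrite derive_comp1// derive_sqn derive_fst /GRing.scale/= => ->.
by rewrite addrC [X in X + _]mulrC.
Qed.

Lemma derive_snd_radial (R : realType) (h : R -> R) (v p : R * R) : smooth1 h ->
  'D_v (fun p : R * R => p.2 * h (sqn p)) p = v.2 * h (sqn p) + p.2 * (derive1 h (sqn p) * (2 * (p.1 * v.1 + p.2 * v.2))).
Proof.
move=> sh; have dh : derivable h (sqn p) 1 by case: (smooth1_is_derive (sqn p) sh).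
have d1 : derivable (@snd R R) p v by apply: diff_derivable; exact: differentiable_snd2.
have dq := differentiable_sqn p.
have d2 : derivable (h \o @sqn R) p v.
  by apply: diff_derivable; apply: differentiable_comp; [exact: dq|apply/derivable1_diffP; exact: dh].
have := deriveM d1 d2; rewrite derive_comp1// derive_sqn derive_snd /GRing.scale/= => ->.
by rewrite addrC [X in X + _]mulrC.
Qed.

Lemma test_function_fst_radial (R : realType) (h : R -> R) (b : R) : b < 1 -> smooth1 h ->
  (forall t, b < t -> h t = 0) -> test_function (fun p : R * R => p.1 * h (sqn p)).
Proof.
move=> b1 sh h0; apply: (test_function_sqn b1); last by move=> p /h0 ->; rewrite mulr0.
by move=> n; apply: CnM; [exact: Cn_fst|apply: (@Cn_comp R n h (@sqn R)); [exact: sh|exact: Cn_sqn]].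
Qed.

Lemma test_function_snd_radial (R : realType) (h : R -> R) (b : R) : b < 1 -> smooth1 h ->
  (forall t, b < t -> h t = 0) -> test_function (fun p : R * R => p.2 * h (sqn p)).
Proof.
move=> b1 sh h0; apply: (test_function_sqn b1); last by move=> p /h0 ->; rewrite mulr0.
by move=> n; apply: CnM; [exact: Cn_snd|apply: (@Cn_comp R n h (@sqn R)); [exact: sh|exact: Cn_sqn]].
Qed.

Lemma test_function_radial (R : realType) (h : R -> R) (b : R) : b < 1 -> smooth1 h ->
  (forall t, b < t -> h t = 0) -> test_function (h \o @sqn R).
Proof.
move=> b1 sh h0; apply: (test_function_sqn b1); last by move=> p /h0.
by move=> n; apply: (@Cn_comp R n h (@sqn R)); [exact: sh|exact: Cn_sqn].
Qed.

Lemma leb2_disk (R : realType) : @leb2 R (disk R) = (disk_area R)%:E.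
Proof.
rewrite diskE leb2_preimage_sqn// (_ : _ `&` _ = I01 R).
  by rewrite lebesgue_measure_itv/= lte_fin ltr01 -EFinB subr0 mule1.
by apply/setIidPl => t /=; rewrite !in_itv/= => /andP[->].
Qed.

Lemma integrable_cst_disk (R : realType) (C : R) : (@leb2 R).-integrable (disk R) (EFin \o (fun=> C)).
Proof.
apply/integrableP; split; first exact/measurable_EFinP.
have mD := @measurable_disk R.
have -> : (\int[@leb2 R]_(x in disk R) `|(EFin \o (fun=> C)) x| = `|C|%:E * @leb2 R (disk R))%E by exact: integral_cst.
by rewrite leb2_disk -EFinM ltry.
Qed.

Lemma integrable_bounded_disk (R : realType) (h : R * R -> R) (C : R) :
  measurable_fun (disk R : set (plane R)) h ->
  (forall p, disk R p -> `|h p| <= C) -> (@leb2 R).-integrable (disk R) (EFin \o h).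
Proof. by move=> mh hC; exact: (integrable_dominated (@measurable_disk R) mh (integrable_cst_disk C)). Qed.

Lemma L2_integrable_sqr (R : realType) (f : R * R -> R) : L2 f ->
  (@leb2 R).-integrable (disk R) (EFin \o (fun p => f p ^+ 2)).
Proof.
move=> [mf fi]; apply/integrableP; split; first by apply/measurable_EFinP; exact: measurable_funX.
apply: le_lt_trans fi; rewrite /sqnorm; under eq_integral do rewrite /= ger0_norm ?sqr_ge0//.
by [].
Qed.

Lemma L2_integrable_mul (R : realType) (f g : R * R -> R) : L2 f -> L2 g ->
  (@leb2 R).-integrable (disk R) (EFin \o (fun p => f p * g p)).
Proof.
move=> Lf Lg; have mD := @measurable_disk R.
have h := integrable_addr mD (L2_integrable_sqr Lf) (L2_integrable_sqr Lg).
have mfg : measurable_fun (disk R : set (plane R)) (fun p => f p * g p).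
  by apply: measurable_funM; [case: Lf|case: Lg].
apply: (integrable_dominated mD mfg h).
move=> p _; rewrite normrM -(real_normK (num_real (f p))) -(real_normK (num_real (g p))).
have := normr_ge0 (f p); have := normr_ge0 (g p); nra.
Qed.

Lemma L2_cst (R : realType) (C : R) : L2 (fun _ : R * R => C).
Proof.
split; first exact: measurable_cst.
have mD := @measurable_disk R.
rewrite /sqnorm.
have -> : (\int[@leb2 R]_(x in disk R) (C ^+ 2)%:E = (C ^+ 2)%:E * @leb2 R (disk R))%E by exact: integral_cst.
by rewrite leb2_disk -EFinM ltry.
Qed.

Lemma L2_integrable (R : realType) (f : R * R -> R) : L2 f ->
  (@leb2 R).-integrable (disk R) (EFin \o f).
Proof.
move=> Lf; have := L2_integrable_mul Lf (L2_cst 1).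
by congr (integrable _ _ _); apply/funext => p /=; rewrite mulr1.
Qed.

Lemma bounded_continuous_itv (R : realType) (h : R -> R) (a b : R) : continuous h ->
  exists2 C, 0 <= C & forall t, a <= t -> t <= b -> `|h t| <= C.
Proof.
move=> ch; have [ab|ba] := leP a b; last first.
  by exists 0 => // t at_ tb; have := le_lt_trans tb ba; rewrite ltNge at_.
have cn : {within `[a, b], continuous (fun t => `|h t|)}.
  apply: continuous_itv_within => t _ _; apply: (@continuous_comp _ _ _ h (fun x => `|x|)); first exact: ch.
  exact: norm_continuous.
have [c _ hc] := EVT_max ab cn; exists `|h c| => // t at_ tb.
by apply: hc; rewrite in_itv/= at_.
Qed.

(** The plane carries the product sigma-algebra. An open set is the countable union of the open
    squares with rational centre and half-side $1/(n+1)$ that it contains. *)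
Lemma open_measurable_plane (R : realType) (A : set (R * R)) : open A ->
  measurable (A : set (plane R)).
Proof.
move=> oA.
pose I (q : rat) (n : nat) : set R := `]ratr q - n.+1%:R^-1, ratr q + n.+1%:R^-1[%classic.
rewrite (_ : A = \bigcup_(q in [set: rat]) \bigcup_(q' in [set: rat]) \bigcup_(n in [set: nat])
    (if `[< I q n `*` I q' n `<=` A >] then I q n `*` I q' n else set0)).
  apply: bigcupT_measurable_rat => q; apply: bigcupT_measurable_rat => q'.
  apply: bigcupT_measurable => n; case: ifP => // _; apply: measurableX; exact: measurable_itv.
apply/seteqP; split => p; last first.
  by move=> [q _ [q' _ [n _]]]; case: ifPn => // /asboolP h /h.
move=> Ap; have /nbhs_ballP[e /= e0 he] : nbhs p A by exact: open_nbhs_nbhs.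
pose n := Num.bound (2 / e); pose d : R := n.+1%:R^-1.
have d0 : 0 < d by rewrite invr_gt0.
have de : d + d < e.
  have : 2 / e < n.+1%:R.
    by rewrite (lt_trans (archi_boundP _))// ?ltr_nat// divr_ge0// ltW.
  by rewrite ltr_pdivrMr// -mulr2n -(mulr_natl d) /d ltr_pdivrMr// mulrC.
have h1 : p.1 - d < p.1 + d by rewrite ltrD2l; lra.
have h2 : p.2 - d < p.2 + d by rewrite ltrD2l; lra.
have [q hq] := rat_in_itvoo h1.
have [q' hq'] := rat_in_itvoo h2.
move: hq hq'; rewrite !in_itv/= => /andP[q1 q2] /andP[q3 q4].
exists q => //; exists q' => //; exists n => //.
rewrite ifT; last first.
  apply/asboolP => -[x y] []; rewrite /I/= !in_itv/= -/d => /andP[x1 x2] /andP[y1 y2].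
  by apply: he; split; rewrite /ball/= ltr_norml; apply/andP; split; lra.
split; rewrite /I/= in_itv/= -/d; lra.
Qed.

Lemma continuous_measurable_plane (R : realType) (f : R * R -> R) : continuous f ->
  measurable_fun setT (f : measurableTypeR R * measurableTypeR R -> measurableTypeR R).
Proof.
move=> cf; apply: (measurability _ (RGenOInfty.measurableE R)).
move=> _ [_ [x ->] <-]; rewrite setTI; apply: open_measurable_plane.
by apply: open_comp; [move=> p _; exact: cf|exact: interval_open].
Qed.

(** * Radial functions, their profile and its weak derivative *)

Lemma sqn_axis (R : realType) (t : R) : 0 <= t -> sqn (Num.sqrt t, 0) = t.
Proof. by move=> t0; rewrite /sqn/= sqr_sqrtr// expr0n addr0. Qed.

(* The profile is taken in the variable t = |p|^2, for which the image of the
   measure of the disk is a multiple of the Lebesgue measure of [0, 1[. *)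
Definition radial_profile (R : realType) (u : R * R -> R) (t : R) : R := u (Num.sqrt t, 0).

Lemma disk_axis (R : realType) (t : R) : 0 <= t -> t < 1 -> disk R (Num.sqrt t, 0).
Proof. by move=> t0 t1; rewrite diskE/= in_itv/= sqn_axis ?t0. Qed.

Lemma radialE (R : realType) (u : R * R -> R) (p : R * R) : radial u -> disk R p ->
  u p = radial_profile u (sqn p).
Proof.
move=> ru Dp; apply: ru => //.
  apply: disk_axis; first exact: sqn_ge0.
  by move: Dp; rewrite diskE/= in_itv/= => /andP[].
by rewrite /enorm -!/(sqn _) sqn_axis// sqn_ge0.
Qed.

Lemma measurable_radial_profile (R : realType) (u : R * R -> R) :
  measurable_fun (disk R : set (plane R)) u ->
  measurable_fun (I01 R) (radial_profile u).
Proof.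
move=> mu; apply: (measurable_comp (F := disk R : set (plane R)) (f := u)
  (g := fun t : measurableTypeR R => (Num.sqrt t, 0 : measurableTypeR R))) => //.
- exact: measurable_disk.
- by move=> _ [t tI <-]; move: tI; rewrite /= in_itv/= => /andP[t0 t1]; exact: disk_axis.
- apply: measurable_funTS; apply/measurable_fun_pairP; split => /=; last exact: measurable_cst.
  by apply: continuous_measurable_fun; exact: sqrt_continuous.
Qed.

Lemma sqn_itv (R : realType) (p : R * R) : disk R p -> 0 <= sqn p < 1.
Proof. by rewrite diskE/= in_itv. Qed.

Lemma bounded_radial (R : realType) (h : R -> R) : continuous h ->
  exists2 C, 0 <= C & forall p, disk R p -> `|h (sqn p)| <= C.
Proof.
move=> ch; have [C C0 hC] := bounded_continuous_itv 0 1 ch.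
by exists C => // p /sqn_itv/andP[q0 /ltW q1]; exact: hC.
Qed.

Lemma measurable_radial (R : realType) (h : R -> R) : continuous h ->
  measurable_fun (disk R : set (plane R)) (fun p => h (sqn p)).
Proof.
move=> ch; apply: measurable_funTS.
exact: (measurableT_comp (continuous_measurable_fun ch) (@measurable_sqn R)).
Qed.

Lemma L2_bounded (R : realType) (f : R * R -> R) (C : R) :
  measurable_fun (disk R : set (plane R)) f ->
  (forall p, disk R p -> `|f p| <= C) -> L2 f.
Proof.
move=> mf fC; split=> //.
have : (@leb2 R).-integrable (disk R) (EFin \o (fun p => f p ^+ 2)).
  apply: (integrable_bounded_disk (C := C ^+ 2)); first exact: measurable_funX.
  by move=> p Dp; rewrite normrX lerXn2r ?nnegrE// ?fC// (le_trans (normr_ge0 _) (fC p Dp)).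
case/integrableP => _; apply: le_lt_trans; rewrite /sqnorm.
by under [leRHS]eq_integral do rewrite /= ger0_norm ?sqr_ge0//.
Qed.

Lemma disk_coord_le1 (R : realType) (p : R * R) : disk R p -> `|p.1| <= 1 /\ `|p.2| <= 1.
Proof.
move=> /sqn_itv/andP[_ /ltW]; rewrite /sqn => h; rewrite !ler_norml.
by have := sqr_ge0 p.1; have := sqr_ge0 p.2; split; apply: sqr_le1_itv; lra.
Qed.

Lemma L2_fst_radial (R : realType) (h : R -> R) : continuous h -> L2 (fun p : R * R => p.1 * h (sqn p)).
Proof.
move=> ch; have [C C0 hC] := bounded_radial ch.
apply: (@L2_bounded _ _ C).
  apply: measurable_funM; last exact: measurable_radial.
  by apply: measurable_funTS; exact: measurable_fst.
move=> p Dp; rewrite normrM -[leRHS]mul1r; apply: ler_pM => //; last exact: hC.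
by case: (disk_coord_le1 Dp).
Qed.

Lemma L2_snd_radial (R : realType) (h : R -> R) : continuous h -> L2 (fun p : R * R => p.2 * h (sqn p)).
Proof.
move=> ch; have [C C0 hC] := bounded_radial ch.
apply: (@L2_bounded _ _ C).
  apply: measurable_funM; last exact: measurable_radial.
  by apply: measurable_funTS; exact: measurable_snd.
move=> p Dp; rewrite normrM -[leRHS]mul1r; apply: ler_pM => //; last exact: hC.
by case: (disk_coord_le1 Dp).
Qed.

(** The weak gradient tested with the radial vector field $p\,h(|p|^2)$, one component at a time;
    the left factor $2(h+t\,h')$ at $t=|p|^2$ is the divergence of that field. *)
Lemma weak_grad_radial (R : realType) (u : R * R -> R) (g : R * R -> R * R) (h : R -> R) (b : R) :
  W12 u g -> b < 1 -> smooth1 h -> (forall t, b < t -> h t = 0) ->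
  \int[@leb2 R]_(p in disk R) (u p * (2 * (h (sqn p) + sqn p * derive1 h (sqn p)))) =
  - \int[@leb2 R]_(p in disk R) (((g p).1 * p.1 + (g p).2 * p.2) * h (sqn p)).
Proof.
move=> [Lu Lg1 Lg2 wg] b1 sh h0.
have mD := @measurable_disk R.
have ch : continuous h := sh 0%N.
have ch' : continuous (derive1 h) := smooth1_derive1 sh 0%N.
have [e1 _] := wg _ (test_function_fst_radial b1 sh h0).
have [_ e2] := wg _ (test_function_snd_radial b1 sh h0).
have D1 : 'D_(ex R) (fun p : R * R => p.1 * h (sqn p)) = (fun p => h (sqn p) + p.1 ^+ 2 * (2 * derive1 h (sqn p))).
  by apply/funext => p; rewrite derive_fst_radial//= ; ring.
have D2 : 'D_(ey R) (fun p : R * R => p.2 * h (sqn p)) = (fun p => h (sqn p) + p.2 ^+ 2 * (2 * derive1 h (sqn p))).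
  by apply/funext => p; rewrite derive_snd_radial//= ; ring.
have c2 : continuous (fun t => 2 * derive1 h t) by move=> t; apply: cvgM; [exact: cvg_cst|exact: ch'].
have LD1 : L2 ('D_(ex R) (fun p : R * R => p.1 * h (sqn p))).
  rewrite D1; have [C C0 hC] := bounded_radial ch; have [C' C'0 hC'] := bounded_radial c2.
  apply: (@L2_bounded _ _ (C + C')).
    apply: measurable_funD; first exact: measurable_radial.
    apply: measurable_funM; last exact: (measurable_radial c2).
    by apply: measurable_funX; apply: measurable_funTS; exact: measurable_fst.
  move=> p Dp; apply: (le_trans (ler_normD _ _)); apply: lerD; first exact: hC.
  rewrite normrM -[leRHS]mul1r; apply: ler_pM => //; last exact: (hC' p Dp).
  by rewrite normrX exprn_ile1//; case: (disk_coord_le1 Dp).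
have LD2 : L2 ('D_(ey R) (fun p : R * R => p.2 * h (sqn p))).
  rewrite D2; have [C C0 hC] := bounded_radial ch; have [C' C'0 hC'] := bounded_radial c2.
  apply: (@L2_bounded _ _ (C + C')).
    apply: measurable_funD; first exact: measurable_radial.
    apply: measurable_funM; last exact: (measurable_radial c2).
    by apply: measurable_funX; apply: measurable_funTS; exact: measurable_snd.
  move=> p Dp; apply: (le_trans (ler_normD _ _)); apply: lerD; first exact: hC.
  rewrite normrM -[leRHS]mul1r; apply: ler_pM => //; last exact: (hC' p Dp).
  by rewrite normrX exprn_ile1//; case: (disk_coord_le1 Dp).
have i1 := L2_integrable_mul Lu LD1.
have i2 := L2_integrable_mul Lu LD2.
have i3 := L2_integrable_mul Lg1 (L2_fst_radial ch).
have i4 := L2_integrable_mul Lg2 (L2_snd_radial ch).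
rewrite (_ : (fun p => u p * (2 * (h (sqn p) + sqn p * derive1 h (sqn p)))) =
  fun p => u p * 'D_(ex R) (fun p : R * R => p.1 * h (sqn p)) p + u p * 'D_(ey R) (fun p : R * R => p.2 * h (sqn p)) p); last first.
  by apply/funext => p; rewrite derive_fst_radial// derive_snd_radial// /sqn/=; ring.
rewrite (RintegralD mD i1 i2) e1 e2 -opprD -(RintegralD mD i3 i4).
by congr (- _); apply: eq_Rintegral => p _; ring.
Qed.

(** If $u=P(|p|^2)$ is smooth this is $2P'(|p|^2)$, so that [flux_tail g t] stands for
    $2c(P(1)-P(t))$ with $c$ the area of the disk. *)
Definition radial_flux (R : realType) (g : R * R -> R * R) (p : R * R) : R :=
  ((g p).1 * p.1 + (g p).2 * p.2) / sqn p.

Definition flux_tail (R : realType) (g : R * R -> R * R) (t : R) : R :=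
  \int[@leb2 R]_(p in disk R `&` [set p | t < sqn p]) radial_flux g p.

(** Division by $|p|^2$ can destroy integrability at the centre; removing the disk $|p|^2\le d$
    restores it and leaves the tails from $t\ge d$ unchanged. *)
Definition cut_flux (R : realType) (g : R * R -> R * R) (d : R) (p : R * R) : R :=
  radial_flux g p * \1_[set p | d < sqn p] p.

Lemma measurable_annulus (R : realType) (t : R) :
  measurable ([set p | t < sqn p] : set (plane R)).
Proof.
rewrite (_ : [set p | _] = @sqn R @^-1` `]t, +oo[%classic); first exact: measurable_preimage_sqn.
by apply/seteqP; split => p /=; rewrite in_itv/= andbT.
Qed.

Lemma measurable_cut_flux (R : realType) (g : R * R -> R * R) (d : R) : 0 < d ->
  measurable_fun (disk R : set (plane R)) (fun p => (g p).1) ->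
  measurable_fun (disk R : set (plane R)) (fun p => (g p).2) ->
  measurable_fun (disk R : set (plane R)) (cut_flux g d).
Proof.
move=> d0 m1 m2.
(* Where the indicator is nonzero, [sqn p] exceeds [d] and the maximum changes nothing; elsewhere it
   replaces the singular inverse by a continuous function. *)
have cm : continuous (fun t : R => (Num.max t d)^-1).
  move=> t; apply: cvgV; first by rewrite gt_eqF// lt_max d0 orbT.
  by apply: continuous_max; [exact: cvg_id|exact: cvg_cst].
rewrite (_ : cut_flux g d = fun p => ((g p).1 * p.1 + (g p).2 * p.2) * (Num.max (sqn p) d)^-1 * \1_[set p | d < sqn p] p).
  apply: measurable_funM; last by apply: measurable_indic; exact: measurable_annulus.
  apply: measurable_funM; last exact: (measurable_radial cm).
  apply: measurable_funD; apply: measurable_funM => //; apply: measurable_funTS.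
    exact: measurable_fst.
  exact: measurable_snd.
apply/funext => p; rewrite /cut_flux /radial_flux indicE.
have [|_] := boolP (p \in _); last by rewrite !mulr0.
by rewrite inE/= => /ltW h; congr (_ * _^-1 * _); apply/esym/max_idPl.
Qed.

Lemma integrable_cut_flux (R : realType) (g : R * R -> R * R) (d : R) : 0 < d ->
  L2 (fun p => (g p).1) -> L2 (fun p => (g p).2) ->
  (@leb2 R).-integrable (disk R) (EFin \o cut_flux g d).
Proof.
move=> d0 L1 Lg2; have mD := @measurable_disk R.
have i1 := integrable_norm (L2_integrable L1).
have i2 := integrable_norm (L2_integrable Lg2).
have i12 := integrable_scaler d^-1 mD (integrable_addr mD i1 i2).
have mc : measurable_fun (disk R : set (plane R)) (cut_flux g d).
  by apply: measurable_cut_flux => //; [case: L1|case: Lg2].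
apply: (integrable_dominated mD mc i12) => p Dp; rewrite /cut_flux indicE.
have [|_] := boolP (p \in _); last first.
  by rewrite mulr0 normr0 mulr_ge0 ?invr_ge0 ?(ltW d0)// addr_ge0/=.
rewrite inE/= mulr1 => dq.
have q0 : 0 < sqn p by exact: lt_trans d0 dq.
have [p1 p2] := disk_coord_le1 Dp.
rewrite /radial_flux normrM normfV (gtr0_norm q0) mulrC; apply: ler_pM => //.
- by rewrite invr_ge0 ltW.
- by rewrite lef_pV2 ?posrE// ltW.
- apply: (le_trans (ler_normD _ _)); rewrite !normrM.
  by apply: lerD; rewrite -[leRHS]mulr1 ler_wpM2l.
Qed.

Lemma flux_tail_cut (R : realType) (g : R * R -> R * R) (d t : R) : d <= t ->
  flux_tail g t = \int[@leb2 R]_(p in disk R `&` [set p | t < sqn p]) cut_flux g d p.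
Proof.
move=> dt; apply: eq_Rintegral => p; rewrite inE/= => -[_ tq].
by rewrite /cut_flux indicE mem_set ?mulr1//=; exact: le_lt_trans tq.
Qed.

Lemma integrable_flux_tail (R : realType) (g : R * R -> R * R) (a b : R) : 0 < a -> b < 1 ->
  L2 (fun p => (g p).1) -> L2 (fun p => (g p).2) ->
  (leb R).-integrable `[a, b] (EFin \o flux_tail g).
Proof.
move=> a0 b1 L1 Lg2.
have h := integrable_tail (@measurable_disk R) (@measurable_sqn R) (@sqn_itv R) (integrable_cut_flux a0 L1 Lg2).
have m1 : measurable (I01 R : set (measurableTypeR R)) by [].
have m2 : measurable (`[a, b]%classic : set (measurableTypeR R)) by [].
have := integrableS m1 m2 (itvcc_sub_co a0 b1) h.
apply: eq_integrable => // t; rewrite inE/= in_itv/= => /andP[at_ _].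
by rewrite (flux_tail_cut g at_).
Qed.

Lemma integrable_radial_profile (R : realType) (u : R * R -> R) : radial u -> L2 u ->
  (leb R).-integrable (I01 R) (EFin \o radial_profile u).
Proof.
move=> ru Lu; apply/integrable_disk_radial; first by apply: measurable_radial_profile; case: Lu.
apply: eq_integrable (L2_integrable Lu); first exact: measurable_disk.
by move=> p; rewrite inE => Dp /=; rewrite -radialE.
Qed.

(** In [weak_grad_radial] the left side is carried to $[0,1[$ by the image measure and the right
    side by the layer-cake formula, which turns $f$ into $f'$ and the flux into its tail. *)
Lemma profile_weak_derivative (R : realType) (u : R * R -> R) (g : R * R -> R * R)
  (f : R -> R) (a b : R) : radial u -> W12 u g -> 0 < a -> a < b -> b < 1 -> smooth1 f ->
  (forall t, t <= a \/ b <= t -> f t = 0) ->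
  \int[leb R]_(t in `[a, b])
     ((2 * disk_area R * radial_profile u t + flux_tail g t) * derive1 f t) = 0.
Proof.
move=> ru W a0 ab b1 sf f0.
have [Lu Lg1 Lg2 _] := W.
have fl t : t < a -> f t = 0 by move=> /ltW h; apply: f0; left.
have fr t : b < t -> f t = 0 by move=> /ltW h; apply: f0; right.
have sf' := smooth1_derive1 sf; have cf' : continuous (derive1 f) := sf' 0%N.
have [C C0 hC] := bounded_continuous_itv a b cf'.
have f'C t : `|derive1 f t| <= C.
  have [ta|ta] := ltP t a; first by rewrite (derive1_vanish_left fl ta) normr0.
  have [tb|tb] := ltP b t; first by rewrite (derive1_vanish_right fr tb) normr0.
  exact: hC.
(* Chosen so that $h+t\,h'=f'$: the divergence of the radial field becomes $2f'$. *)
pose h t := f t / t ^+ 1.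
have sh : smooth1 h := smooth1_div_pow 1 a0 sf fl.
have hr t : b < t -> h t = 0 by move=> /fr ft; rewrite /h ft mul0r.
have hE t : 2 * (h t + t * derive1 h t) = 2 * derive1 f t.
  rewrite (derive1_val (is_derive_div_pow 1 t a0 sf fl)) /h.
  have [ta|ta] := ltP t a.
    by rewrite (derive1_vanish_left fl ta) (fl _ ta) !mul0r !(mulr0, addr0).
  have t0 : t != 0 by rewrite gt_eqF// (lt_le_trans a0 ta).
  by field.
have := weak_grad_radial W b1 sh hr.
have -> : \int[@leb2 R]_(p in disk R) (u p * (2 * (h (sqn p) + sqn p * derive1 h (sqn p)))) =
  \int[@leb2 R]_(p in disk R) (radial_profile u (sqn p) * (2 * derive1 f (sqn p))).
  by apply: eq_Rintegral => p; rewrite inE => Dp; rewrite hE (radialE ru Dp).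
have -> : \int[@leb2 R]_(p in disk R) (((g p).1 * p.1 + (g p).2 * p.2) * h (sqn p)) =
  \int[@leb2 R]_(p in disk R) (cut_flux g a p * f (sqn p)).
  apply: eq_Rintegral => p _; rewrite /cut_flux indicE /h /radial_flux expr1.
  have [|] := boolP (p \in _); first by rewrite mulr1 mulrAC mulrA.
  rewrite notin_setE/= => /negP; rewrite -leNgt => qa; rewrite f0; last by left.
  by rewrite mul0r !mulr0.
have mI : measurable (I01 R : set (measurableTypeR R)) by [].
have mf' : measurable_fun (I01 R) (fun t => 2 * derive1 f t).
  apply: measurable_funM => //; apply: measurable_funTS; exact: continuous_measurable_fun.
have iV := integrable_radial_profile ru Lu.
have iVf : (leb R).-integrable (I01 R) (EFin \o (fun t => radial_profile u t * (2 * derive1 f t))).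
  apply: (integrable_mul_bounded mI iV mf' (C := 2 * C)) => t _.
  by rewrite normrM ger0_norm// ler_pM2l.
rewrite (Rintegral_disk_radial iVf).
have ik := integrable_cut_flux a0 Lg1 Lg2.
have df t := smooth1_is_derive t sf.
rewrite (Rintegral_layer_cake (@measurable_disk R) (@measurable_sqn R) (@sqn_itv R) ik df cf' f'C); last first.
  by rewrite fl.
have outab t : ~ `[a, b]%classic t -> derive1 f t = 0.
  rewrite /= in_itv/= => /negP; rewrite negb_and -!ltNge => /orP[ta|bt].
    exact: derive1_vanish_left fl _ ta.
  exact: derive1_vanish_right fr _ bt.
rewrite (@Rintegral_support1 R `[a, b]%classic (I01 R) _ (itvcc_sub_co a0 b1)); last first.
  by move=> t _ /outab ->; rewrite !mulr0.
rewrite (@Rintegral_support1 R `[a, b]%classic (I01 R) _ (itvcc_sub_co a0 b1)); last first.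
  by move=> t _ /outab ->; rewrite !mul0r.
have m2 : measurable (`[a, b]%classic : set (measurableTypeR R)) by [].
have iVf' := integrableS mI m2 (itvcc_sub_co a0 b1) iVf.
move=> e.
have iH := integrable_flux_tail a0 b1 Lg1 Lg2.
have iHf : (leb R).-integrable `[a, b] (EFin \o (fun t => flux_tail g t * derive1 f t)).
  apply: (integrable_mul_bounded m2 iH _ (C := C)) => //.
  by apply: measurable_funTS; exact: continuous_measurable_fun.
have -> : (fun t => (2 * disk_area R * radial_profile u t + flux_tail g t) * derive1 f t) =
  (fun t => disk_area R * (radial_profile u t * (2 * derive1 f t)) + flux_tail g t * derive1 f t).
  by apply/funext => t; ring.
rewrite (RintegralD m2 (integrable_scaler (disk_area R) m2 iVf') iHf) (RintegralZl _ m2 iVf') e.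
apply/eqP; rewrite addrC subr_eq0; apply/eqP; apply: eq_Rintegral => t; rewrite inE/= in_itv/= => /andP[at_ _].
by rewrite (flux_tail_cut g at_) mulrC.
Qed.

Lemma ae_imply (R : realType) (P Q : R -> Prop) : (forall t, P t -> Q t) ->
  {ae leb R, forall t, P t} -> {ae leb R, forall t, Q t}.
Proof. by move=> PQ; apply: filterS; first exact: (ae_filter_ringOfSetsType (leb R)). Qed.

(** This solves for the profile almost everywhere in terms of [flux_tail], which can be estimated
    pointwise; it is the source of the growth bound. *)
Lemma profile_flux (R : realType) (u : R * R -> R) (g : R * R -> R * R) :
  radial u -> W12 u g -> exists B, {ae leb R, forall t, 0 < t < 1 ->
    2 * disk_area R * radial_profile u t + flux_tail g t = B}.
Proof.
move=> ru W; have [Lu Lg1 Lg2 _] := W.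
apply: du_bois_reymond; last by move=> f a b a0 ab b1 sf f0; exact: (profile_weak_derivative ru W a0 ab b1 sf f0).
move=> a b a0 ab b1.
have mI : measurable (I01 R : set (measurableTypeR R)) by [].
have m2 : measurable (`[a, b]%classic : set (measurableTypeR R)) by [].
apply: integrable_addr => //; last exact: integrable_flux_tail.
apply: integrable_scaler => //.
exact: integrableS mI m2 (itvcc_sub_co a0 b1) (integrable_radial_profile ru Lu).
Qed.

(** * Logarithmic growth of the profile *)

Lemma enorm_sqr (R : realType) (p : R * R) : enorm p ^+ 2 = sqn p.
Proof. by rewrite sqr_sqrtr// sqn_ge0. Qed.

(** Cauchy-Schwarz bounds the flux by $|g|/|p|$, and Young's inequality splits this product. The
    free parameter [c] is optimised after integration, in place of an integral Cauchy-Schwarz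
    inequality. *)
Lemma radial_flux_le (R : realType) (g : R * R -> R * R) (p : R * R) (c : R) : 0 < c -> 0 < sqn p ->
  `|radial_flux g p| <= c / 2 * sqn (g p) + (2 * c)^-1 * (sqn p)^-1.
Proof.
move=> c0 q0; rewrite /radial_flux normrM normfV (gtr0_norm q0).
set s := `|_|.
have hs : s ^+ 2 <= sqn (g p) * sqn p.
  rewrite real_normK ?num_real// /sqn.
  have := sqr_ge0 ((g p).1 * p.2 - (g p).2 * p.1); nra.
rewrite ler_pdivrMr// mulrDl mulfVK ?gt_eqF//.
have -> : (2 * c)^-1 = c^-1 / 2 by rewrite invfM mulrC.
have cV : 0 < c^-1 by rewrite invr_gt0.
have : 0 <= (c * s - 1) ^+ 2 * c^-1 by rewrite mulr_ge0 ?sqr_ge0// ltW.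
have -> : (c * s - 1) ^+ 2 * c^-1 = c * s ^+ 2 - 2 * s + c^-1 by field; rewrite gt_eqF.
have : c * s ^+ 2 <= c * (sqn (g p) * sqn p) by rewrite ler_pM2l.
lra.
Qed.

Lemma L2_integrable_sqn (R : realType) (g : R * R -> R * R) :
  L2 (fun p => (g p).1) -> L2 (fun p => (g p).2) ->
  (@leb2 R).-integrable (disk R) (EFin \o (fun p => sqn (g p))).
Proof.
move=> L1 Lg2; exact: (integrable_addr (@measurable_disk R) (L2_integrable_sqr L1) (L2_integrable_sqr Lg2)).
Qed.

Lemma flux_tailE (R : realType) (g : R * R -> R * R) (t : R) :
  flux_tail g t = \int[@leb2 R]_(p in disk R) cut_flux g t p.
Proof.
rewrite /flux_tail Rintegral_mkcondr; apply: eq_Rintegral => p _.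
rewrite /cut_flux patchE indicE.
by case: (p \in [set p | t < sqn p]); rewrite ?mulr1 ?mulr0.
Qed.

Lemma integral_disk_annulus_inv (R : realType) (t t0 : R) : 0 < t -> t < t0 -> t0 < 1 ->
  (@leb2 R).-integrable (disk R) (EFin \o (fun p => (sqn p)^-1 * \1_`]t, t0]%classic (sqn p))) /\
  \int[@leb2 R]_(p in disk R) ((sqn p)^-1 * \1_`]t, t0]%classic (sqn p)) = disk_area R * (ln t0 - ln t).
Proof.
move=> t_gt0 tt0 t01.
pose h (x : R) := x^-1 * \1_`]t, t0]%classic x.
have cV x : t <= x -> x <= t0 -> {for x, continuous (fun x : R => x^-1)}.
  move=> tx _; apply: cvgV; first by rewrite gt_eqF// (lt_le_trans t_gt0).
  exact: cvg_id.
have m0 : measurable (`[t, t0]%classic : set (measurableTypeR R)) by [].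
have mI : measurable (I01 R : set (measurableTypeR R)) by [].
have sub : `]t, t0]%classic `<=` (I01 R).
  by move=> x /=; rewrite !in_itv/= => /andP[tx xt]; rewrite (le_trans (ltW t_gt0) (ltW tx)) (le_lt_trans xt).
have iV := integrable_continuous_itv cV.
have ih : (leb R).-integrable (I01 R) (EFin \o h).
  have sub' : `]t, t0]%classic `<=` `[t, t0]%classic.
    by move=> x /=; rewrite !in_itv/= => /andP[/ltW -> ->].
  have m1 : measurable (`]t, t0]%classic : set (measurableTypeR R)) by [].
  have := integrableS m0 m1 sub' iV.
  rewrite integrable_mkcond//= restrict_EFin => i1.
  apply: eq_integrable (integrableS measurableT mI (@subsetT _ _) i1) => // x _.
  by rewrite /h/= patchE indicE; case: (x \in _); rewrite ?mulr1 ?mulr0.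
split; first by apply/(@integrable_disk_radial R h) => //; exact: measurable_integrable ih.
rewrite (Rintegral_disk_radial ih); congr (_ * _).
have -> : \int[leb R]_(x in I01 R) h x = \int[leb R]_(x in `]t, t0]) h x.
  apply: Rintegral_support1 => // x _ xt; rewrite /h indicE memNset ?mulr0//.
have -> : \int[leb R]_(x in `]t, t0]) h x = \int[leb R]_(x in `]t, t0]) x^-1.
  by apply: eq_Rintegral => x xt; rewrite /h indicE xt mulr1.
rewrite Rintegral_itv_obnd_cbnd; last first.
  by apply: integrableS iV => // x /=; rewrite !in_itv/= => /andP[/ltW -> ->].
have dln x : t <= x -> x <= t0 -> is_derive x 1 (@ln R) x^-1.
  by move=> tx _; apply: is_derive1_ln; exact: lt_le_trans t_gt0 tx.
by rewrite (Rintegral_FTC2 tt0 dln cV).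
Qed.

(** The interval is open at 0 so that the indicator vanishes at the centre too: for $t_0=1/(n+2)$
    the indicators tend to 0 at every point, which dominated convergence uses in
    [cvg_core_energy]. *)
Definition core_energy (R : realType) (g : R * R -> R * R) (t0 : R) : R :=
  \int[@leb2 R]_(p in disk R) (sqn (g p) * \1_`]0, t0]%classic (sqn p)).

Lemma measurable_indic_sqn (R : realType) (a b : R) :
  measurable_fun (disk R : set (plane R)) (fun p => \1_`]a, b]%classic (sqn p) : R).
Proof.
apply: measurable_funTS.
exact: (measurableT_comp (measurable_indic (measurable_itv `]a, b])) (@measurable_sqn R)).
Qed.

Lemma cvg_core_energy (R : realType) (g : R * R -> R * R) :
  L2 (fun p => (g p).1) -> L2 (fun p => (g p).2) ->
  core_energy g n.+2%:R^-1 @[n --> \oo] --> (0 : R).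
Proof.
move=> L1 Lg2; have mD := @measurable_disk R.
have ig := L2_integrable_sqn L1 Lg2.
have mg := measurable_integrable ig.
have mfn n : measurable_fun (disk R : set (plane R))
    (fun p => (sqn (g p) * \1_`]0, n.+2%:R^-1]%classic (sqn p))%:E).
  by apply/measurable_EFinP; apply: measurable_funM => //; exact: measurable_indic_sqn.
have mf0 : measurable_fun (disk R : set (plane R)) (fun p => 0%:E : \bar R) by [].
have cv : {ae (@leb2 R), forall p, disk R p ->
   (sqn (g p) * \1_`]0, n.+2%:R^-1]%classic (sqn p))%:E @[n --> \oo] --> (0%:E : \bar R)}.
  apply: aeW => p _; apply: cvg_near_cst.
  have [q0|q0] := leP (sqn p) 0.
    near=> n; rewrite indicE memNset ?mulr0//= in_itv/= => /andP[h _].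
    by move: h; rewrite ltNge q0.
  near=> n; rewrite indicE memNset ?mulr0//= in_itv/= => /andP[_].
  apply/negP; rewrite -ltNge invf_plt ?posrE//.
  near: n; exists (Num.bound (sqn p)^-1) => // n /= hn.
  rewrite (lt_le_trans (archi_boundP _)) ?invr_ge0 ?(ltW q0)// ler_nat.
  by rewrite (leq_trans hn)// -addn2 leq_addr.
have dom : {ae (@leb2 R), forall p n, disk R p ->
   (`| (sqn (g p) * \1_`]0, n.+2%:R^-1]%classic (sqn p))%:E | <= `|(sqn (g p))%:E|)%E}.
  apply: aeW => p n _; rewrite lee_fin normrM ler_piMr// indicE.
  by case: (_ \in _); rewrite ?normr1 ?normr0.
have [_ _] := dominated_convergence mD mfn mf0 cv (integrable_abse ig) dom.
rewrite integral0 => h.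
exact: (fine_cvg h).
Unshelve. all: by end_near. Qed.

(** [radial_flux_le] integrated over the annulus $t<|p|^2\le t_0$: the inverse square yields the
    logarithm, and the energy is enlarged to the disk $|p|^2\le t_0$ to make it independent of
    $t$. *)
Lemma flux_tail_diff (R : realType) (g : R * R -> R * R) (t t0 c : R) :
  L2 (fun p => (g p).1) -> L2 (fun p => (g p).2) ->
  0 < t -> t < t0 -> t0 < 1 -> 0 < c ->
  `|flux_tail g t - flux_tail g t0| <= c / 2 * core_energy g t0 + (2 * c)^-1 * (disk_area R * (ln t0 - ln t)).
Proof.
move=> L1 Lg2 t_gt0 tt0 t01 c0; have mD := @measurable_disk R.
have t0_gt0 := lt_trans t_gt0 tt0.
have i1 := integrable_cut_flux t_gt0 L1 Lg2.
have i2 := integrable_cut_flux t0_gt0 L1 Lg2.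
have i12 := integrable_subr mD i1 i2.
rewrite !flux_tailE -(RintegralB mD i1 i2).
have [ia ea] := integral_disk_annulus_inv t_gt0 tt0 t01.
have ig : (@leb2 R).-integrable (disk R) (EFin \o (fun p => sqn (g p) * \1_`]0, t0]%classic (sqn p))).
  apply: (integrable_mul_bounded mD (L2_integrable_sqn L1 Lg2) (@measurable_indic_sqn R 0 t0) (C := 1)) => p _.
  by rewrite indicE; case: (_ \in _); rewrite ?normr1 ?normr0.
have j1 := integrable_scaler (c / 2) mD ig.
have j2 := integrable_scaler (2 * c)^-1 mD ia.
rewrite -ea /core_energy -(RintegralZl _ mD ig) -(RintegralZl _ mD ia) -(RintegralD mD j1 j2).
apply: (le_trans (le_normr_Rintegral mD i12)).
apply: (le_Rintegral mD (integrable_norm i12) (integrable_addr mD j1 j2)) => p Dp /=.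
rewrite /cut_flux !indicE.
have c0' := ltW c0.
have g0 : 0 <= c / 2 * (sqn (g p) * (sqn p \in `]0, t0]%classic)%:R).
  by apply: mulr_ge0; [exact: divr_ge0|apply: mulr_ge0; [exact: sqn_ge0|exact: ler0n]].
have g1 : 0 <= (2 * c)^-1 * ((sqn p)^-1 * (sqn p \in `]t, t0]%classic)%:R).
  apply: mulr_ge0; first by rewrite invr_ge0 mulr_ge0.
  by apply: mulr_ge0; [rewrite invr_ge0 sqn_ge0|exact: ler0n].
have [tq|tq] := ltP t (sqn p); last first.
  rewrite [p \in [set p0 | t < _]]memNset/=; last by apply/negP; rewrite -leNgt.
  rewrite [p \in [set p0 | t0 < _]]memNset/=; last by apply/negP; rewrite -leNgt (le_trans tq)// ltW.
  by rewrite !mulr0 subrr normr0 addr_ge0.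
rewrite [p \in [set p0 | t < _]]mem_set//= mulr1.
have [qt|qt] := leP (sqn p) t0; last first.
  by rewrite [p \in [set p0 | t0 < _]]mem_set//= mulr1 subrr normr0 addr_ge0.
rewrite [p \in [set p0 | t0 < _]]memNset/=; last by apply/negP; rewrite -leNgt.
rewrite mulr0 subr0 !mem_set/= ?in_itv/= ?tq ?qt ?(lt_trans t_gt0 tq)//.
by rewrite !mulr1; apply: radial_flux_le => //; exact: lt_trans tq.
Qed.

(* By the Cauchy-Schwarz inequality, V^2 <= C + e ln (1 / t) where e is controlled
   by the energy of g in a small disk, hence is as small as needed. *)
Lemma profile_exp_bound (R : realType) (u : R * R -> R) (g : R * R -> R * R) (b : R) :
  radial u -> W12 u g -> 0 <= b -> exists2 C, 0 < C &
    {ae leb R, forall t, 0 < t < 1 ->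
      expR (b * radial_profile u t ^+ 2) <= C / Num.sqrt t}.
Proof.
move=> ru W b0; have [Lu L1 Lg2 _] := W.
have [B hB] := profile_flux ru W.
have c_gt0 := disk_area_gt0 R; set c := disk_area R in c_gt0 hB.
(* The coefficient $s$ of $\sqrt L$ must satisfy $bs^2\le1$; adding 1 to [b] covers [b = 0]. *)
pose s : R := (b + 1)^-1.
have b1 : 0 < b + 1 by rewrite ltr_wpDl.
have s0 : 0 < s by rewrite invr_gt0.
have bs : b * s ^+ 2 <= 1.
  rewrite /s exprVn ler_pdivrMr ?exprn_gt0// mul1r expr2; nra.
have [n hn] : exists n, core_energy g n.+2%:R^-1 <= c * s ^+ 2.
  have e0 : 0 < c * s ^+ 2 by rewrite mulr_gt0// exprn_gt0.
  have /cvgr0Pnorm_le /(_ _ e0)[N _ h] := cvg_core_energy L1 Lg2.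
  by exists N; apply: le_trans (ler_norm _) (h N _) => /=.
set t0 : R := n.+2%:R^-1 in hn.
have t0_gt0 : 0 < t0 by rewrite invr_gt0.
have t0_lt1 : t0 < 1 by rewrite invf_lt1// ltr1n.
have mD := @measurable_disk R.
have ic := integrable_cut_flux t0_gt0 L1 Lg2.
pose B2 := \int[@leb2 R]_(p in disk R) `|cut_flux g t0 p|.
have hB2 t : t0 <= t -> `|flux_tail g t| <= B2.
  move=> tt; have it := integrable_cut_flux (lt_le_trans t0_gt0 tt) L1 Lg2.
  rewrite flux_tailE; apply: (le_trans (le_normr_Rintegral mD it)).
  apply: (le_Rintegral mD (integrable_norm it) (integrable_norm ic)) => p _ /=.
  rewrite /cut_flux !normrM ler_wpM2l// !indicE.
  have [h|h] := ltP t (sqn p); last by rewrite memNset ?normr0//=; apply/negP; rewrite -leNgt.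
  by rewrite !mem_set//=; exact: le_lt_trans h.
pose B1 := (`|B| + B2) / (2 * c).
have B20 : 0 <= B2 by apply: Rintegral_ge0 => p _; exact: normr_ge0.
have B10 : 0 <= B1 by rewrite divr_ge0 ?addr_ge0 ?mulr_ge0// ltW.
exists (expR (2 * b * B1 ^+ 2)); first exact: expR_gt0.
apply: ae_imply hB => t /[swap] /[dup] t01 /andP[t_gt0 t_lt1] /(_ t01) hV.
set V := radial_profile u t in hV *.
pose L := - ln t.
have L0 : 0 < L by rewrite oppr_gt0 ln_lt0// t_gt0.
have HV : `|V| <= B1 + s / 2 * Num.sqrt L.
  have H : `|flux_tail g t| <= B2 + c * s * Num.sqrt L.
    have [tt|tt] := leP t0 t.
      by apply: (le_trans (hB2 t tt)); rewrite lerDl !mulr_ge0 ?sqrtr_ge0// ltW.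
    have -> : flux_tail g t = flux_tail g t0 + (flux_tail g t - flux_tail g t0) by ring.
    apply: (le_trans (ler_normD _ _)); apply: lerD; first exact: hB2.
    have sL : 0 < Num.sqrt L by rewrite sqrtr_gt0.
    (* The optimal Young parameter: with core energy at most $cs^2$, each of the two terms is at
       most $cs\sqrt L/2$. *)
    pose k := Num.sqrt L / s.
    have k0 : 0 < k by rewrite divr_gt0.
    apply: (le_trans (flux_tail_diff L1 Lg2 t_gt0 tt t0_lt1 k0)); rewrite -/c.
    have lt0 : ln t0 - ln t <= Num.sqrt L ^+ 2.
      by rewrite sqr_sqrtr ?(ltW L0)// /L gerDr ltW// ln_lt0// t0_gt0.
    have h1 : k / 2 * core_energy g t0 <= k / 2 * (c * s ^+ 2).
      by rewrite ler_pM2l// divr_gt0.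
    have h2 : (2 * k)^-1 * (c * (ln t0 - ln t)) <= (2 * k)^-1 * (c * Num.sqrt L ^+ 2).
      have k2 : 0 < (2 * k)^-1 by rewrite invr_gt0 mulr_gt0.
      by rewrite (ler_pM2l k2) (ler_pM2l c_gt0).
    apply: (le_trans (lerD h1 h2)).
    rewrite le_eqVlt; apply/orP; left; apply/eqP; rewrite /k; field.
    by rewrite !gt_eqF.
  have -> : V = (B - flux_tail g t) / (2 * c) by rewrite -hV; field; rewrite gt_eqF.
  rewrite normrM normfV (gtr0_norm (_ : 0 < 2 * c)) ?mulr_gt0// ler_pdivrMr ?mulr_gt0//.
  apply: (le_trans (ler_normB _ _)).
  apply: (le_trans (lerD (lexx _) H)).
  rewrite le_eqVlt; apply/orP; left; apply/eqP; rewrite /B1; field.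
  by rewrite gt_eqF.
(* From $(x+y)^2\le2x^2+2y^2$. After multiplication by [b] the term in $L$ is at most $L/2$ because
   $bs^2\le1$, and $e^{L/2}=1/\sqrt t$. *)
have V2 : V ^+ 2 <= 2 * B1 ^+ 2 + s ^+ 2 * L / 2.
  rewrite -(real_normK (num_real V)) -[in leRHS](sqr_sqrtr (ltW L0)).
  have := normr_ge0 V; have := sqrtr_ge0 L.
  set x := Num.sqrt L in HV *; set y := `|V| in HV *; move=> x0 y0.
  have h : y ^+ 2 <= (B1 + s / 2 * x) ^+ 2 by rewrite lerXn2r ?nnegrE// (le_trans y0).
  apply: (le_trans h); have := sqr_ge0 (B1 - s / 2 * x); nra.
have -> : (Num.sqrt t)^-1 = expR (L / 2).
  have e : Num.sqrt t = expR (ln t / 2).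
    rewrite -[t in LHS]lnK ?posrE// -[X in expR X](_ : ln t / 2 + ln t / 2 = _); last by field.
    by rewrite expRD -expr2 sqrtr_sqr gtr0_norm// expR_gt0.
  by rewrite e -expRN /L mulNr.
rewrite -expRD ler_expR.
have h3 : b * V ^+ 2 <= b * (2 * B1 ^+ 2 + s ^+ 2 * L / 2) by rewrite ler_wpM2l.
have h4 : b * s ^+ 2 * (L / 2) <= 1 * (L / 2) by rewrite ler_wpM2r// divr_ge0 ?ltW.
lra.
Qed.

(** * Test functions as elements of $W^{1,2}_0$ *)

Lemma Cn_measurable (R : realType) (n : nat) (f : R * R -> R) : Cn n f ->
  measurable_fun (disk R : set (plane R)) f.
Proof.
move=> Cf; apply: measurable_funTS; apply: continuous_measurable_plane.
by elim: n f Cf => [//|n ih] f /Cn_le; exact: ih.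
Qed.

Lemma continuous_bounded_disk (R : realType) (f : R * R -> R) : continuous f ->
  exists C, forall p, disk R p -> `|f p| <= C.
Proof.
move=> cf.
have cD : compact (f @` [set p : R * R | sqn p <= 1]).
  apply: continuous_compact; last exact: compact_sqn_le.
  exact: continuous_subspaceT.
have [M [_ hM]] := compact_bounded cD.
exists (M + 1) => p /sqn_itv/andP[_ q1].
by apply: (hM (M + 1)); [rewrite ltrDl|exists p => //=; exact: ltW].
Qed.

Lemma L2_continuous (R : realType) (f : R * R -> R) : continuous f -> L2 f.
Proof.
move=> cf; have [C hC] := continuous_bounded_disk cf.
by apply: (L2_bounded _ hC); apply: measurable_funTS; exact: continuous_measurable_plane.
Qed.

Lemma test_function_D (R : realType) (f : R * R -> R) : test_function f ->
  test_function ('D_(ex R) f) /\ test_function ('D_(ey R) f).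
Proof.
move=> [sf [K [cK KD f0]]].
have D0 v p : ~ K p -> 'D_v f p = 0.
  move=> nKp; have oK : open (~` K) by apply: closed_openC; apply: compact_closed => //; exact: norm_hausdorff.
  rewrite (@near_eq_derive _ _ _ f (fun=> 0)) ?derive_cst//.
  by apply: filterS (open_nbhs_nbhs (conj oK nKp)) => q /f0.
by split; (split; [move=> n; have [_ ? ?] := sf n.+1|exists K; split => // p; exact: D0]).
Qed.

Lemma test_function_continuous (R : realType) (f : R * R -> R) : test_function f -> continuous f.
Proof. by move=> [/(_ 0%N)]. Qed.

Lemma test_function_derivable (R : realType) (f : R * R -> R) (p v : R * R) : test_function f -> derivable f p v.
Proof. by move=> [/(_ 1%N)/CnSP[df _ _] _]; exact: diff_derivable. Qed.

Lemma test_functionM (R : realType) (f h : R * R -> R) : test_function f -> test_function h ->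
  test_function (fun p => f p * h p).
Proof.
move=> [sf [K [cK KD f0]]] [sh _]; split; first by move=> n; exact: CnM.
by exists K; split => // p /f0 ->; rewrite mul0r.
Qed.

Lemma test_functionD (R : realType) (a b : R) (f h : R * R -> R) : test_function f -> test_function h ->
  test_function (fun p => a * f p + b * h p).
Proof.
move=> [sf [K [cK KD f0]]] [sh [K' [cK' KD' h0]]]; split.
  by move=> n; apply: CnD; apply: CnM => //; exact: Cn_cst.
exists (K `|` K'); split; first exact: compactU.
- by move=> p [/KD|/KD'].
- by move=> p /not_orP[/f0 -> /h0 ->]; rewrite !mulr0 addr0.
Qed.

Lemma test_function_out (R : realType) (f : R * R -> R) (p : R * R) : test_function f ->
  ~ disk R p -> f p = 0.
Proof. by move=> [_ [K [_ KD f0]]] nD; apply: f0 => /KD. Qed.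

Lemma is_derive_line_x (R : realType) (f : R * R -> R) (x y : R) : test_function f ->
  is_derive x 1 (fun x => f (x, y)) ('D_(ex R) f (x, y)).
Proof.
move=> tf; have := @test_function_derivable _ f (x, y) (ex R) tf.
have e (h : R) : h *: ex R + (x, y) = (h *: 1 + x, y).
  by rewrite /ex; congr pair; rewrite /= ?scaler0 ?add0r.
have E : (fun h : R => h^-1 *: (f (h *: ex R + (x, y)) - f (x, y))) = (fun h : R => h^-1 *: (f (h *: 1 + x, y) - f (x, y))).
  by apply/funext => h; rewrite e.
rewrite /derivable => df; apply: DeriveDef; first by rewrite /derivable; rewrite -[X in cvg (X @ _)]E.
by rewrite /derive -[X in lim (X @ _)]E.
Qed.

Lemma is_derive_line_y (R : realType) (f : R * R -> R) (x y : R) : test_function f ->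
  is_derive y 1 (fun y => f (x, y)) ('D_(ey R) f (x, y)).
Proof.
move=> tf; have := @test_function_derivable _ f (x, y) (ey R) tf.
have e (h : R) : h *: ey R + (x, y) = (x, h *: 1 + y).
  by rewrite /ey; congr pair; rewrite /= ?scaler0 ?add0r.
have E : (fun h : R => h^-1 *: (f (h *: ey R + (x, y)) - f (x, y))) = (fun h : R => h^-1 *: (f (x, h *: 1 + y) - f (x, y))).
  by apply/funext => h; rewrite e.
rewrite /derivable => df; apply: DeriveDef; first by rewrite /derivable; rewrite -[X in cvg (X @ _)]E.
by rewrite /derive -[X in lim (X @ _)]E.
Qed.

Lemma disk_itv (R : realType) (x y : R) : disk R (x, y) -> -1 < x < 1 /\ -1 < y < 1.
Proof.
move=> /sqn_itv/andP[_]; rewrite /sqn/= => h.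
by have := sqr_ge0 x; have := sqr_ge0 y; split; apply/andP; split; nra.
Qed.

Lemma test_function_integrableT (R : realType) (f : R * R -> R) : test_function f ->
  (@leb2 R).-integrable setT (EFin \o f).
Proof.
move=> tf; have := L2_integrable (L2_continuous (test_function_continuous tf)).
rewrite (integrable_mkcond _ (@measurable_disk R))/= restrict_EFin.
congr (integrable _ _ (EFin \o _)); apply/funext => p; rewrite patchE.
have [//|] := boolP (p \in disk R); rewrite notin_setE => nD.
by rewrite (test_function_out tf nD).
Qed.

Lemma Rintegral_test_function (R : realType) (f : R * R -> R) : test_function f ->
  (\int[@leb2 R]_(p in disk R) (f p)%:E = \int[@leb2 R]_p (f p)%:E)%E.
Proof.
move=> tf; rewrite integral_mkcond; apply: eq_integral => p _; rewrite patchE.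
have [//|] := boolP (p \in disk R); rewrite notin_setE => nD.
by rewrite (test_function_out tf nD).
Qed.

Lemma integral_line (R : realType) (F f : R -> R) :
  (forall t : R, is_derive t 1 F (f t)) -> continuous f -> F 1 = 0 -> F (-1) = 0 ->
  (forall t, ~ (-1 < t < 1) -> f t = 0) ->
  (\int[leb R]_t (f t)%:E = 0)%E.
Proof.
move=> dF cf F1 F0 f0.
have m1 : (-1 : R) < 1 by lra.
have mI : measurable (`[-1, 1]%classic : set (measurableTypeR R)) by [].
have := Rintegral_FTC2 m1 (fun t _ _ => dF t) (fun t _ _ => cf t).
rewrite F1 F0 subr0 => h.
have i : (leb R).-integrable `[-1, 1] (EFin \o f) by apply: integrable_continuous_itv => t _ _; exact: cf.
rewrite (_ : (\int[_]_t _)%E = (\int[leb R]_(t in `[(-1)%R, 1%R]) (f t)%:E)%E).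
  by rewrite -(fineK (integrable_fin_num mI i)); congr EFin.
rewrite [RHS]integral_mkcond; apply: eq_integral => t _; rewrite patchE.
have [//|] := boolP (t \in _); rewrite notin_setE/= in_itv/= => nI.
by rewrite f0// => /andP[h1 h2]; apply: nI; rewrite !ltW.
Qed.

Lemma continuous_pairl (R : realType) (y : R) : continuous (fun x : R => (x, y) : R * R).
Proof. by move=> x; apply: (@cvg_pair R R R (nbhs x) (nbhs x) (nbhs y)); [exact: cvg_id|exact: cvg_cst]. Qed.

Lemma continuous_pairr (R : realType) (x : R) : continuous (fun y : R => (x, y) : R * R).
Proof. by move=> y; apply: (@cvg_pair R R R (nbhs y) (nbhs x) (nbhs y)); [exact: cvg_cst|exact: cvg_id]. Qed.

(** As test functions are extended by 0, Fubini can be used over the whole plane; on each line the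
    derivative integrates to the difference of the values at 1 and -1, both 0. Applied to products
    of test functions this is integration by parts, and shows that the classical gradient is the
    weak one. *)
Lemma Rintegral_derive_test (R : realType) (f : R * R -> R) : test_function f ->
  \int[@leb2 R]_(p in disk R) 'D_(ex R) f p = 0 /\ \int[@leb2 R]_(p in disk R) 'D_(ey R) f p = 0.
Proof.
move=> tf; have [t1 t2] := test_function_D tf.
have out x y : ~ disk R (x, y) -> f (x, y) = 0 by exact: test_function_out.
split.
  rewrite /Rintegral Rintegral_test_function//.
  rewrite -[X in fine X](@integral21_prod_meas1 _ _ (measurableTypeR R) (measurableTypeR R) R (leb R) (leb R) (EFin \o 'D_(ex R) f)).
    rewrite integral0_eq// => y _.
    apply: (@integral_line R (fun x => f (x, y)) (fun x => 'D_(ex R) f (x, y))).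
    - by move=> x; exact: is_derive_line_x.
    - move=> x; apply: (@continuous_comp _ _ _ (fun x : R => (x, y)) ('D_(ex R) f)); last exact: test_function_continuous.
      exact: continuous_pairl.
    - by apply: out => /disk_itv[]; rewrite ltxx andbF.
    - by apply: out => /disk_itv[]; rewrite ltxx.
    - by move=> x nx; apply: (test_function_out t1) => /disk_itv[].
  exact: test_function_integrableT t1.
rewrite /Rintegral Rintegral_test_function//.
rewrite -[X in fine X](@integral12_prod_meas1 _ _ (measurableTypeR R) (measurableTypeR R) R (leb R) (leb R) (EFin \o 'D_(ey R) f)).
  rewrite integral0_eq// => x _.
  apply: (@integral_line R (fun y => f (x, y)) (fun y => 'D_(ey R) f (x, y))).
  - by move=> y; exact: is_derive_line_y.
  - move=> y; apply: (@continuous_comp _ _ _ (fun y : R => (x, y)) ('D_(ey R) f)); last exact: test_function_continuous.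
    exact: continuous_pairr.
  - by apply: out => /disk_itv[_]; rewrite ltxx andbF.
  - by apply: out => /disk_itv[_]; rewrite ltxx.
  - by move=> y ny; apply: (test_function_out t2) => /disk_itv[].
exact: test_function_integrableT t2.
Qed.

Lemma weak_grad_test (R : realType) (f : R * R -> R) : test_function f -> weak_grad f (grad f).
Proof.
move=> tf h th; have mD := @measurable_disk R.
have [d1 d2] := Rintegral_derive_test (test_functionM tf th).
have [t1 t2] := test_function_D tf; have [s1 s2] := test_function_D th.
have L (a b : R * R -> R) : test_function a -> test_function b ->
    (@leb2 R).-integrable (disk R) (EFin \o (fun p => a p * b p)).
  by move=> ta tb; apply: L2_integrable_mul; apply: L2_continuous; exact: test_function_continuous.
have prod (v : R * R) : (fun p => 'D_v (fun p => f p * h p) p) = (fun p => f p * 'D_v h p + 'D_v f p * h p).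
  apply/funext => p; have := deriveM (@test_function_derivable _ f p v tf) (@test_function_derivable _ h p v th).
  by rewrite /GRing.scale/= [h p * _]mulrC.
split.
  apply/eqP; rewrite -addr_eq0 -(RintegralD mD (L _ _ tf s1) (L _ _ t1 th)); apply/eqP.
  by rewrite -[RHS]d1 prod.
apply/eqP; rewrite -addr_eq0 -(RintegralD mD (L _ _ tf s2) (L _ _ t2 th)); apply/eqP.
by rewrite -[RHS]d2 prod.
Qed.

Lemma L2_of_integrable (R : realType) (f : R * R -> R) :
  measurable_fun (disk R : set (plane R)) f ->
  (@leb2 R).-integrable (disk R) (EFin \o (fun p => f p ^+ 2)) -> L2 f.
Proof.
move=> mf /integrableP[_ h]; split => //; apply: le_lt_trans h; rewrite /sqnorm.
by under [leRHS]eq_integral do rewrite /= ger0_norm ?sqr_ge0//.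
Qed.

Lemma L2_comb (R : realType) (a b : R) (f h : R * R -> R) : L2 f -> L2 h ->
  L2 (fun p => a * f p + b * h p).
Proof.
move=> Lf Lh; have mD := @measurable_disk R.
have [mf _] := Lf; have [mh _] := Lh.
apply: L2_of_integrable.
  by apply: measurable_funD; apply: measurable_funM.
rewrite (_ : (fun p => _) = fun p => (a ^+ 2 * f p ^+ 2 + b ^+ 2 * h p ^+ 2) + 2 * a * b * (f p * h p)); last first.
  by apply/funext => p; ring.
apply: integrable_addr => //; last by apply: integrable_scaler => //; exact: L2_integrable_mul.
by apply: integrable_addr => //; apply: integrable_scaler => //; exact: L2_integrable_sqr.
Qed.

Definition vcomb (R : realType) (a b : R) (g h : R * R -> R * R) (p : R * R) : R * R :=
  (a * (g p).1 + b * (h p).1, a * (g p).2 + b * (h p).2).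

Lemma weak_grad_comb (R : realType) (a b : R) (u v : R * R -> R) (g h : R * R -> R * R) :
  W12 u g -> W12 v h -> W12 (fun p => a * u p + b * v p) (vcomb a b g h).
Proof.
move=> [Lu Lg1 Lg2 wu] [Lv Lh1 Lh2 wv]; have mD := @measurable_disk R.
split; [exact: L2_comb|exact: L2_comb|exact: L2_comb|].
move=> f tf; have [t1 t2] := test_function_D tf.
have Lf := L2_continuous (test_function_continuous tf).
have Lt1 := L2_continuous (test_function_continuous t1).
have Lt2 := L2_continuous (test_function_continuous t2).
have [u1 u2] := wu f tf; have [v1 v2] := wv f tf.
have lin (x y z : R * R -> R) : L2 x -> L2 y -> L2 z ->
    \int[@leb2 R]_(p in disk R) ((a * x p + b * y p) * z p) =
    a * \int[@leb2 R]_(p in disk R) (x p * z p) + b * \int[@leb2 R]_(p in disk R) (y p * z p).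
  move=> Lx Ly Lz; have ix := L2_integrable_mul Lx Lz; have iy := L2_integrable_mul Ly Lz.
  rewrite -(RintegralZl a mD ix) -(RintegralZl b mD iy).
  rewrite -(RintegralD mD (integrable_scaler a mD ix) (integrable_scaler b mD iy)).
  by apply: eq_Rintegral => p _; ring.
split.
  have -> := lin _ _ _ Lu Lv Lt1; have -> := lin _ _ _ Lg1 Lh1 Lf.
  by rewrite u1 v1 !mulrN opprD.
have -> := lin _ _ _ Lu Lv Lt2; have -> := lin _ _ _ Lg2 Lh2 Lf.
by rewrite u2 v2 !mulrN opprD.
Qed.

Lemma W12_test (R : realType) (f : R * R -> R) : test_function f -> W12 f (grad f).
Proof.
move=> tf; have [t1 t2] := test_function_D tf; split.
- by apply: L2_continuous; exact: test_function_continuous.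
- by apply: L2_continuous; exact: (test_function_continuous t1).
- by apply: L2_continuous; exact: (test_function_continuous t2).
- exact: weak_grad_test.
Qed.

(** Admissibility of the competitors of the first variation. They are approximated by $a s_n+bf$:
    the term $bf$ cancels in the error, which is $a^2$ times the error of $s_n$. *)
Lemma W012_comb (R : realType) (a b : R) (u f : R * R -> R) (g : R * R -> R * R) :
  W012 u g -> test_function f -> W012 (fun p => a * u p + b * f p) (vcomb a b g (grad f)).
Proof.
move=> [Wu [s [ts cs]]] tf; split; first exact: weak_grad_comb Wu (W12_test tf).
have [[mu _] [mg1 _] [mg2 _] _] := Wu.
exists (fun n p => a * s n p + b * f p); split; first by move=> n; exact: test_functionD.
have mD := @measurable_disk R.
have a2 : (0%:E <= (a ^+ 2)%:E)%E by rewrite lee_fin sqr_ge0.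
have e1 n : (sqnorm (fun p => (a * s n p + b * f p) - (a * u p + b * f p))%R = (a ^+ 2)%:E * sqnorm (fun p => s n p - u p)%R)%E.
  rewrite /sqnorm -ge0_integralZl//; last 2 first.
  - apply/measurable_EFinP; apply: measurable_funX; apply: measurable_funB => //.
    by apply: (@Cn_measurable _ 0%N); exact: test_function_continuous.
  - by move=> p _; rewrite lee_fin sqr_ge0.
  by apply: eq_integral => p _; rewrite -EFinM; congr EFin; ring.
have e2 n : (sqnorm_vec (fun p => grad (fun p => a * s n p + b * f p) p - vcomb a b g (grad f) p)%R =
    (a ^+ 2)%:E * sqnorm_vec (fun p => grad (s n) p - g p)%R)%E.
  have [d1 d2] := test_function_D (ts n).
  rewrite /sqnorm_vec -ge0_integralZl//; last 2 first.
  - apply/measurable_EFinP.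
    rewrite (_ : (fun p => _) = fun p => ('D_(ex R) (s n) p - (g p).1) ^+ 2 + ('D_(ey R) (s n) p - (g p).2) ^+ 2); last first.
      by apply/funext => p; rewrite enorm_sqr.
    apply: measurable_funD; apply: measurable_funX; apply: measurable_funB => //.
      by apply: (@Cn_measurable _ 0%N); exact: (test_function_continuous d1).
    by apply: (@Cn_measurable _ 0%N); exact: (test_function_continuous d2).
  - by move=> p _; rewrite lee_fin sqr_ge0.
  apply: eq_integral => p _; rewrite -EFinM; congr EFin; rewrite !enorm_sqr /sqn /grad /vcomb/=.
  have der (v : R * R) : 'D_v (fun p => a * s n p + b * f p) p = a * 'D_v (s n) p + b * 'D_v f p.
    have ds := @test_function_derivable _ (s n) p v (ts n); have df := @test_function_derivable _ f p v tf.
    have da : derivable (a \*: s n) p v by exact: derivableZ.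
    have db : derivable (b \*: f) p v by exact: derivableZ.
    by have := deriveD da db; rewrite !deriveZ.
  by rewrite !der; ring.
rewrite (_ : (fun n => _) = (fun n => (a ^+ 2)%:E * (sqnorm (fun p => s n p - u p)%R + sqnorm_vec (fun p => grad (s n) p - g p)%R))%E); last first.
  apply/funext => n.
  have s1 : (0 <= sqnorm (fun p => s n p - u p)%R)%E by apply: integral_ge0 => p _; rewrite lee_fin sqr_ge0.
  have s2 : (0 <= sqnorm_vec (fun p => grad (s n) p - g p)%R)%E by apply: integral_ge0 => p _; rewrite lee_fin sqr_ge0.
  by rewrite (ge0_muleDr _ s1 s2) e1 e2.
by rewrite -(mule0 (a ^+ 2)%:E); apply: cvgeZl.
Qed.

(** * Integrability from a bound by a multiple of $1/\sqrt t$ *)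

Lemma measurable_inv_sqrt (R : realType) : measurable_fun `]0, (1 : R)[ (fun x : R => (Num.sqrt x)^-1).
Proof.
apply: open_continuous_measurable_fun; first exact: interval_open.
move=> x; rewrite inE/= in_itv/= => /andP[x0 _].
by apply: cvgV; [rewrite gt_eqF// sqrtr_gt0|exact: sqrt_continuous].
Qed.

(** The singularity is avoided by shifting $x$ to $x+1/(n+1)$. The fundamental theorem and the
    subadditivity of the square root give a bound uniform in $n$, and monotone convergence removes
    the shift. *)
Lemma integral_inv_sqrt_le (R : realType) (t : R) : 0 < t ->
  (\int[leb R]_(x in `]0%R, t[) ((Num.sqrt x)^-1)%:E <= (2 * Num.sqrt t)%:E)%E.
Proof.
move=> t0.
pose e n : R := n.+1%:R^-1.
have e0 n : 0 < e n by rewrite invr_gt0.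
pose f n (x : R) : R := (Num.sqrt (x + e n))^-1.
have cf n x : 0 <= x -> {for x, continuous (f n)}.
  move=> x0; apply: cvgV; first by rewrite gt_eqF// sqrtr_gt0 ltr_wpDl.
  apply: (@continuous_comp _ _ _ (fun x : R => x + e n) (@Num.sqrt R)); last exact: sqrt_continuous.
  by apply: cvgD; [exact: cvg_id|exact: cvg_cst].
have m0 : measurable (`[0, t]%classic : set (measurableTypeR R)) by [].
have m1 : measurable (`]0, t[%classic : set (measurableTypeR R)) by [].
have iF n : (\int[leb R]_(x in `]0%R, t[) (f n x)%:E <= (2 * Num.sqrt t)%:E)%E.
  have dF (x : R) : 0 <= x -> x <= t -> is_derive x 1 (fun x => 2 * Num.sqrt (x + e n)) (f n x).
    move=> x0 _; have xe : 0 < x + e n by rewrite ltr_wpDl.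
    have d1 : is_derive x 1 (fun x : R => x + e n) (1 + 0).
      by apply: is_derive1_add; exact: is_derive_cst.
    have := is_derive1_scale 2 (is_derive1_compose d1 (is_derive1_sqrt xe)).
    by congr (is_derive _ _ _ _); rewrite addr0 mulr1 invfM mulrA divff ?mul1r.
  have cF x : 0 <= x -> x <= t -> {for x, continuous (f n)} by move=> x0 _; exact: cf.
  have ii := integrable_continuous_itv cF.
  have := Rintegral_FTC2 t0 dF cF; rewrite /Rintegral add0r => h.
  have -> : (\int[leb R]_(x in `]0%R, t[) (f n x)%:E = \int[leb R]_(x in `[0%R, t]) (f n x)%:E)%E.
    rewrite [RHS]integral_itv_bndoo//; apply/measurable_EFinP.
    by apply: measurable_funS (measurable_integrable ii) => // x /=; rewrite !in_itv/= => /andP[/ltW -> /ltW ->].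
  rewrite -(fineK (integrable_fin_num m0 ii)) lee_fin [leLHS]h.
  have s1 := sqrtr_ge0 t; have s2 := sqrtr_ge0 (e n).
  suff : Num.sqrt (t + e n) <= Num.sqrt t + Num.sqrt (e n) by lra.
  rewrite -(ler_pXn2r (n := 2)) ?nnegrE ?sqrtr_ge0 ?addr_ge0//.
  rewrite sqr_sqrtr; last by rewrite addr_ge0// ltW.
  rewrite sqrrD sqr_sqrtr ?(ltW t0)// sqr_sqrtr ?(ltW (e0 n))//.
  have := mulr_ge0 s1 s2; lra.
have mf n : measurable_fun `]0, t[ (fun x => (f n x)%:E).
  apply/measurable_EFinP; apply: open_continuous_measurable_fun; first exact: interval_open.
  by move=> x; rewrite inE/= in_itv/= => /andP[/ltW x0 _]; exact: cf.
have f0 n x : `]0, t[%classic x -> (0 <= (f n x)%:E)%E.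
  by move=> _; rewrite lee_fin invr_ge0 sqrtr_ge0.
have fnd x : `]0, t[%classic x -> {homo (fun n => (f n x)%:E) : n m / (n <= m)%N >-> (n <= m)%E}.
  rewrite /= in_itv/= => /andP[x0 _] n m nm; rewrite lee_fin /f.
  have en k : 0 < x + e k by rewrite addr_gt0.
  rewrite lef_pV2 ?posrE ?sqrtr_gt0//; apply: ler_wsqrtr; rewrite lerD2l /e.
  by rewrite lef_pV2 ?posrE// ler_nat.
have h := @cvg_monotone_convergence _ _ R (leb R) _ m1 _ mf f0 fnd.
have -> : (\int[leb R]_(x in `]0%R, t[) ((Num.sqrt x)^-1)%:E = \int[leb R]_(x in `]0%R, t[) limn (fun n => (f n x)%:E))%E.
  apply: eq_integral => x; rewrite inE/= in_itv/= => /andP[x0 _].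
  apply/esym/cvg_lim => //; apply: cvg_EFin; first by near=> n.
  apply: cvgV; first by rewrite gt_eqF// sqrtr_gt0.
  apply: continuous_cvg; first exact: sqrt_continuous.
  rewrite -[X in _ --> X]addr0; apply: cvgD; first exact: cvg_cst.
  exact: cvg_harmonic.
rewrite -(cvg_lim _ h)//; apply: lime_le; first by apply/cvg_ex; eexists; exact: h.
by near=> n; exact: iF.
Unshelve. all: by end_near. Qed.

Lemma integrable_inv_sqrt (R : realType) :
  (leb R).-integrable `]0, (1 : R)[ (EFin \o (fun x : R => (Num.sqrt x)^-1)).
Proof.
apply/integrableP; split; first by apply/measurable_EFinP; exact: measurable_inv_sqrt.
under eq_integral do rewrite /= ger0_norm ?invr_ge0 ?sqrtr_ge0//.
by apply: le_lt_trans (integral_inv_sqrt_le ltr01) _; rewrite ltry.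
Qed.

Lemma ae_bound_integrable (R : realType) (f : R -> R) (C : R) : 0 < C ->
  measurable_fun (I01 R) f -> (forall t, 0 <= f t) ->
  {ae leb R, forall t, 0 < t < 1 -> f t <= C / Num.sqrt t} ->
  (leb R).-integrable (I01 R) (EFin \o f).
Proof.
move=> C0 mf f0 fC; apply/integrableP; split; first exact/measurable_EFinP.
have sub : `]0, (1 : R)[%classic `<=` (I01 R).
  by move=> t /=; rewrite !in_itv/= => /andP[/ltW -> ->].
have mf' : measurable_fun `]0, (1 : R)[ (fun t => (f t)%:E).
  by apply/measurable_EFinP; apply: measurable_funS mf.
under eq_integral do rewrite /= ger0_norm ?f0//.
rewrite integral_itv_bndoo//.
apply: (@le_lt_trans _ _ (\int[leb R]_(t in `]0%R, 1%R[) (C * (Num.sqrt t)^-1)%:E)%E).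
  apply: ae_ge0_le_integral => //.
  - by move=> t _; rewrite lee_fin.
  - by move=> t _; rewrite lee_fin mulr_ge0 ?invr_ge0 ?sqrtr_ge0// ltW.
  - by apply/measurable_EFinP; apply: measurable_funM => //; exact: measurable_inv_sqrt.
have m1 : measurable (`]0, 1[%classic : set (measurableTypeR R)) by [].
have /integrableP[_] := integrable_scaler C m1 (@integrable_inv_sqrt R).
apply: le_lt_trans; rewrite le_eqVlt; apply/orP; left; apply/eqP; apply: eq_integral => t _.
by rewrite /= ger0_norm// mulr_ge0 ?invr_ge0 ?sqrtr_ge0// ltW.
Qed.

(** * Euler-Lagrange equation *)

Lemma integrable_exp_radial (R : realType) (u : R * R -> R) (g : R * R -> R * R) (b : R) :
  radial u -> W12 u g -> 0 <= b ->
  (leb R).-integrable (I01 R) (EFin \o (fun t => expR (b * radial_profile u t ^+ 2))).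
Proof.
move=> ru W b0; have [C C0 hC] := profile_exp_bound ru W b0.
have [[mu _] _ _ _] := W.
apply: (ae_bound_integrable C0 _ _ hC).
  apply: measurableT_comp => //; apply: measurable_funM => //; apply: measurable_funX.
  exact: measurable_radial_profile.
by move=> t; exact: expR_ge0.
Qed.

Lemma integrable_exp_disk (R : realType) (u : R * R -> R) (g : R * R -> R * R) (b : R) :
  radial u -> W12 u g -> 0 <= b ->
  (@leb2 R).-integrable (disk R) (EFin \o (fun p => expR (b * u p ^+ 2))).
Proof.
move=> ru W b0; have i := integrable_exp_radial ru W b0.
have /integrable_disk_radial h := measurable_integrable i.
apply: eq_integrable (h.1 i); first exact: measurable_disk.
by move=> p; rewrite inE => Dp /=; rewrite -radialE.
Qed.

(** Polynomial factors are absorbed by passing from $a$ to $a+1$ in the exponent, which is harmless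
    since $e^{bu^2}$ is integrable for every $b\ge0$. *)
Lemma sqr_exp_le (R : realType) (a x : R) : x ^+ 2 * expR (a * x ^+ 2) <= expR ((a + 1) * x ^+ 2).
Proof.
rewrite mulrDl mul1r expRD mulrC ler_pM2l ?expR_gt0//.
by have := expR_ge1Dx (x ^+ 2); lra.
Qed.

Lemma abs_exp_le (R : realType) (a x : R) : `|x| * expR (a * x ^+ 2) <= expR ((a + 1) * x ^+ 2).
Proof.
rewrite mulrDl mul1r expRD mulrC ler_pM2l ?expR_gt0//.
have := expR_ge1Dx (x ^+ 2); rewrite -(real_normK (num_real x)).
have := sqr_ge0 (`|x| - 1); nra.
Qed.

Lemma measurable_exp_sqr (R : realType) (u : R * R -> R) (a : R) :
  measurable_fun (disk R : set (plane R)) u ->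
  measurable_fun (disk R : set (plane R)) (fun p => expR (a * u p ^+ 2)).
Proof. by move=> mu; apply: measurableT_comp => //; apply: measurable_funM => //; apply: measurable_funX. Qed.

Lemma integrable_sqr_exp (R : realType) (u : R * R -> R) (g : R * R -> R * R) (a : R) :
  radial u -> W12 u g -> 0 <= a ->
  (@leb2 R).-integrable (disk R) (EFin \o (fun p => u p ^+ 2 * expR (a * u p ^+ 2))).
Proof.
move=> ru W a0; have [[mu _] _ _ _] := W; have mD := @measurable_disk R.
have a1 : 0 <= a + 1 by rewrite addr_ge0.
apply: (integrable_dominated mD _ (integrable_exp_disk ru W a1)).
  by apply: measurable_funM; [exact: measurable_funX|exact: measurable_exp_sqr].
by move=> p _; rewrite ger0_norm ?sqr_exp_le// mulr_ge0 ?sqr_ge0 ?expR_ge0.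
Qed.

Lemma integrable_mul_exp (R : realType) (u : R * R -> R) (g : R * R -> R * R) (a : R) :
  radial u -> W12 u g -> 0 <= a ->
  (@leb2 R).-integrable (disk R) (EFin \o (fun p => u p * expR (a * u p ^+ 2))).
Proof.
move=> ru W a0; have [[mu _] _ _ _] := W; have mD := @measurable_disk R.
have a1 : 0 <= a + 1 by rewrite addr_ge0.
apply: (integrable_dominated mD _ (integrable_exp_disk ru W a1)).
  by apply: measurable_funM => //; exact: measurable_exp_sqr.
by move=> p _; rewrite normrM (ger0_norm (expR_ge0 _)) abs_exp_le.
Qed.

Lemma disk_not_negligible (R : realType) (P : R * R -> Prop) :
  (forall p, disk R p -> ~ P p) -> ~ {ae @leb2 R, forall p, disk R p -> P p}.
Proof.
move=> nP h.
have : (@leb2 R).-negligible (disk R).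
  by apply: negligibleS h => p Dp /= /(_ Dp); exact: nP.
move=> [A [mA A0 sA]].
have : (@leb2 R (disk R) <= @leb2 R A)%E.
  by apply: (le_measure (@leb2 R)) => //; rewrite inE//; exact: measurable_disk.
have -> : (@leb2 R A = 0)%E by exact: A0.
by rewrite leb2_disk lee_fin leNgt disk_area_gt0.
Qed.

Lemma Rintegral_disk_gt0 (R : realType) (f : R * R -> R) :
  (@leb2 R).-integrable (disk R) (EFin \o f) -> (forall p, disk R p -> 0 < f p) ->
  0 < \int[@leb2 R]_(p in disk R) f p.
Proof.
move=> fi f0; have mD := @measurable_disk R.
rewrite lt_neqAle Rintegral_ge0 ?andbT; last by move=> p /f0/ltW.
apply/eqP => /esym i0.
have : (\int[@leb2 R]_(p in disk R) `|(EFin \o f) p| = 0)%E.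
  have -> : (\int[@leb2 R]_(p in disk R) `|(EFin \o f) p| = \int[@leb2 R]_(p in disk R) (EFin \o f) p)%E.
    by apply: eq_integral => p; rewrite inE => Dp /=; rewrite gtr0_norm// f0.
  by rewrite -(fineK (integrable_fin_num mD fi)); congr EFin.
move=> /(ae_eq_integral_abs _ mD (measurable_int _ fi)).
by apply: disk_not_negligible => p Dp /=; move/eqP; rewrite eqe gt_eqF// f0.
Qed.

(** The tangent-line inequality for the convex function $x\mapsto e^{ax^2}$. It takes the place of
    differentiating the energy under the integral sign. *)
Lemma exp_sqr_convex (R : realType) (a x y : R) : 0 <= a ->
  expR (a * x ^+ 2) + 2 * a * (x * expR (a * x ^+ 2) * (y - x)) <= expR (a * y ^+ 2).
Proof.
move=> a0.
have -> : a * y ^+ 2 = a * x ^+ 2 + a * (y ^+ 2 - x ^+ 2) by ring.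
rewrite expRD; have e0 := expR_gt0 (a * x ^+ 2); set e := expR (a * x ^+ 2) in e0 *.
have h := expR_ge1Dx (a * (y ^+ 2 - x ^+ 2)).
have h2 : a * (2 * x * (y - x)) <= a * (y ^+ 2 - x ^+ 2).
  by rewrite ler_wpM2l//; have := sqr_ge0 (y - x); nra.
have h3 : e * (1 + a * (2 * x * (y - x))) <= e * expR (a * (y ^+ 2 - x ^+ 2)).
  by rewrite ler_pM2l//; lra.
apply: le_trans h3; rewrite le_eqVlt; apply/orP; left; apply/eqP; ring.
Qed.

Lemma sqnorm_vecE (R : realType) (g : R * R -> R * R) :
  L2 (fun p => (g p).1) -> L2 (fun p => (g p).2) ->
  sqnorm_vec g = (\int[@leb2 R]_(p in disk R) sqn (g p))%:E.
Proof.
move=> L1 Lg2; have mD := @measurable_disk R.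
rewrite /Rintegral fineK; last exact: (integrable_fin_num mD (L2_integrable_sqn L1 Lg2)).
by apply: eq_integral => p _; rewrite enorm_sqr.
Qed.

Lemma norm_vec_le1 (R : realType) (g : R * R -> R * R) :
  L2 (fun p => (g p).1) -> L2 (fun p => (g p).2) ->
  (norm_vec g <= 1)%E = (\int[@leb2 R]_(p in disk R) sqn (g p) <= 1).
Proof.
move=> L1 Lg2; rewrite /norm_vec sqnorm_vecE//= lee_fin -[X in _ <= X]sqrtr1 ler_sqrt//.
Qed.

(* Here G + 2 e B + e^2 N is the squared norm of g + e (grad f), and s bounds it,
   so that (u + e f) / s is a competitor. *)
Lemma first_variation_arith (R : realType) (I J G B N : R) : 0 < I -> G <= 1 ->
  (forall e s, 0 < s -> G + 2 * e * B + e ^+ 2 * N <= s ^+ 2 -> (1 - s) * I + e * J <= 0) ->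
  I * B = J.
Proof.
move=> I0 G1 h.
pose j := J / I.
have Jj : J = j * I by rewrite /j divfK// gt_eqF.
(* Otherwise some $s<1+ej$ has $q\le s^2$, and the hypothesis fails: $(1-s)I+eJ=(1+ej-s)I>0$. *)
have key e : 0 < 1 + e * j -> (1 + e * j) ^+ 2 <= G + 2 * e * B + e ^+ 2 * N.
  move=> ej; rewrite leNgt; apply/negP => Q.
  set q := G + _ + _ in h Q *.
  (* The second argument keeps [s] positive when $q\le0$, where [Num.sqrt q] is 0. *)
  pose s := Num.max (Num.sqrt q) ((1 + e * j) / 2).
  have s0 : 0 < s by rewrite lt_max divr_gt0// orbT.
  have s1 : s < 1 + e * j.
    rewrite gt_max; apply/andP; split; last by rewrite ltr_pdivrMr//; lra.
    rewrite -(gtr0_norm ej) -sqrtr_sqr ltr_sqrt// exprn_gt0//.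
  have sq : q <= s ^+ 2.
    have [q0|q0] := leP 0 q; last by rewrite (le_trans (ltW q0))// sqr_ge0.
    rewrite -[leLHS](sqr_sqrtr q0) lerXn2r ?nnegrE ?sqrtr_ge0 ?(ltW s0)//.
    by rewrite /s le_max lexx.
  have := h e s s0 sq; rewrite Jj; nra.
suff : B - j = 0 by move=> /eqP; rewrite subr_eq0 => /eqP ->; rewrite Jj mulrC.
apply/eqP/negPn/negP => d0; set d := B - j in d0.
(* With $d=B-j$ and $e=-dt$, [key] and $G\le1$ give $0\le td^2(tN-2)-(dtj)^2$. Taking $t=1/M$ makes
   $tN<1$, so the right side is negative, and it also makes $1+ej$ positive. *)
pose M := 1 + `|N| + `|d * j|.
have M0 : 0 < M by rewrite /M; have := normr_ge0 N; have := normr_ge0 (d * j); lra.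
pose t := M^-1.
have t0 : 0 < t by rewrite invr_gt0.
have tM : t * M = 1 by rewrite /t mulVf// gt_eqF.
have tn : t * `|N| < 1 by rewrite -tM ltr_pM2l// /M; have := normr_ge0 (d * j); lra.
have td : t * `|d * j| < 1 by rewrite -tM ltr_pM2l// /M; have := normr_ge0 N; lra.
have d2 : 0 < d ^+ 2 by rewrite exprn_even_gt0.
have ej : 0 < 1 + (- (d * t)) * j.
  have : t * (d * j) < 1 by apply: le_lt_trans td; rewrite ler_wpM2l ?(ltW t0)// ler_norm.
  have -> : - (d * t) * j = - (t * (d * j)) by ring.
  lra.
have := key _ ej.
have -> : B = j + d by rewrite /d; ring.
move=> h1.
have h2 : 0 <= t * d ^+ 2 * (t * N - 2) - (d * t * j) ^+ 2.
  move: h1 G1; set q := _ ^+ 2; have := erefl q; rewrite {1}/q => <-.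
  have -> : t * d ^+ 2 * (t * N - 2) - (d * t * j) ^+ 2 = (1 + 2 * - (d * t) * (j + d) + (- (d * t)) ^+ 2 * N) - (1 + - (d * t) * j) ^+ 2 by ring.
  lra.
have h3 : t * N < 1 by apply: le_lt_trans tn; rewrite ler_wpM2l ?(ltW t0)// ler_norm.
have h4 : 0 < t * d ^+ 2 by rewrite mulr_gt0.
have h5 := sqr_ge0 (d * t * j).
nra.
Qed.

(** The competitor is $(u+ef)/s$. Its energy is at most that of $u$ by optimality, and at least the
    integral of the tangent-line minorant at $u$. Comparing the two leaves $(1-s)I+eJ\le0$, an
    inequality that [first_variation_arith] converts into the equation; $1/I$ plays the part of the
    Lagrange multiplier. *)
Lemma euler_lagrange (R : realType) (alpha : R) (u : R * R -> R) (g : R * R -> R * R) (f : R * R -> R) :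
  0 < alpha -> radial u -> (forall p, disk R p -> 0 < u p) ->
  TM_energy alpha u = TM alpha -> W012 u g -> (norm_vec g <= 1)%E -> test_function f ->
  (\int[@leb2 R]_(p in disk R) (u p ^+ 2 * expR (alpha * u p ^+ 2))) *
    (\int[@leb2 R]_(p in disk R) ((g p).1 * 'D_(ex R) f p + (g p).2 * 'D_(ey R) f p)) =
  \int[@leb2 R]_(p in disk R) (u p * expR (alpha * u p ^+ 2) * f p).
Proof.
move=> a0 ru u0 uTM W0 ng tf; have mD := @measurable_disk R.
have [W _] := W0; have [Lu Lg1 Lg2 _] := W; have [mu _] := Lu.
have a0' := ltW a0.
have [t1 t2] := test_function_D tf.
have L2f1 := L2_continuous (test_function_continuous t1).
have L2f2 := L2_continuous (test_function_continuous t2).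
have iU := integrable_sqr_exp ru W a0'.
have iE := integrable_exp_disk ru W a0'.
have iM := integrable_mul_exp ru W a0'.
have [C hC] := continuous_bounded_disk (test_function_continuous tf).
have mf : measurable_fun (disk R : set (plane R)) f.
  by have [] := L2_continuous (test_function_continuous tf).
have iJ : (@leb2 R).-integrable (disk R) (EFin \o (fun p => u p * expR (alpha * u p ^+ 2) * f p)).
  exact: integrable_mul_bounded mD iM mf hC.
have iG := L2_integrable_sqn Lg1 Lg2.
have iB : (@leb2 R).-integrable (disk R)
    (EFin \o (fun p => (g p).1 * 'D_(ex R) f p + (g p).2 * 'D_(ey R) f p)).
  by apply: integrable_addr => //; exact: L2_integrable_mul.
have iN : (@leb2 R).-integrable (disk R) (EFin \o (fun p => sqn (grad f p))).
  exact: (L2_integrable_sqn (g := grad f) L2f1 L2f2).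
apply: (first_variation_arith (G := \int[@leb2 R]_(p in disk R) sqn (g p))
   (N := \int[@leb2 R]_(p in disk R) sqn (grad f p))).
- apply: Rintegral_disk_gt0 => // p Dp.
  by rewrite mulr_gt0 ?exprn_gt0 ?expR_gt0 ?u0.
- by rewrite -norm_vec_le1.
move=> e s s0 hs.
have sn : s != 0 by rewrite gt_eqF.
pose v p := s^-1 * u p + (e / s) * f p.
have W0v : W012 v (vcomb s^-1 (e / s) g (grad f)) by exact: W012_comb.
have [[[mv _] Lv1 Lv2 _] _] := W0v.
have adm : admissible v.
  exists (vcomb s^-1 (e / s) g (grad f)); split => //.
  rewrite norm_vec_le1//.
  have -> : \int[@leb2 R]_(p in disk R) sqn (vcomb s^-1 (e / s) g (grad f) p) =
     \int[@leb2 R]_(p in disk R) (s ^- 2 * ((sqn (g p) +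
        2 * e * ((g p).1 * 'D_(ex R) f p + (g p).2 * 'D_(ey R) f p)) + e ^+ 2 * sqn (grad f p))).
    apply: eq_Rintegral => p _; rewrite /sqn /vcomb/=; field => //.
  have i2 := integrable_scaler (2 * e) mD iB.
  have i3 := integrable_scaler (e ^+ 2) mD iN.
  have i12 := integrable_addr mD iG i2.
  rewrite RintegralZl//; last exact: integrable_addr.
  rewrite RintegralD// RintegralD// RintegralZl// RintegralZl//.
  by rewrite mulrC ler_pdivrMr ?exprn_gt0// mul1r.
have iEfin : (TM_energy alpha u = (\int[@leb2 R]_(p in disk R) expR (alpha * u p ^+ 2))%:E)%E.
  by rewrite /TM_energy /Rintegral fineK//; exact: (integrable_fin_num mD iE).
have le1 : (TM_energy alpha v <= TM_energy alpha u)%E.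
  by rewrite uTM; apply: ereal_sup_ubound; exists v.
(* Integrability for the competitor comes from optimality: its energy is at most that of $u$, which
   is finite by the growth bound. *)
have iV : (@leb2 R).-integrable (disk R) (EFin \o (fun p => expR (alpha * v p ^+ 2))).
  apply/integrableP; split.
    by apply/measurable_EFinP; exact: measurable_exp_sqr.
  under eq_integral do rewrite /= ger0_norm ?expR_ge0//.
  by apply: le_lt_trans le1 _; rewrite iEfin ltry.
have le2 : \int[@leb2 R]_(p in disk R) expR (alpha * v p ^+ 2) <=
           \int[@leb2 R]_(p in disk R) expR (alpha * u p ^+ 2).
  rewrite -lee_fin -iEfin; apply: le_trans le1.
  by rewrite /TM_energy /Rintegral fineK//; exact: (integrable_fin_num mD iV).
have iX := integrable_scaler (s^-1 - 1) mD iU.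
have iY := integrable_scaler (e / s) mD iJ.
have iZ := integrable_scaler (2 * alpha) mD (integrable_addr mD iX iY).
have le3 : \int[@leb2 R]_(p in disk R) (expR (alpha * u p ^+ 2) +
   2 * alpha * ((s^-1 - 1) * (u p ^+ 2 * expR (alpha * u p ^+ 2)) +
                (e / s) * (u p * expR (alpha * u p ^+ 2) * f p))) <=
   \int[@leb2 R]_(p in disk R) expR (alpha * v p ^+ 2).
  apply: le_Rintegral => //; first exact: integrable_addr.
  move=> p _; apply: le_trans (exp_sqr_convex (u p) (v p) a0').
  rewrite lerD2l le_eqVlt; apply/orP; left; apply/eqP; rewrite /v; field => //.
move: le3; rewrite RintegralD// RintegralZl//; last exact: integrable_addr.
rewrite RintegralD// RintegralZl// RintegralZl//.
set I := (X in (s^-1 - 1) * X); set J := (X in e / s * X).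
move=> le3.
have := le_trans le3 le2; rewrite gerDl pmulr_rle0 ?mulr_gt0//.
rewrite -/I -/J; clearbody I J.
have -> : (s^-1 - 1) * I + e / s * J = ((1 - s) * I + e * J) / s by field.
by rewrite pmulr_lle0// invr_gt0.
Qed.

(** * The equation of the profile *)

Definition prim (R : realType) (k : R -> R) (t : R) : R :=
  \int[leb R]_(s in `[0, t]) k s.

(** Rewriting a primitive as the total integral minus a tail transfers to it the measurability and
    integrability that Fubini gives for tails. *)
Lemma prim_tail (R : realType) (k : R -> R) (t : R) : 0 <= t < 1 ->
  (leb R).-integrable (I01 R) (EFin \o k) ->
  prim k t = \int[leb R]_(s in I01 R) k s -
    \int[leb R]_(s in I01 R `&` [set s | t < s]) k s.
Proof.
move=> /andP[t0 t1] ik; apply/eqP; rewrite eq_sym subr_eq; apply/eqP.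
have -> : I01 R `&` [set s | t < s] = `]t, 1[%classic.
  apply/seteqP; split => s /=; rewrite !in_itv/=; first by move=> [/andP[_ ->] ->].
  by move=> /andP[ts ->]; rewrite ts (le_trans t0 (ltW ts)).
have E : I01 R = `[0, t] `|` `]t, 1[.
  apply/seteqP; split => s /=; rewrite !in_itv/=.
    move=> /andP[s0 ->]; have [ts|st] := ltP t s; first by right.
    by left; rewrite s0.
  move=> [/andP[-> st]|/andP[ts ->]]; first by rewrite (le_lt_trans st t1).
  by rewrite (le_trans t0 (ltW ts)).
rewrite [in LHS]E Rintegral_setU -?E//.
apply/disj_setPRL => s /=; rewrite !in_itv/= => /andP[ts _].
by move=> /andP[_]; rewrite leNgt ts.
Qed.

Lemma integrable_prim (R : realType) (k : R -> R) :
  (leb R).-integrable (I01 R) (EFin \o k) ->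
  (leb R).-integrable (I01 R) (EFin \o prim k).
Proof.
move=> ik; have mI : measurable (I01 R : set (measurableTypeR R)) by [].
have q01 (p : R) : I01 R p -> 0 <= id p < 1 by rewrite /= in_itv.
have it := @integrable_tail _ (measurableTypeR R) R (leb R) (I01 R) id k mI (@measurable_id _ _ _) q01 ik.
have ic : (leb R).-integrable (I01 R)
  (EFin \o fun=> \int[leb R]_(s in I01 R) k s).
  apply/integrableP; split; first exact/measurable_EFinP.
  by rewrite integral_cst//= lebesgue_measure_itv/= lte_fin ltr01 -EFinB subr0 mule1 ltry.
have := integrable_subr mI ic it; apply: eq_integrable => // t.
by rewrite inE/= in_itv/= => t01; rewrite prim_tail.
Qed.

Lemma integrable_sub01 (R : realType) (k : R -> R) (A : set (measurableTypeR R)) : measurable A ->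
  A `<=` I01 R -> (leb R).-integrable (I01 R) (EFin \o k) ->
  (leb R).-integrable A (EFin \o k).
Proof. by move=> mA sA; apply: integrableS. Qed.

Lemma itv0t_sub (R : realType) (t : R) : t < 1 -> `[0, t] `<=` I01 R.
Proof. by move=> t1 s /=; rewrite !in_itv/= => /andP[-> st]; rewrite (le_lt_trans st t1). Qed.

Lemma is_derive_prim (R : realType) (k : R -> R) (t : R) : 0 < t < 1 ->
  (leb R).-integrable (I01 R) (EFin \o k) -> {for t, continuous k} ->
  is_derive t 1 (prim k) (k t).
Proof.
move=> /andP[t0 t1] ik ck.
have i2 : (leb R).-integrable `[0, (t + 1) / 2] (EFin \o k).
  apply: integrable_sub01 ik => //; apply: itv0t_sub; lra.
have tt : t < (t + 1) / 2 by lra.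
have [d dE] := continuous_FTC1_closed tt i2 t0 ck.
by apply: DeriveDef; [exact: d|rewrite -dE derive1E].
Qed.

Lemma continuous_prim (R : realType) (k : R -> R) (t : R) : 0 < t < 1 ->
  (leb R).-integrable (I01 R) (EFin \o k) -> {for t, continuous (prim k)}.
Proof.
move=> /andP[t0 t1] ik.
have i2 : (leb R).-integrable `[0, (t + 1) / 2] (EFin \o k).
  apply: integrable_sub01 ik => //; apply: itv0t_sub; lra.
have h0 : 0 < (t + 1) / 2 by lra.
have := parameterized_integral_continuous (ltW h0) i2.
move=> /(continuous_within_itvP _ h0)[h _ _]; apply: h.
rewrite in_itv/= t0/=; lra.
Qed.

(** As [k] is merely integrable, this is the layer-cake formula with [q] the identity. That formula
    asks for a function vanishing at 0, hence its use for $f-f(0)$; the condition $f(1)=0$ makes the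
    remaining constants cancel. *)
Lemma prim_by_parts (R : realType) (k f : R -> R) (C : R) : smooth1 f ->
  (forall t, `|derive1 f t| <= C) -> f 1 = 0 ->
  (leb R).-integrable (I01 R) (EFin \o k) ->
  \int[leb R]_(t in I01 R) (k t * f t) =
  - \int[leb R]_(t in I01 R) (prim k t * derive1 f t).
Proof.
move=> sf fC f1 ik; have mI : measurable (I01 R : set (measurableTypeR R)) by [].
have cf' : continuous (derive1 f) := smooth1_derive1 sf 0%N.
have cf : continuous f := sf 0%N.
have q01 (p : R) : I01 R p -> 0 <= id p < 1 by rewrite /= in_itv.
have df (t : R) : is_derive t 1 (fun t => f t - f 0) (derive1 f t).
  by rewrite -[derive1 f t]subr0; exact: is_derive1_sub (smooth1_is_derive t sf) (is_derive_cst (f 0) t 1).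
have it := @integrable_tail _ (measurableTypeR R) R (leb R) (I01 R) id k mI (@measurable_id _ _ _) q01 ik.
have cake := @Rintegral_layer_cake _ (measurableTypeR R) R (leb R) (I01 R) id k
  (fun t => f t - f 0) (derive1 f) C mI (@measurable_id _ _ _) q01 ik df cf' fC (subrr _).
set T := \int[leb R]_(s in I01 R) k s.
have mf : measurable_fun (I01 R) f by apply: measurable_funTS; exact: continuous_measurable_fun.
have mf' : measurable_fun (I01 R) (derive1 f) by apply: measurable_funTS; exact: continuous_measurable_fun.
have [B B0 hB] := bounded_continuous_itv 0 1 cf.
have ikf : (leb R).-integrable (I01 R) (EFin \o (fun t => k t * f t)).
  by apply: (integrable_mul_bounded mI ik mf (C := B)) => t /=; rewrite in_itv/= => /andP[h /ltW]; exact: hB.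
have itf : (leb R).-integrable (I01 R) (EFin \o (fun t =>
    (\int[leb R]_(p in I01 R `&` [set p | t < id p]) k p) * derive1 f t)).
  by apply: (integrable_mul_bounded mI it mf' (C := C)).
have if' : (leb R).-integrable (I01 R) (EFin \o (derive1 f)).
  apply: (integrableS (E := `[0, 1] : set (measurableTypeR R))) => //.
    by move=> t /=; rewrite !in_itv/= => /andP[-> /ltW].
  by apply: integrable_continuous_itv => t _ _; exact: cf'.
have e1 : \int[leb R]_(t in I01 R) derive1 f t = - f 0.
  rewrite Rintegral_itv_bndo_bndc//.
  by rewrite (Rintegral_FTC2 ltr01 (fun t _ _ => smooth1_is_derive t sf)) ?f1 ?sub0r// => t _ _; exact: cf'.
have -> : \int[leb R]_(t in I01 R) (prim k t * derive1 f t) =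
   T * (- f 0) - \int[leb R]_(t in I01 R)
    ((\int[leb R]_(p in I01 R `&` [set p | t < id p]) k p) * derive1 f t).
  rewrite -e1 -RintegralZl// -RintegralB//; last exact: integrable_scaler.
  apply: eq_Rintegral => t; rewrite inE/= in_itv/= => t01; rewrite prim_tail//.
  by rewrite mulrBl.
have -> : \int[leb R]_(t in I01 R) (k t * f t) =
  \int[leb R]_(t in I01 R) (k t * (f t - f 0)) + f 0 * T.
  rewrite -RintegralZl// -RintegralD//; last 2 first.
  - have := integrable_subr mI ikf (integrable_scaler (f 0) mI ik).
    by apply: eq_integrable => // t _ /=; rewrite mulrBr (mulrC _ (f 0)).
  - exact: integrable_scaler.
  by apply: eq_Rintegral => t _; rewrite mulrBr (mulrC (f 0)) subrK.
rewrite cake.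
under eq_Rintegral do rewrite mulrC.
ring.
Qed.

Lemma smooth_antiderivative_right (R : realType) (g : R -> R) (a b : R) : a < b ->
  smooth1 g -> (forall t, t <= a \/ b <= t -> g t = 0) ->
  exists2 G : R -> R, smooth1 G & derive1 G = g /\ (forall t, b <= t -> G t = 0).
Proof.
move=> ab sg g0; have cg : continuous g := sg 0%N.
have [G dG _] := @smooth_antiderivative R g a cg (fun t h => g0 t (or_introl h)).
have dG1 (t : R) : is_derive t 1 (fun t => G t - G b) (g t).
  by rewrite -[g t]subr0; exact: is_derive1_sub (dG t) (is_derive_cst (G b) t 1).
have G' : derive1 (fun t => G t - G b) = g by apply/funext => t; exact: derive1_val.
exists (fun t => G t - G b).
  move=> n; apply: Cn1_le; apply/Cn1SP; split; first by move=> x; have [] := dG1 x.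
  by rewrite G'.
split => // t; rewrite le_eqVlt => /predU1P[<-|bt]; first by rewrite subrr.
rewrite -(@Rintegral_FTC2 R G g b t bt (fun t _ _ => dG t) (fun t _ _ => cg t)).
rewrite (_ : \int[_]_(s in _) _ = \int[leb R]_(s in `[b, t]) 0).
  by rewrite Rintegral_cst// mul0r.
by apply: eq_Rintegral => s; rewrite inE/= in_itv/= => /andP[bs _]; apply: g0; right.
Qed.

(* The test function is Phi(|p|^2) with Phi' = z / t. *)
Lemma profile_weak_ode (R : realType) (alpha I : R) (u : R * R -> R) (g : R * R -> R * R) (z : R -> R) (a b : R) :
  0 <= alpha -> radial u -> W12 u g ->
  (forall f, test_function f ->
    I * (\int[@leb2 R]_(p in disk R) ((g p).1 * 'D_(ex R) f p + (g p).2 * 'D_(ey R) f p)) =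
    \int[@leb2 R]_(p in disk R) (u p * expR (alpha * u p ^+ 2) * f p)) ->
  0 < a -> a < b -> b < 1 -> smooth1 z -> (forall t, t <= a \/ b <= t -> z t = 0) ->
  I * (4 * \int[leb R]_(t in I01 R) (radial_profile u t * derive1 z t)) =
  \int[leb R]_(t in I01 R)
    (prim (fun t => radial_profile u t * expR (alpha * radial_profile u t ^+ 2)) t / t * z t).
Proof.
move=> al ru W EL a0 ab b1 sz z0; have mD := @measurable_disk R.
have [Lu Lg1 Lg2 _] := W; have [mu _] := Lu.
have z0a t : t < a -> z t = 0 by move=> /ltW h; apply: z0; left.
pose h t := z t / t ^+ 1.
have sh : smooth1 h by exact: smooth1_div_pow a0 sz z0a.
have h0 t : t <= a \/ b <= t -> h t = 0 by move=> /z0 zt; rewrite /h zt mul0r.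
have zE : z = (fun t => t * h t).
  apply/funext => t; rewrite /h expr1; have [t0|t0] := eqVneq t 0; last by rewrite mulrC divfK.
  by rewrite t0 mul0r z0//; left; exact: ltW.
have h0b t : b < t -> h t = 0 by move=> /ltW bt; apply: h0; right.
have ch : continuous h := sh 0%N.
have z' t : derive1 z t = h t + t * derive1 h t.
  rewrite zE; apply: derive1_val; rewrite -[h t]mul1r.
  exact: is_derive1_mul (is_derive_id t 1) (smooth1_is_derive t sh).
(* The primitive is normalised at the outer end. Near the centre it is a constant, in general
   nonzero, and this is what makes the integrated source start at 0. *)
have [Phi sP [P' P0]] := smooth_antiderivative_right ab sh h0.
have tP : test_function (Phi \o @sqn R).
  by apply: (test_function_radial b1 sP) => t /ltW; exact: P0.
have := EL _ tP.
have DP v p : 'D_v (Phi \o @sqn R) p = h (sqn p) * (2 * (p.1 * v.1 + p.2 * v.2)).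
  rewrite derive_comp1; last exact: differentiable_sqn.
    by rewrite P' derive_sqn.
  by case: (smooth1_is_derive (sqn p) sP).
have i3 := L2_integrable_mul Lg1 (L2_fst_radial ch).
have i4 := L2_integrable_mul Lg2 (L2_snd_radial ch).
rewrite (_ : (fun p => _ + _) = (fun p => 2 * (((g p).1 * p.1 + (g p).2 * p.2) * h (sqn p)))); last first.
  by apply/funext => p; rewrite !DP /=; ring.
rewrite RintegralZl//; last first.
  have := integrable_addr mD i3 i4; apply: eq_integrable => // p _ /=; congr EFin; ring.
rewrite -[Rintegral _ _ _ in LHS]opprK -(weak_grad_radial W b1 sh h0b).
set F := fun t => radial_profile u t * expR (alpha * radial_profile u t ^+ 2).
have -> : \int[@leb2 R]_(p in disk R) (u p * (2 * (h (sqn p) + sqn p * derive1 h (sqn p)))) =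
   \int[@leb2 R]_(p in disk R) (2 * (radial_profile u (sqn p) * derive1 z (sqn p))).
  by apply: eq_Rintegral => p; rewrite inE => Dp; rewrite (radialE ru Dp) z'; ring.
have -> : \int[@leb2 R]_(p in disk R) (u p * expR (alpha * u p ^+ 2) * (Phi \o @sqn R) p) =
   \int[@leb2 R]_(p in disk R) ((F \* Phi) (sqn p)).
  by apply: eq_Rintegral => p; rewrite inE => Dp; rewrite (radialE ru Dp).
have mP := measurable_radial_profile mu.
have mF : measurable_fun (I01 R) F.
  apply: measurable_funM => //; apply: measurableT_comp => //; apply: measurable_funM => //.
  exact: measurable_funX.
have mz' : measurable_fun (I01 R) (derive1 z).
  by apply: measurable_funTS; apply: continuous_measurable_fun; exact: smooth1_derive1 sz 0%N.
have mPhi : measurable_fun (I01 R) Phi.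
  by apply: measurable_funTS; apply: continuous_measurable_fun; exact: sP 0%N.
have mI : measurable (I01 R : set (measurableTypeR R)) by [].
have iF : (leb R).-integrable (I01 R) (EFin \o F).
  apply/integrable_disk_radial => //.
  have := integrable_mul_exp ru W al; apply: eq_integrable => // p; rewrite inE => Dp /=.
  by rewrite (radialE ru Dp).
have [C C0 hC] := bounded_continuous_itv a b ch.
have PC t : `|derive1 Phi t| <= C.
  rewrite P'; have [ta|ta] := leP t a; first by rewrite h0 ?normr0//; left.
  have [bt|bt] := leP b t; first by rewrite h0 ?normr0//; right.
  exact: hC (ltW ta) (ltW bt).
have [B B0 hB] := bounded_continuous_itv 0 1 (sP 0%N).
have [B' B'0 hB'] := bounded_continuous_itv 0 1 (smooth1_derive1 sz 0%N).
have iFP : (leb R).-integrable (I01 R) (EFin \o (F \* Phi)).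
  by apply: (integrable_mul_bounded mI iF mPhi (C := B)) => t /=; rewrite in_itv/= => /andP[h1 /ltW]; exact: hB.
have iPz : (leb R).-integrable (I01 R) (EFin \o (fun t => radial_profile u t * derive1 z t)).
  apply: (integrable_mul_bounded mI (integrable_radial_profile ru Lu) mz' (C := B')) => t /=.
  by rewrite in_itv/= => /andP[h1 /ltW]; exact: hB'.
rewrite (Rintegral_disk_radial iFP).
rewrite (@Rintegral_disk_radial _ (fun t => 2 * (radial_profile u t * derive1 z t))); last exact: integrable_scaler.
rewrite RintegralZl//.
have -> := prim_by_parts sP PC (P0 1 (ltW b1)) iF.
rewrite P'; set J1 := Rintegral _ _ _; set J2 := Rintegral _ _ _ => e.
have -> : \int[leb R]_(t in I01 R) (prim F t / t * z t) = J2.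
  apply: eq_Rintegral => t; rewrite inE/= in_itv/= => /andP[t0 _].
  by rewrite /h expr1 mulrAC mulrA.
have cn : - disk_area R != 0 by rewrite oppr_eq0 gt_eqF// disk_area_gt0.
clearbody J1 J2; apply: (mulfI cn); rewrite [RHS]mulNr -mulrN -e; ring.
Qed.

Lemma ae_bound_integrable_abs (R : realType) (f : R -> R) (C : R) : 0 < C ->
  measurable_fun (I01 R) f ->
  {ae leb R, forall t, 0 < t < 1 -> `|f t| <= C / Num.sqrt t} ->
  (leb R).-integrable (I01 R) (EFin \o f).
Proof.
move=> C0 mf fC; have mI : measurable (I01 R : set (measurableTypeR R)) by [].
have i : (leb R).-integrable (I01 R) (EFin \o (fun t => `|f t|)).
  by apply: (ae_bound_integrable C0) => //; exact: measurableT_comp.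
exact: (integrable_dominated mI mf i).
Qed.

(** For the source term this gives $K(t)=O(\sqrt t)$, so $K(t)/t$ is again $O(1/\sqrt t)$ and
    integrable at 0: the profile is then bounded. *)
Lemma prim_le_sqrt (R : realType) (f : R -> R) (C t : R) : 0 < C -> 0 < t < 1 ->
  (leb R).-integrable (I01 R) (EFin \o f) ->
  (forall s, 0 <= s < 1 -> 0 <= f s) ->
  {ae leb R, forall s, 0 < s < 1 -> f s <= C / Num.sqrt s} ->
  prim f t <= C * (2 * Num.sqrt t).
Proof.
move=> C0 /andP[t0 t1] fi f0 fC.
have sub : `]0, t[ `<=` I01 R.
  by move=> s /=; rewrite !in_itv/= => /andP[/ltW -> /lt_trans]; apply.
have fit : (leb R).-integrable `[0, t] (EFin \o f).
  by apply: integrable_sub01 fi => //; exact: itv0t_sub.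
have mf' : measurable_fun `]0, t[ (fun s => (f s)%:E).
  by apply/measurable_EFinP; apply: measurable_funS (measurable_integrable fi).
rewrite -lee_fin /prim /Rintegral fineK; last exact: integrable_fin_num fit.
rewrite integral_itv_bndoo//.
have mS : measurable_fun `]0, t[ (fun x : R => (Num.sqrt x)^-1).
  apply: measurable_funS (@measurable_inv_sqrt R) => //.
  by move=> s /=; rewrite !in_itv/= => /andP[-> /lt_trans]; apply.
apply: (@le_trans _ _ (\int[leb R]_(t in `]0%R, t[) (C * (Num.sqrt t)^-1)%:E)%E).
  apply: ae_ge0_le_integral => //.
  - by move=> s /=; rewrite in_itv/= lee_fin => /andP[s0 st]; rewrite f0// (ltW s0) (lt_trans st).
  - by move=> s _; rewrite lee_fin mulr_ge0 ?invr_ge0 ?sqrtr_ge0// ltW.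
  - by apply/measurable_EFinP; apply: measurable_funM.
  - move: fC; apply: ae_imply => s h; rewrite /= in_itv/= lee_fin => /andP[s0 st].
    by apply: h; rewrite s0 (lt_trans st).
under eq_integral do rewrite EFinM.
rewrite ge0_integralZl//; last 2 first.
- exact/measurable_EFinP.
- by rewrite lee_fin ltW.
by rewrite EFinM lee_pmul2l// integral_inv_sqrt_le.
Qed.

Lemma ae_neq (R : realType) (a : R) : {ae leb R, forall t, t != a}.
Proof.
exists [set a]; split => //; first exact: lebesgue_measure_set1.
by move=> t /= /negP/negPn/eqP.
Qed.

Lemma ae_and (R : realType) (P Q S : R -> Prop) : (forall t, P t -> Q t -> S t) ->
  {ae leb R, forall t, P t} -> {ae leb R, forall t, Q t} ->
  {ae leb R, forall t, S t}.
Proof. by move=> PQ; apply: filterS2; first exact: (ae_filter_ringOfSetsType (leb R)). Qed.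

Lemma ae_itv_exists (R : realType) (P : R -> Prop) (a b : R) : a < b ->
  {ae leb R, forall t, P t} -> exists2 t, a < t < b & P t.
Proof.
move=> ab [N [mN N0 sN]]; apply: contrapT => nP.
have sub : `]a, b[ `<=` N.
  by move=> t /=; rewrite in_itv/= => tab; apply: sN => Pt; apply: nP; exists t.
have : (leb R `]a, b[%classic <= leb R N)%E.
  by apply: le_measure => //; rewrite inE.
by rewrite N0 lebesgue_measure_itv/= lte_fin ab -EFinB lee_fin leNgt subr_gt0 ab.
Qed.

Lemma eq_prim (R : realType) (f g : R -> R) (t : R) : t < 1 ->
  measurable_fun (I01 R) f -> measurable_fun (I01 R) g ->
  {ae leb R, forall s, 0 < s < 1 -> f s = g s} -> prim f t = prim g t.
Proof.
move=> t1 mf mg fg; rewrite /prim /Rintegral; congr fine.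
apply: ae_eq_integral => //.
- by apply/measurable_EFinP; apply: measurable_funS mf => //; exact: itv0t_sub.
- by apply/measurable_EFinP; apply: measurable_funS mg => //; exact: itv0t_sub.
apply: (ae_and _ fg (ae_neq 0)) => s h s0 /=; rewrite in_itv/= => /andP[s0' st].
by rewrite h// lt_neqAle eq_sym s0 s0' (le_lt_trans st t1).
Qed.

Lemma prim_ge0 (R : realType) (f : R -> R) (t : R) : t < 1 ->
  (forall s, 0 <= s < 1 -> 0 <= f s) -> 0 <= prim f t.
Proof.
move=> t1 f0; apply: Rintegral_ge0 => s /=; rewrite in_itv/= => /andP[s0 st].
by rewrite f0// s0 (le_lt_trans st).
Qed.

Lemma prim_mono (R : realType) (f : R -> R) (s t : R) : 0 <= s -> s <= t -> t < 1 ->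
  (leb R).-integrable (I01 R) (EFin \o f) ->
  (forall s, 0 <= s < 1 -> 0 <= f s) -> prim f s <= prim f t.
Proof.
move=> s0 st t1 fi f0; rewrite -subr_ge0 /prim Rintegral_itvB//.
- apply: Rintegral_ge0 => x /=; rewrite in_itv/= => /andP[sx xt].
  by rewrite f0// (le_trans s0 (ltW sx)) (le_lt_trans xt).
- by apply: integrable_sub01 fi => //; exact: itv0t_sub.
Qed.

(** In the variable $t$ the equation reads $-4I(tV')'=Ve^{\alpha V^2}$; integrated from the centre,
    where there is no flux, $-4ItV'=K$. By du Bois-Reymond, $4IP+\int_0^tK(s)/s\,ds$ is a.e.
    constant. Solving for $P$ yields a representative $V$ that is continuous, nonincreasing and
    bounded, whence the classical derivatives. *)
Lemma profile_ode (R : realType) (alpha I : R) (u : R * R -> R) (g : R * R -> R * R) :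
  0 <= alpha -> 0 < I -> radial u -> (forall p, disk R p -> 0 < u p) -> W12 u g ->
  (forall f, test_function f ->
    I * (\int[@leb2 R]_(p in disk R) ((g p).1 * 'D_(ex R) f p + (g p).2 * 'D_(ey R) f p)) =
    \int[@leb2 R]_(p in disk R) (u p * expR (alpha * u p ^+ 2) * f p)) ->
  exists (V K : R -> R) (B : R),
    [/\ {ae leb R, forall t, 0 < t < 1 -> radial_profile u t = V t},
    forall s t, 0 < s -> s <= t -> t < 1 -> V t <= V s &
    forall t : R, 0 < t < 1 ->
      [/\ is_derive t 1 V (- (K t / t) / (4 * I)),
          is_derive t 1 K (V t * expR (alpha * V t ^+ 2)),
          0 < V t <= B &
          t * (V t * expR (alpha * V t ^+ 2)) <= K t <= t * (B * expR (alpha * B ^+ 2))]].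
Proof.
move=> al I0 ru u0 W EL; have mI : measurable (I01 R : set (measurableTypeR R)) by [].
have [Lu _ _ _] := W; have [mu _] := Lu.
pose P := radial_profile u.
pose F t := P t * expR (alpha * P t ^+ 2).
have P0 t : 0 <= t < 1 -> 0 < P t.
  by move=> /andP[t0 t1]; apply: u0; apply: disk_axis.
have F0 t : 0 <= t < 1 -> 0 <= F t by move=> t01; rewrite mulr_ge0 ?expR_ge0 ?ltW ?P0.
have mP : measurable_fun (I01 R) P := measurable_radial_profile mu.
have mexp (f : R -> R) : measurable_fun (I01 R) f ->
    measurable_fun (I01 R) (fun t => f t * expR (alpha * f t ^+ 2)).
  move=> mf; apply: measurable_funM => //; apply: measurableT_comp => //; apply: measurable_funM => //.
  exact: measurable_funX.
have mF : measurable_fun (I01 R) F by exact: mexp.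
have al1 : 0 <= alpha + 1 by rewrite addr_ge0.
have [C C0 hC] := profile_exp_bound ru W al1.
have FC : {ae leb R, forall t, 0 < t < 1 -> F t <= C / Num.sqrt t}.
  move: hC; apply: ae_imply => t h t01; apply: (le_trans _ (h t01)).
  by apply: (le_trans _ (abs_exp_le _ _)); rewrite ler_wpM2r ?expR_ge0// ler_norm.
have iF : (leb R).-integrable (I01 R) (EFin \o F).
  apply: (ae_bound_integrable_abs C0 mF); move: FC; apply: ae_imply => t h t01.
  by rewrite ger0_norm ?h// F0//; move: t01 => /andP[/ltW -> ->].
pose k t := prim F t / t.
have k0 t : 0 <= t < 1 -> 0 <= k t.
  by move=> /andP[t0 t1]; rewrite divr_ge0// prim_ge0.
have ck t : 0 < t < 1 -> {for t, continuous k}.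
  move=> t01; apply: cvgM; first exact: continuous_prim.
  by apply: cvgV; [rewrite gt_eqF//; case/andP: t01|exact: cvg_id].
have mk : measurable_fun (I01 R) k.
  apply/measurable_fun_itv_obnd_cbndP.
  apply: open_continuous_measurable_fun; first exact: interval_open.
  by move=> t; rewrite inE/= in_itv/=; exact: ck.
have C20 : 0 < C * 2 by rewrite mulr_gt0.
have ik : (leb R).-integrable (I01 R) (EFin \o k).
  apply: (ae_bound_integrable_abs C20 mk).
  apply: (@aeW _ (measurableTypeR R)) => t t01; move: (t01) => /andP[t0 t1].
  rewrite ger0_norm ?k0 ?(ltW t0)// /k.
  have s0 : 0 < Num.sqrt t by rewrite sqrtr_gt0.
  rewrite ler_pdivrMr// -[X in _ / _ * X](sqr_sqrtr (ltW t0)) expr2 mulrA divfK ?gt_eqF//.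
  by rewrite -mulrA; exact: prim_le_sqrt.
(* The weak equation together with an integration by parts of [k] says that $4IP+\int_0^tk$ has zero
   weak derivative. *)
have [c hc] : exists c, {ae leb R, forall t, 0 < t < 1 -> 4 * I * P t + prim k t = c}.
  apply: du_bois_reymond.
    move=> a b a0 ab b1; apply: integrable_addr => //.
      apply: integrable_scaler => //.
      by apply: integrable_sub01 (integrable_radial_profile ru Lu) => //; exact: itvcc_sub_co.
    by apply: integrable_sub01 (integrable_prim ik) => //; exact: itvcc_sub_co.
  move=> z a b a0 ab b1 sz z0.
  have z'0 t : t < a \/ b < t -> derive1 z t = 0.
    by move=> [ta|bt]; [apply: (derive1_vanish_left _ ta) => s /ltW sa|
      apply: (derive1_vanish_right _ bt) => s /ltW bs]; apply: z0; [left|right].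
  rewrite -(Rintegral_support1 (itvcc_sub_co a0 b1)); last first.
    move=> t _ /=; rewrite in_itv/= => /negP; rewrite negb_and -!ltNge => /orP h.
    by rewrite z'0 ?mulr0.
  have [B' B'0 hB'] := bounded_continuous_itv a b (smooth1_derive1 sz 0%N).
  have z'B t : `|derive1 z t| <= B'.
    have [ta|ta] := ltP t a; first by rewrite z'0 ?normr0//; left.
    have [bt|bt] := ltP b t; first by rewrite z'0 ?normr0//; right.
    exact: hB'.
  have mz' : measurable_fun (I01 R) (derive1 z).
    by apply: measurable_funTS; apply: continuous_measurable_fun; exact: smooth1_derive1 sz 0%N.
  have iPz : (leb R).-integrable (I01 R) (EFin \o (fun t => P t * derive1 z t)).
    by apply: (integrable_mul_bounded mI (integrable_radial_profile ru Lu) mz' (C := B')).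
  have ikz : (leb R).-integrable (I01 R) (EFin \o (fun t => prim k t * derive1 z t)).
    by apply: (integrable_mul_bounded mI (integrable_prim ik) mz' (C := B')).
  have := profile_weak_ode al ru W EL a0 ab b1 sz z0.
  rewrite -/P -/F -/k => e.
  have z1 : z 1 = 0 by apply: z0; right; exact: ltW.
  have := prim_by_parts sz z'B z1 ik; rewrite -e => e2.
  transitivity (\int[leb R]_(t in I01 R) (4 * I * (P t * derive1 z t) + prim k t * derive1 z t)).
    by apply: eq_Rintegral => t _; ring.
  rewrite RintegralD//; last exact: integrable_scaler.
  rewrite RintegralZl// (mulrC 4) -mulrA e2 addNr//.
have I40 : 0 < 4 * I by rewrite mulr_gt0.
pose V t := (c - prim k t) / (4 * I).
have PV : {ae leb R, forall t, 0 < t < 1 -> P t = V t}.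
  move: hc; apply: ae_imply => t h t01; rewrite /V -(h t01) addrK mulrC mulKf// gt_eqF//.
(* The source is rebuilt from [V]: its integrals are those of [F], by a.e. equality, but it is
   continuous on $]0,1[$, so its primitive has a classical derivative. *)
pose F' t := V t * expR (alpha * V t ^+ 2).
have mV : measurable_fun (I01 R) V.
  apply: measurable_funM => //; apply: measurable_funB => //.
  exact: measurable_integrable (integrable_prim ik).
have mF' : measurable_fun (I01 R) F' by exact: mexp.
have FF' : {ae leb R, forall t, 0 < t < 1 -> F t = F' t}.
  by move: PV; apply: ae_imply => t h t01; rewrite /F h.
have KE t : t < 1 -> prim F t = prim F' t by move=> t1; exact: eq_prim.
have iF' : (leb R).-integrable (I01 R) (EFin \o F').
  apply: (ae_bound_integrable_abs C0 mF'); apply: (ae_and _ FC FF') => t h1 h2 t01.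
  by rewrite -h2// ger0_norm ?h1// F0//; move: t01 => /andP[/ltW -> ->].
have Vmono s t : 0 <= s -> s <= t -> t < 1 -> V t <= V s.
  move=> s0 st t1; rewrite /V ler_pM2r ?invr_gt0// lerB//.
  exact: prim_mono.
have V0 t : 0 <= t -> t < 1 -> 0 < V t.
  (* The profile is positive, but [V] agrees with it only almost everywhere: positivity is read at a
     later point of agreement and carried back by monotonicity. *)
  move=> t0 t1; have [s /andP[ts s1] h] := ae_itv_exists t1 PV.
  have s0 := le_lt_trans t0 ts.
  have s01 : 0 < s < 1 by rewrite s0 s1.
  apply: (lt_le_trans _ (Vmono t s t0 (ltW ts) s1)).
  by rewrite -(h s01) P0// (ltW s0) s1.
have dV (t : R) : 0 < t < 1 -> is_derive t 1 V (- (prim F' t / t) / (4 * I)).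
  move=> t01; have [t0 t1] := andP t01; rewrite -KE// -/(k t) -[- k t]sub0r.
  rewrite [X in is_derive _ _ _ X]mulrC; rewrite /V.
  rewrite (_ : (fun _ => _) = (fun t => (4 * I)^-1 * (c - prim k t))); last first.
    by apply/funext => s; rewrite mulrC.
  apply: is_derive1_scale.
  by have := is_derive1_sub (is_derive_cst c t 1) (is_derive_prim t01 ik (ck t t01)).
(* The bound is the value of [V] at 0, where the primitive of [k] vanishes. *)
exists V, (prim F'), (c / (4 * I)); split => // [s t s0|t t01]; first exact: Vmono (ltW s0).
have [t0 t1] := andP t01.
have VB s : 0 <= s -> s < 1 -> V s <= c / (4 * I).
  by move=> s0 s1; rewrite /V ler_pM2r ?invr_gt0// gerBl prim_ge0.
split.
- exact: dV.
- apply: is_derive_prim => //.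
  have cV := is_derive1_cts (dV t t01).
  apply: cvgM => //; apply: continuous_comp; last exact: continuous_expR.
  by apply: cvgM; [exact: cvg_cst|apply: cvgM].
- by rewrite V0 ?(ltW t0)//= VB// ltW.
- have i2 : (leb R).-integrable `[0, t] (EFin \o F').
    by apply: integrable_sub01 iF' => //; exact: itv0t_sub.
  have ic (x : R) : (leb R).-integrable `[0, t] (EFin \o (fun=> x)).
    by apply: integrable_continuous_itv => s _ _; exact: cvg_cst.
  have cE (x : R) : \int[leb R]_(s in `[0, t]) (fun=> x) s = t * x.
    by rewrite Rintegral_cst//= lebesgue_measure_itv/= lte_fin t0 -EFinB subr0//= mulrC.
  (* On $[0,t]$ the function [V] lies between [V t] and the bound, and $x\mapsto xe^{\alpha x^2}$ is
     increasing on $x\ge0$; integrating the two constant bounds encloses $K(t)$. *)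
  have Fmono s s' : 0 <= s' -> s' <= s -> 0 <= s -> s * expR (alpha * s ^+ 2) >= s' * expR (alpha * s' ^+ 2).
    move=> s'0 ss' s0; apply: ler_pM; rewrite ?expR_ge0//.
    by rewrite ler_expR ler_wpM2l// lerXn2r.
  rewrite -[t * (V t * _)]cE -[t * (c / _ * _)]cE /prim; apply/andP; split.
    apply: (le_Rintegral _ (ic _) i2); first by []. move=> s; rewrite /= in_itv/= => /andP[s0 st].
    have s1 := le_lt_trans st t1.
    by apply: Fmono; rewrite ?Vmono// ltW// V0// ltW.
  apply: (le_Rintegral _ i2 (ic _)); first by []. move=> s; rewrite /= in_itv/= => /andP[s0 st].
  have s1 := le_lt_trans st t1; have Vs0 := V0 s s0 s1.
  by apply: Fmono; rewrite ?VB ?(ltW Vs0)// (le_trans (ltW Vs0))// VB.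
Qed.

(** * The strict supersolution and Picone's comparison *)

Lemma is_derive1_sqr (R : realType) (x : R) : is_derive x 1 (fun x : R => x ^+ 2) (2 * x).
Proof.
rewrite (_ : (fun x : R => x ^+ 2) = (fun x => x * x)); last by apply/funext => y; rewrite expr2.
by have := is_derive1_mul (is_derive_id x 1) (is_derive_id x 1); congr (is_derive _ _ _ _); ring.
Qed.

Lemma is_derive1_exp_sqr (R : realType) (a x : R) :
  is_derive x 1 (fun x => x * expR (a * x ^+ 2)) ((1 + 2 * a * x ^+ 2) * expR (a * x ^+ 2)).
Proof.
have dE := is_derive1_compose (is_derive1_scale a (is_derive1_sqr x)) (is_derive_expR (a * x ^+ 2)).
have := is_derive1_mul (is_derive_id x 1) dE.
by congr (is_derive _ _ _ _); ring.
Qed.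

(* Q = r z' / z for z(r) = w(r) (3 - r^2 - r^3), w(r) = K(r^2) / (2 I r) = - (V(r^2))'. *)
Lemma riccati_supersolution (R : realType) (alpha I B : R) (V K : R -> R) : 0 <= alpha -> 0 < I ->
  (forall s t, 0 < s -> s <= t -> t < 1 -> V t <= V s) ->
  (forall t : R, 0 < t < 1 ->
      [/\ is_derive t 1 V (- (K t / t) / (4 * I)),
          is_derive t 1 K (V t * expR (alpha * V t ^+ 2)),
          0 < V t <= B &
          t * (V t * expR (alpha * V t ^+ 2)) <= K t <= t * (B * expR (alpha * B ^+ 2))]) ->
  exists (Q : R -> R) (kappa C : R), I^-1 < kappa /\ forall r : R, 0 < r < 1 -> `|Q r| <= C /\
    exists2 D, is_derive r 1 Q D &
      D <= r^-1 - kappa * (r * ((1 + 2 * alpha * V (r ^+ 2) ^+ 2) * expR (alpha * V (r ^+ 2) ^+ 2))) - Q r ^+ 2 / r.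
Proof.
move=> al I0 Vm h.
pose F x := x * expR (alpha * x ^+ 2).
pose W x := (1 + 2 * alpha * x ^+ 2) * expR (alpha * x ^+ 2).
pose f (r : R) := F (V (r ^+ 2)).
pose X (r : R) := 2 * (r ^+ 2 * f r) * (K (r ^+ 2))^-1.
pose p (r : R) : R := 3 - r ^+ 2 - r ^+ 2 * r.
pose q1 (r : R) := - (2 * r ^+ 2 + 3 * (r ^+ 2 * r)) * (p r)^-1.
pose Q r := X r - 1 + q1 r.
have r2 (r : R) : 0 < r < 1 -> 0 < r ^+ 2 < 1.
  by move=> /andP[r0 r1]; rewrite exprn_gt0//= exprn_ilt1// ltW.
have p1 (r : R) : 0 < r < 1 -> 1 <= p r <= 3.
  move=> r01; have /andP[a b] := r2 _ r01; have /andP[r0 r1] := r01; rewrite /p.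
  by apply/andP; split; nra.
have F0 x : 0 < x -> 0 < F x by move=> x0; rewrite mulr_gt0// expR_gt0.
have Fm x y : 0 <= x -> x <= y -> F x <= F y.
  move=> x0 xy; apply: ler_pM; rewrite ?expR_ge0// ler_expR ler_wpM2l// lerXn2r ?nnegrE//.
  exact: le_trans xy.
have Wm x y : 0 <= x -> x <= y -> W x <= W y.
  move=> x0 xy; have xy2 : x ^+ 2 <= y ^+ 2 by rewrite lerXn2r ?nnegrE// (le_trans x0).
  apply: ler_pM; rewrite ?expR_ge0//.
  - by rewrite addr_ge0// !mulr_ge0.
  - by rewrite lerD2l ler_wpM2l// mulr_ge0.
  - by rewrite ler_expR ler_wpM2l.
have W0 x : 0 < W x.
  by rewrite /W mulr_gt0 ?expR_gt0// (lt_le_trans ltr01)// lerDl mulr_ge0 ?sqr_ge0// mulr_ge0.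
have f0 (r : R) : 0 < r < 1 -> 0 < f r.
  by move=> /r2/h[_ _ /andP[v0 _] _]; exact: F0.
have K0 (r : R) : 0 < r < 1 -> 0 < K (r ^+ 2).
  move=> r01; have [_ _ _ /andP[k _]] := h _ (r2 _ r01); apply: lt_le_trans k.
  by apply: mulr_gt0; [case/andP: (r2 _ r01)|exact: f0].
have X02 (r : R) : 0 < r < 1 -> 0 < X r <= 2.
  move=> r01; have [_ _ _ /andP[k _]] := h _ (r2 _ r01); have /andP[a b] := r2 _ r01.
  have k0 := K0 _ r01; have fr := f0 _ r01; rewrite /X; apply/andP; split.
    by apply: divr_gt0 => //; apply: mulr_gt0 => //; exact: mulr_gt0.
  by rewrite ler_pdivrMr// ler_pM2l.
(* A lower bound for $3r+4X$: for $r\ge1/2$ the first term gives $3/2$; for $r<1/2$ the upper bound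
   on $K$ and the monotonicity of $f$ give $X\ge2f(1/2)/F(B)$. *)
pose d : R := Num.min (3 / 2) (8 * f (2^-1) / F B).
have h01 : 0 < (2^-1 : R) < 1 by rewrite invr_gt0 ltr0n/= invf_lt1// ltr1n.
have B0 : 0 < B by have [_ _ /andP[v0 vB] _] := h _ h01; exact: lt_le_trans vB.
have d0 : 0 < d by rewrite lt_min divr_gt0//= divr_gt0 ?F0// mulr_gt0// f0.
have dX (r : R) : 0 < r < 1 -> d <= 3 * r + 4 * X r.
  move=> r01; have /andP[x0 x2] := X02 _ r01; have /andP[r0 r1] := r01.
  have [rh|rh] := leP (2^-1) r.
    by apply: le_trans (_ : 3 / 2 <= _); [rewrite ge_min lexx|lra].
  apply: (@le_trans _ _ (8 * f (2^-1) / F B)); first by rewrite ge_min lexx orbT.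
  have [_ _ _ /andP[_ k]] := h _ (r2 _ r01); have /andP[a b] := r2 _ r01.
  apply: (@le_trans _ _ (4 * X r)); last by lra.
  rewrite -mulrA (_ : 8 = 4 * 2 :> R); last by ring.
  rewrite -mulrA ler_pM2l// /X -mulrA ler_pM2l//.
  rewrite ler_pdivrMr ?F0// mulrAC ler_pdivlMr ?K0//.
  apply: (@le_trans _ _ (f r * (r ^+ 2 * F B))); last by rewrite le_eqVlt; apply/orP; left; apply/eqP; ring.
  apply: ler_pM; rewrite ?(ltW (f0 _ _)) ?(ltW (K0 _ _))//.
  have [_ _ /andP[v0 _] _] := h _ (r2 _ h01).
  by apply: Fm; rewrite ?(ltW v0)// Vm//; [rewrite lerXn2r ?nnegrE ?ltW//|case/andP: (r2 _ h01)].
(* The gain is at least $rd/p$, and $p\le3$, $W\le W(B)$; so $c$ is what can be added to $1/I$. *)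
pose c := d / (3 * W B).
have c0 : 0 < c by rewrite divr_gt0// mulr_gt0.
(* Since $X-1$ lies in $]-1,1]$ and [q1] in $[-5,0]$, the bound 8 on $|Q|$ is generous. *)
exists Q, (I^-1 + c), 8; split; first by rewrite ltrDl.
move=> r r01; have /andP[r0 r1] := r01; have /andP[p1r p3r] := p1 _ r01; have /andP[x0 x2] := X02 _ r01.
split.
  have q10 : 0 <= - q1 r <= 5.
    rewrite /q1 mulNr opprK; apply/andP; split.
      by rewrite divr_ge0 ?(le_trans _ p1r)// addr_ge0// !mulr_ge0 ?sqr_ge0// ltW.
    have /andP[a b] := r2 _ r01.
    rewrite ler_pdivrMr ?(lt_le_trans _ p1r)//; nra.
  by rewrite /Q ler_norml; lra.
have [dV dK /andP[v0 vB] _] := h _ (r2 _ r01).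
have d2 := is_derive1_sqr r.
have df : is_derive r 1 f (W (V (r ^+ 2)) * (- (K (r ^+ 2) / r ^+ 2) / (4 * I) * (2 * r))).
  have dVr := is_derive1_compose d2 dV.
  exact: is_derive1_compose dVr (is_derive1_exp_sqr alpha (V (r ^+ 2))).
have dKr := is_derive1_compose d2 dK.
have dKi := is_derive1_inv (lt0r_neq0 (K0 _ r01)) dKr.
have dXr := is_derive1_mul (is_derive1_scale 2 (is_derive1_mul d2 df)) dKi.
have d3 := is_derive1_mul d2 (is_derive_id r 1).
have dp := is_derive1_sub (is_derive1_sub (is_derive_cst (3 : R) r 1) d2) d3.
have dn := is_derive1_opp (is_derive1_add (is_derive1_scale 2 d2) (is_derive1_scale 3 d3)).
have pn : p r != 0 by rewrite gt_eqF// (lt_le_trans _ p1r).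
have dq := is_derive1_mul dn (is_derive1_inv (f := p) pn dp).
have dQ := is_derive1_add (is_derive1_sub dXr (is_derive_cst (1 : R) r 1)) dq.
eexists; first exact: dQ.
have k0 := K0 _ r01; have fr := f0 _ r01.
(* The left side is the surplus of $wp$ over the equation with eigenvalue $1/I$. Its part $r(3r+4X)$
   already suffices; $6r^2X\ge0$ is dropped. *)
have key : (3 * r ^+ 2 + 2 * X r * (2 * r + 3 * r ^+ 2)) / p r >= c * (r * W (V (r ^+ 2))).
  have WB : W (V (r ^+ 2)) <= W B by apply: Wm => //; exact: ltW.
  have pg0 := lt_le_trans ltr01 p1r.
  rewrite ler_pdivlMr//.
  have h1 : c * (r * W (V (r ^+ 2))) * p r <= r * d.
    rewrite /c -[leRHS](mulfVK (x := 3 * W B)); last by rewrite gt_eqF// mulr_gt0.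
    rewrite (_ : _ * p r = d / (3 * W B) * r * (p r * W (V (r ^+ 2)))); last by ring.
    rewrite (_ : r * d / _ * _ = d / (3 * W B) * r * (3 * W B)); last by ring.
    rewrite ler_pM2l; last by rewrite mulr_gt0.
    by apply: ler_pM => //; [exact: ltW|exact: ltW].
  apply: (le_trans h1).
  have h2 : r * d <= r * (3 * r + 4 * X r) by rewrite ler_pM2l// dX.
  apply: (le_trans h2); have := mulr_ge0 (ltW x0) (sqr_ge0 r); nra.
move: key; rewrite /Q /q1; set P := p r in pn *.
rewrite -/(W (V (r ^+ 2))) -[V (r ^+ 2) * expR _]/(f r).
have XE : X r = 2 * (r ^+ 2 * f r) * (K (r ^+ 2))^-1 by [].
rewrite XE; move: (W (V (r ^+ 2))) (f r) (K (r ^+ 2)) k0 => w ff k k0; clearbody P => key.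
(* The two inequalities have equal differences of their sides, so what remains is an identity of
   rational functions. *)
rewrite -subr_ge0; move: key; rewrite -subr_ge0; congr (is_true (_ <= _)).
have kn := lt0r_neq0 k0; have rn := lt0r_neq0 r0; have In := lt0r_neq0 I0.
by clear -pn kn rn In; field; rewrite pn kn rn In.
Qed.

Lemma MVT_is_derive (R : realType) (f f' : R -> R) (a b : R) : a < b ->
  {within `[a, b], continuous f} -> (forall t : R, a < t -> t < b -> is_derive t 1 f (f' t)) ->
  exists2 c, a < c < b & f b - f a = f' c * (b - a).
Proof.
move=> ab cf df; have df' (t : R) : t \in `]a, b[%R -> is_derive t 1 f (f' t).
  by rewrite in_itv/= => /andP[at_ tb]; exact: df.
by have [c cab e] := MVT ab df' cf; exists c; [move: cab; rewrite in_itv|].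
Qed.

(* phi r phi' - phi^2 Q is nondecreasing. By the mean value theorem for phi^2 it
   takes values >= - e arbitrarily near 0 and <= e arbitrarily near 1, so it is 0. *)
Lemma picone_comparison (R : realType) (W Q phi : R -> R) (kappa C mu : R) (k : nat) :
  (forall r, 0 < r < 1 -> 0 < W r) ->
  (forall r : R, 0 < r < 1 -> `|Q r| <= C /\
    exists2 D, is_derive r 1 Q D & D <= r^-1 - kappa * (r * W r) - Q r ^+ 2 / r) ->
  (1 <= k)%N -> (exists2 r, 0 < r < 1 & phi r != 0) ->
  {within `[0, 1], continuous phi} -> phi 0 = 0 -> phi 1 = 0 ->
  (forall r : R, 0 < r < 1 -> is_derive r 1 phi (derive1 phi r)) ->
  (forall r : R, 0 < r < 1 ->
    is_derive r 1 (fun r => r * derive1 phi r) (k%:R ^+ 2 / r * phi r - mu * (r * W r * phi r))) ->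
  kappa <= mu.
Proof.
move=> W0 hQ k1 [r0 r001 pr0] cp p0 p1 dp dp2; rewrite leNgt; apply/negP => mk.
pose dphi : R -> R := derive1 phi.
pose B r := phi r * (r * dphi r) - phi r * phi r * Q r.
have dB (r : R) : 0 < r < 1 -> exists2 D, is_derive r 1 B D & (kappa - mu) * (r * W r * phi r ^+ 2) <= D.
  move=> r01; have [_ [D dQ DQ]] := hQ r r01; have d1 := dp r r01.
  have := is_derive1_sub (is_derive1_mul d1 (dp2 r r01)) (is_derive1_mul (is_derive1_mul d1 d1) dQ).
  set E := (X in is_derive _ _ _ X) => dE; exists E => //.
  have /andP[rp _] := r01.
  have k2 : (1 : R) <= k%:R ^+ 2 by rewrite expr_ge1// ler1n.
  have h1 : phi r ^+ 2 * D <= phi r ^+ 2 * (r^-1 - kappa * (r * W r) - Q r ^+ 2 / r).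
    by rewrite ler_wpM2l// sqr_ge0.
  have h2 : phi r ^+ 2 * r^-1 <= k%:R ^+ 2 * (phi r ^+ 2 * r^-1).
    by rewrite ler_peMl// mulr_ge0 ?sqr_ge0// invr_ge0 ltW.
  have h3 : 0 <= (r * dphi r - Q r * phi r) ^+ 2 / r by rewrite divr_ge0 ?sqr_ge0// ltW.
  (* Completing the square: the excess is the sum of the defect of the supersolution, the term in
     $k^2-1$, and $(r\phi'-Q\phi)^2/r$, all nonnegative. *)
  have : E - (kappa - mu) * (r * W r * phi r ^+ 2) =
    (phi r ^+ 2 * (r^-1 - kappa * (r * W r) - Q r ^+ 2 / r) - phi r ^+ 2 * D) +
    (k%:R ^+ 2 * (phi r ^+ 2 * r^-1) - phi r ^+ 2 * r^-1) +
    (r * dphi r - Q r * phi r) ^+ 2 / r.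
    by rewrite /E /dphi; field; rewrite gt_eqF.
  move=> e; rewrite -subr_ge0 e; apply: addr_ge0 => //; apply: addr_ge0; rewrite subr_ge0; [exact: h1|exact: h2].
have B0' (r : R) : 0 < r < 1 -> 0 <= (kappa - mu) * (r * W r * phi r ^+ 2).
  move=> r01; rewrite mulr_ge0 ?subr_ge0 ?(ltW mk)// mulr_ge0 ?sqr_ge0// mulr_ge0 ?ltW ?W0//.
  by case/andP: r01.
have Bm (s t : R) : 0 < s -> s < t -> t < 1 -> B s <= B t.
  move=> s0 st t1.
  pose B' : R -> R := derive1 B.
  have dB' (r : R) : 0 < r < 1 -> is_derive r 1 B (B' r) /\ 0 <= B' r.
    move=> r01; have [D dD hD] := dB r r01; rewrite /B' (derive1_val dD); split => //.
    exact: le_trans (B0' r r01) hD.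
  have [|r ra rb|c /andP[sc ct] e] := @MVT_is_derive _ B B' s t st.
  - apply: continuous_itv_within => r sr rt; apply: (is_derive1_cts (l := B' r)).
    by apply: (dB' r _).1; rewrite (lt_le_trans s0 sr) (le_lt_trans rt t1).
  - by apply: (dB' r _).1; rewrite (lt_trans s0 ra) (lt_trans rb t1).
  rewrite -subr_ge0 e mulr_ge0 ?subr_ge0 ?(ltW st)//.
  by apply: (dB' c _).2; rewrite (lt_trans s0 sc) (lt_trans ct t1).
have cp2 a b : 0 <= a -> b <= 1 -> {within `[a, b], continuous (fun r => phi r * phi r)}.
  move=> a0 b1.
  have cp' : {within `[a, b], continuous phi}.
    apply: continuous_subspaceW cp => t /=; rewrite !in_itv/= => /andP[at_ tb].
    by rewrite (le_trans a0 at_) (le_trans tb b1).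
  by move=> t; apply: cvgM; exact: cp'.
have dp22 (r : R) : 0 < r < 1 -> is_derive r 1 (fun r => phi r * phi r) (2 * (phi r * dphi r)).
  move=> r01; have d1 := dp r r01; have := is_derive1_mul d1 d1.
  by congr (is_derive _ _ _ _); rewrite /dphi; ring.
have [cl cr] : phi x @[x --> 0^'+] --> 0 /\ phi x @[x --> 1^'-] --> 0.
  by have /(continuous_within_itvP _ ltr01)[_] := cp; rewrite p0 p1.
have C0 : 0 <= C by have [h _] := hQ r0 r001; exact: le_trans h.
have small e : 0 < e -> exists2 d, 0 < d & forall x, `|x| <= d -> x ^+ 2 * C <= e.
  move=> e0; pose d := Num.min 1 (e / (C + 1)).
  have d0 : 0 < d by rewrite lt_min ltr01 divr_gt0// ltr_wpDl.
  exists d => // x xd; rewrite -real_normK ?num_real//.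
  have x0 := normr_ge0 x.
  have h1 : `|x| <= 1 by apply: le_trans xd _; rewrite ge_min lexx.
  have : `|x| <= e / (C + 1) by apply: le_trans xd _; rewrite ge_min lexx orbT.
  rewrite ler_pdivlMr ?ltr_wpDl// => h2.
  have := mulr_ge0 x0 C0; nra.
have lower e s : 0 < e -> 0 < s -> s < 1 -> exists2 x, 0 < x < s & - e <= B x.
  move=> e0 s0 s1; have [d d0 hd] := small e e0.
  have [b /andP[b0 bs] hb] : exists2 b, 0 < b < s & forall x, 0 < x < b -> `|phi x| <= d.
    have /cvgr0Pnorm_le/(_ d d0) := cl.
    move=> [eta /= eta0 heta]; exists (Num.min (s / 2) eta).
      by rewrite lt_min eta0 divr_gt0//= gt_min; apply/orP; left; lra.
    move=> x /andP[x0]; rewrite lt_min => /andP[xs xe]; apply: heta => //=.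
    by rewrite sub0r normrN gtr0_norm.
  (* As $\phi^2$ goes from 0 to a nonnegative value, $\phi\phi'\ge0$ at some intermediate point.
     There $B\ge-\phi^2Q\ge-e$, whatever the size of $\phi'$. *)
  have [|r ra rb|x /andP[x0 xb] e1] := @MVT_is_derive _ (fun r => phi r * phi r) (fun r => 2 * (phi r * dphi r)) 0 b b0.
  - by apply: cp2 => //; rewrite ltW// (lt_trans bs).
  - by apply: dp22; rewrite ra (lt_trans rb)// (lt_trans bs).
  have x01 : 0 < x < 1 by rewrite x0 (lt_trans xb)// (lt_trans bs).
  exists x; first by rewrite x0 (lt_trans xb).
  have h1 : 0 <= phi x * dphi x.
    move: e1; rewrite p0 mulr0 !subr0 => e1.
    have : 0 <= 2 * (phi x * dphi x) * b by rewrite -e1 -expr2 sqr_ge0.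
    by rewrite pmulr_lge0// pmulr_rge0.
  have [+ _] := hQ x x01; rewrite ler_norml => /andP[_ h2].
  have h3 : phi x ^+ 2 * C <= e by apply: hd; apply: hb; rewrite x0.
  have h4 : phi x * phi x * Q x <= phi x ^+ 2 * C by rewrite -expr2 ler_wpM2l// sqr_ge0.
  have h5 : 0 <= x * (phi x * dphi x) by rewrite mulr_ge0// ltW.
  rewrite /B mulrCA; lra.
have upper e s : 0 < e -> 0 < s -> s < 1 -> exists2 x, s < x < 1 & B x <= e.
  move=> e0 s0 s1; have [d d0 hd] := small e e0.
  have [b /andP[b0 bs] hb] : exists2 b, s < b < 1 & forall x, b < x < 1 -> `|phi x| <= d.
    have /cvgr0Pnorm_le/(_ d d0) := cr.
    move=> [eta /= eta0 heta]; exists (Num.max ((s + 1) / 2) (1 - eta)).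
      by rewrite lt_max gt_max; apply/andP; split; [apply/orP; left; lra|apply/andP; split; lra].
    move=> x /andP[+ x1]; rewrite gt_max => /andP[xs xe]; apply: heta => //=.
    by rewrite gtr0_norm ?subr_gt0//; lra.
  have b00 := lt_trans s0 b0.
  have [|r ra rb|x /andP[x0 xb] e1] := @MVT_is_derive _ (fun r => phi r * phi r) (fun r => 2 * (phi r * dphi r)) b 1 bs.
  - by apply: cp2 => //; rewrite ltW.
  - by apply: dp22; rewrite (lt_trans _ ra).
  have x01 : 0 < x < 1 by rewrite xb (lt_trans _ x0).
  exists x; first by rewrite xb (lt_trans b0).
  have h1 : phi x * dphi x <= 0.
    move: e1; rewrite p1 mulr0 !sub0r => e1.
    have : 2 * (phi x * dphi x) * (1 - b) <= 0 by rewrite -e1 -expr2 oppr_le0 sqr_ge0.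
    by rewrite pmulr_lle0 ?subr_gt0// pmulr_rle0.
  have [+ _] := hQ x x01; rewrite ler_norml => /andP[h2 _].
  have h3 : phi x ^+ 2 * C <= e by apply: hd; apply: hb; rewrite x0.
  have h4 : phi x * phi x * - Q x <= phi x ^+ 2 * C.
    by rewrite -expr2 ler_wpM2l ?sqr_ge0// lerNl.
  have h5 : x * (phi x * dphi x) <= 0 by rewrite pmulr_rle0//; case/andP: x01.
  rewrite /B mulrCA; lra.
have BE s : 0 < s -> s < 1 -> B s = 0.
  move=> s0 s1; apply/le_anti/andP; split; apply/ler_addgt0Pr => e e0; rewrite ?add0r.
    have [x /andP[sx x1] h] := upper e s e0 s0 s1.
    exact: le_trans (Bm s x s0 sx x1) h.
  have [x /andP[x0 xs] h] := lower e s e0 s0 s1.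
  by have := le_trans h (Bm x s x0 xs s1); rewrite lerNl -subr_ge0 opprK addrC.
have [D dD hD] := dB r0 r001; have /andP[r00 r01] := r001.
(* [B] is identically 0 on $]0,1[$, whereas its derivative at $r_0$ is at least
   $(\kappa-\mu)r_0W(r_0)\phi(r_0)^2>0$: a contradiction. *)
have : is_derive r0 1 B 0.
  apply: (@is_derive1_itv_eq _ (fun=> 0) _ 0 1) => // s s0 s1; by rewrite BE.
move=> /derive1_val; rewrite (derive1_val dD) => D0; move: hD; rewrite D0 leNgt.
have p2 : 0 < phi r0 ^+ 2 by rewrite exprn_even_gt0.
by rewrite mulr_gt0 ?subr_gt0// mulr_gt0// mulr_gt0// W0.
Qed.

(** * The Sturm-Liouville problem in the variable r *)

(** Squaring expands lengths on $[a,+\infty[$ by at least $2a$. The ends of the interval are first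
    raised to $a^2$ so that their square roots stay in that half-line. *)
Lemma sqr_preimage_length (R : realType) (a x y : R) : 0 < a -> x < y ->
  (leb R ([set r : R | (x < r ^+ 2 <= y)%R] `&` `[a, +oo[) <= ((2 * a)^-1 * (y - x))%:E)%E.
Proof.
move=> a0 xy.
pose m := Num.max x (a ^+ 2); pose M := Num.max y (a ^+ 2).
have m0 : a ^+ 2 <= m by rewrite le_max lexx orbT.
have mM : m <= M by rewrite ge_max !le_max lexx orbT (ltW xy).
have a20 : 0 <= a ^+ 2 by rewrite sqr_ge0.
have M0 := le_trans m0 mM.
have am : a <= Num.sqrt m by rewrite -[leLHS](ger0_norm (ltW a0)) -sqrtr_sqr ler_wsqrtr.
have sM : Num.sqrt m <= Num.sqrt M by rewrite ler_wsqrtr.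
have h : Num.sqrt M - Num.sqrt m <= (2 * a)^-1 * (y - x).
  rewrite ler_pdivlMl ?mulr_gt0//.
  have e1 := sqr_sqrtr (le_trans a20 m0); have e2 := sqr_sqrtr (le_trans a20 M0).
  have h1 : M - m <= y - x.
    rewrite /M /m; have [ya|ya] := leP y (a ^+ 2); have [xa|xa] := leP x (a ^+ 2); lra.
  nra.
apply: (@le_trans _ _ (leb R `[Num.sqrt m, Num.sqrt M]%classic)).
  apply: le_outer_measure => r /= -[/andP[xr ry]]; rewrite !in_itv/= andbT => ar.
  have r0 := le_trans (ltW a0) ar.
  have ar2 : a ^+ 2 <= r ^+ 2 by rewrite lerXn2r// nnegrE ltW.
  rewrite -(ger0_norm r0) -sqrtr_sqr !ler_wsqrtr//; first by rewrite le_max ry.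
  by rewrite ge_max (ltW xr).
rewrite lebesgue_measure_itv/= lte_fin; case: ifP => _; first by rewrite -EFinB lee_fin.
by rewrite lee_fin mulr_ge0 ?invr_ge0 ?mulr_ge0 ?subr_ge0// ltW.
Qed.

(** A cover of $N$ by half-open intervals of total length below $2ae$ pulls back to a cover of total
    length at most $e$. *)
Lemma lebesgue_null_sqr (R : realType) (N : set R) (a : R) : 0 < a ->
  leb R N = 0%E ->
  leb R ([set r | N (r ^+ 2)%R] `&` `[a, +oo[) = 0%E.
Proof.
move=> a0 N0; apply/eqP; rewrite eq_le outer_measure_ge0 andbT.
apply/lee_addgt0Pr => e e0; rewrite add0e.
have a2 : 0 < 2 * a by rewrite mulr_gt0.
have : (leb R N < (2 * a * e)%:E)%E by rewrite N0 lte_fin mulr_gt0.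
move=> /ereal_inf_lt[z [/= A [mA NA] <-] zlt].
pose J n := [set r | A n (r ^+ 2)] `&` `[a, +oo[.
apply: (@le_trans _ _ (\sum_(n <oo) leb R (J n))%E).
  apply: (@le_trans _ _ (leb R (\bigcup_n J n))).
    apply: le_outer_measure => r /= [Nr ar]; have [n _ An] := NA _ Nr.
    by exists n.
  exact: outer_measure_sigma_subadditive.
apply: (@le_trans _ _ (\sum_(n <oo) ((2 * a)^-1)%:E * wlength idfun (A n))%E).
  apply: lee_nneseries => [n _ _|n _]; first exact: outer_measure_ge0.
  have /ocitvP[E|[[x y] /= xy E]] : ocitv (A n) by exact: mA.
    rewrite /J E (_ : _ `&` _ = set0); last by apply/seteqP; split => // r [].
    by rewrite wlength0 mule0 measure0.
  rewrite E wlength_itv/= lte_fin xy -EFinB.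
  apply: le_trans (sqr_preimage_length a0 xy); rewrite /J E le_eqVlt; apply/orP; left; apply/eqP.
  by congr (lebesgue_measure (_ `&` _)); apply/seteqP; split => r /=; rewrite in_itv.
rewrite nneseriesZl; last by move=> n _; exact: wlength_ge0.
rewrite lee_pdivrMl// -EFinM; exact: ltW.
Qed.

(** The eigenvalue problem lives in $r$ and the equation of the profile in $t=r^2$, so exceptional
    null sets must be pulled back through squaring. This map contracts near 0, hence the exhaustion
    by the half-lines $r\ge1/(n+1)$. *)
Lemma ae_sqr (R : realType) (P : R -> Prop) : {ae leb R, forall t, 0 < t < 1 -> P t} ->
  {ae leb R, forall r, 0 < r < 1 -> P (r ^+ 2)}.
Proof.
move=> [N [mN N0 sN]].
pose S n := [set r : R | N (r ^+ 2)%R] `&` `[n.+1%:R^-1, +oo[.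
exists (\bigcup_n S n).
have a0 n : 0 < n.+1%:R^-1 :> R by rewrite invr_gt0.
have mS n : measurable (S n : set (measurableTypeR R)).
  apply: measurableI => //; rewrite -[X in measurable X]setTI.
  have : measurable_fun setT (fun r : R => r ^+ 2) by apply: measurable_funX.
  exact.
split; first exact: bigcupT_measurable.
  apply/eqP; rewrite eq_le outer_measure_ge0 andbT.
  apply: (le_trans (outer_measure_sigma_subadditive _ _)).
  rewrite eseries0// => n _ _; exact: lebesgue_null_sqr.
move=> r /= /not_implyP[/andP[r0 r1] nP].
have [n nr] := ltr_add_invr r0.
exists n => //; split; last by rewrite /= in_itv/= andbT; move: nr; rewrite add0r => /ltW.
apply: sN => /=; apply/not_implyP; split => //.
by rewrite exprn_gt0//= exprn_ilt1// ltW.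
Qed.

(** The weight computed from the regular representative [V] in place of the values of [u], with
    which it agrees only almost everywhere. *)
Definition smooth_weight (R : realType) (alpha : R) (V : R -> R) (r : R) : R :=
  (1 + 2 * alpha * V (r ^+ 2) ^+ 2) * expR (alpha * V (r ^+ 2) ^+ 2).

Lemma smooth_weight_gt0 (R : realType) (alpha : R) (V : R -> R) (r : R) : 0 <= alpha ->
  0 < smooth_weight alpha V r.
Proof.
by move=> al; rewrite mulr_gt0 ?expR_gt0// (lt_le_trans ltr01)// lerDl mulr_ge0 ?sqr_ge0// mulr_ge0.
Qed.

(** A null set does not affect the integrated equation, so the weight may be replaced by the
    continuous one. The integrand is then continuous and the fundamental theorem gives the equation
    at every point. *)
Lemma sl_eigen_derivable (R : realType) (alpha mu : R) (u : R * R -> R) (k : nat) (V phi : R -> R) :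
  {ae leb R, forall t, 0 < t < 1 -> radial_profile u t = V t} ->
  (forall t, 0 < t < 1 -> {for t, continuous V}) ->
  SL_eigen alpha u k mu phi ->
  forall r : R, 0 < r < 1 -> is_derive r 1 (fun r => r * derive1 phi r)
    (k%:R ^+ 2 / r * phi r - mu * (r * smooth_weight alpha V r * phi r)).
Proof.
move=> uV cV [_ _ dphi hphi] r r01.
pose F r := k%:R ^+ 2 / r * phi r - mu * (r * weight alpha u r * phi r).
pose F' (r : R) := k%:R ^+ 2 / r * phi r - mu * (r * smooth_weight alpha V r * phi r).
have FF' : {ae leb R, forall r, 0 < r < 1 -> F r = F' r}.
  have := ae_sqr uV; apply: ae_imply => s h s01; rewrite /F /F' /smooth_weight /weight -h//.
  by rewrite /radial_profile /profile sqrtr_sqr gtr0_norm//; case/andP: s01.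
have cF' (s : R) : 0 < s < 1 -> {for s, continuous F'}.
  move=> s01; have [s0 s1] := andP s01.
  have cp : {for s, continuous phi}.
    by apply/differentiable_continuous/derivable1_diffP; exact: dphi.
  have cV2 : {for s, continuous (fun r : R => V (r ^+ 2))}.
    apply: (@continuous_comp _ _ _ (fun r : R => r ^+ 2) V); first exact: exprn_continuous.
    by apply: cV; rewrite exprn_gt0//= exprn_ilt1// ltW.
  have cV3 : {for s, continuous (fun r : R => V (r ^+ 2) ^+ 2)}.
    by rewrite (_ : (fun _ => _) = (fun r => V (r ^+ 2) * V (r ^+ 2))); [apply: cvgM|apply/funext => x; rewrite expr2].
  apply: cvgB.
    apply: cvgM => //; apply: cvgM; first exact: cvg_cst.
    by apply: cvgV; [rewrite gt_eqF|exact: cvg_id].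
  apply: cvgM; first exact: cvg_cst.
  apply: cvgM => //; apply: cvgM; first exact: cvg_id.
  apply: cvgM.
    apply: cvgD; first exact: cvg_cst.
    by apply: cvgM; [exact: cvg_cst|exact: cV3].
  apply: continuous_comp; last exact: continuous_expR.
  by apply: cvgM; [exact: cvg_cst|exact: cV3].
have [r0 r1] := andP r01.
pose a := r / 2; pose b := (r + 1) / 2.
have a0 : 0 < a by rewrite divr_gt0.
have ar : a < r by rewrite /a; lra.
have rb : r < b by rewrite /b; lra.
have b1 : b < 1 by rewrite /b; lra.
have iF' (c : R) : c < 1 -> (leb R).-integrable `[a, c] (EFin \o F').
  move=> c1; apply: integrable_continuous_itv => t at_ tc; apply: cF'.
  by rewrite (lt_le_trans a0 at_) (le_lt_trans tc c1).
(* Around $r$, the function $x\phi'(x)$ equals its value at $a$ plus the integral of the continuous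
   [F'] from $a$ to $x$. *)
apply: (@is_derive1_itv_eq _ (fun x => a * derive1 phi a + \int[leb R]_(t in `[a, x]) F' t) _ a b) => //.
  move=> x ax xb; have x1 := lt_trans xb b1.
  have [iF e] := hphi a x a0 ax x1.
  apply/eqP; rewrite eq_sym addrC -subr_eq e; apply/eqP.
  rewrite /Rintegral; congr fine; apply: ae_eq_integral => //.
  - exact: measurable_int iF.
  - exact: measurable_int (iF' x x1).
  move: FF'; apply: ae_imply => t h /=; rewrite in_itv/= => /andP[at_ tx].
  by rewrite -[LHS]/((F t)%:E) h// (lt_le_trans a0 at_) (le_lt_trans tx x1).
have [d dE] := continuous_FTC1_closed rb (iF' b b1) ar (cF' r r01).
rewrite -[X in is_derive _ _ _ X]add0r.
apply: is_derive1_add.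
apply: DeriveDef; [exact: d|by rewrite -derive1E dE].
Qed.

(** * The two bounds and the conclusion *)

Lemma lambda2_ge (R : realType) (alpha kappa : R) (u : R * R -> R) :
  (forall k mu phi, (1 <= k)%N -> SL_eigen alpha u k mu phi -> kappa <= mu) ->
  (kappa%:E <= lambda2 alpha u)%E.
Proof.
move=> h; apply: le_ereal_inf_tmp => _ [k /= k1 <-].
by apply: le_ereal_inf_tmp => _ [mu [phi hphi] <-]; rewrite lee_fin; exact: h k1 hphi.
Qed.

Lemma Lambda1_le (R : realType) (alpha : R) (u : R * R -> R) (g : R * R -> R * R) :
  0 <= alpha -> radial u -> (forall p, disk R p -> 0 < u p) -> W012 u g -> (norm_vec g <= 1)%E ->
  (Lambda1 alpha u <= ((\int[@leb2 R]_(p in disk R) (u p ^+ 2 * expR (alpha * u p ^+ 2)))^-1)%:E)%E.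
Proof.
move=> al ru u0 W0 ng; have mD := @measurable_disk R.
have [W _] := W0; have [_ Lg1 Lg2 _] := W.
have iU := integrable_sqr_exp ru W al.
set I := Rintegral _ _ _.
have I0 : 0 < I by apply: Rintegral_disk_gt0 => // p Dp; rewrite mulr_gt0 ?exprn_gt0 ?expR_gt0 ?u0.
move: ng; rewrite norm_vec_le1//; set G := Rintegral _ _ _ => G1.
apply: (@le_trans _ _ (G / I)%:E); last by rewrite lee_fin ler_piMl// invr_ge0 ltW.
apply: ereal_inf_lbound; exists u, g; split => //.
  by apply: disk_not_negligible => p /u0/lt0r_neq0/eqP.
rewrite sqnorm_vecE//.
have -> : (\int[@leb2 R]_(p in disk R) (u p ^+ 2 * expR (alpha * u p ^+ 2))%:E = I%:E)%E.
  by rewrite /I /Rintegral fineK//; exact: (integrable_fin_num mD iU).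
by rewrite inver gt_eqF// -EFinM.
Qed.

Theorem lemma20 (R : realType) (alpha : R) (u : R * R -> R)
  (alpha_gt0 : 0 < alpha) (alpha_le : alpha <= 4 * pi)
  (u_opt : optimizers alpha u) (u_rad : radial u)
  (u_pos : forall p : R * R, disk R p -> 0 < u p) :
  (Lambda1 alpha u < lambda2 alpha u)%E.
Proof.
have [[g [W0 ng]] uTM] := u_opt; have [W _] := W0; have al := ltW alpha_gt0.
have EL := euler_lagrange alpha_gt0 u_rad u_pos uTM W0 ng.
have L1 := Lambda1_le al u_rad u_pos W0 ng.
have I0 : 0 < \int[@leb2 R]_(p in disk R) (u p ^+ 2 * expR (alpha * u p ^+ 2)).
  apply: Rintegral_disk_gt0; first exact: integrable_sqr_exp u_rad W al.
  by move=> p Dp; rewrite mulr_gt0 ?exprn_gt0 ?expR_gt0 ?u_pos.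
have [V [K [B [uV Vm hVK]]]] := profile_ode al I0 u_rad u_pos W EL.
have [Q [kappa [C [Ik hQ]]]] := riccati_supersolution al I0 Vm hVK.
apply: (le_lt_trans L1); apply: (@lt_le_trans _ _ kappa%:E); first by rewrite lte_fin.
apply: lambda2_ge => k mu phi k1 hphi.
have [nz [cp [p0 p1]] dp _] := hphi.
apply: (@picone_comparison _ (smooth_weight alpha V) Q phi kappa C mu k) => //.
- by move=> r _; exact: smooth_weight_gt0.
- by move=> r r01; apply: DeriveDef; [exact: dp|rewrite derive1E].
- apply: (sl_eigen_derivable uV) hphi => t t01.
  by have [dV _ _ _] := hVK t t01; exact: is_derive1_cts dV.
Qed.
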